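(* Let $0<q<1$, $0<k_1\le k_2$, $m\in\mathbb{Z}$, $n\in\mathbb{Z}_{\ge0}$, $s\in\mathbb{R}$ with $|s|\ge q^{-1}$, and $\cos\theta,\cos\psi\in[-1,1]$ ($\theta,\psi$ real). Then, with the convention $s_{-j}=0$ for $j\ge1$, $$ \sum_{p=0}^\infty c_p\, s_{n+m}\big(\cos\theta;sq^{2k_1-2k_2-2p},q^{2k_1+2k_2+2p}/s\,|\,q^2\big)\, s_n\big(\mu(q^{2k_2+2p}/s);sq^{-2k_2},q^{-2k_2}/s\,|\,q^{-2}\big) $$ $$ \times p_p\big(\cos\psi;qe^{i\theta}/s,qe^{-i\theta}/s,q^{2k_2-2k_1+1},q^{2k_1+2k_2-1}\,|\,q^2\big) $$ $$ = P_n\big(\cos\psi;q^{2k_1-2k_2+2m+1},q^{2k_1+2k_2-1},q^{2k_2-2k_1+1}\,|\,q^2\big)\; {}_2\varphi_2\!\left({qe^{i(\theta-\psi)}/s,\ qe^{i(\theta+\psi)}/s\atop q^2/s^2,\ q^{2k_2-2k_1-2m+2}e^{i\theta}/s};q^2,\,q^{2k_2-2k_1-2m+2}e^{-i\theta}/s\right), $$ where $$ c_p=\frac{(q^{4k_2+2}/s^2;q^2)_{2p}\,\big|(q^{2k_2-2k_1+2p+2}e^{i\theta}/s;q^2)_\infty\big|^2}{(q^2,\,q^2/s^2,\,q^{4k_2+2p}/s^2;q^2)_p}\,\big(q^{2k_2-2k_1+3}/s^2\big)^p q^{2p(p-1)} $$ $$ \times\frac{(-1)^{n+m}q^{n(1+2k_2)}(sq^{2k_1-2k_2})^{-m}q^{n(n-1)-m(m-1)}}{(q^{4k_2+2}/s^2,\,q^{2k_2-2k_1-2m+2}e^{i\theta}/s;q^2)_\infty}.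 $$
   Context: Notation: $\mu(y)=\tfrac12(y+y^{-1})$. For a base $Q$, $(x;Q)_k=\prod_{j=0}^{k-1}(1-xQ^j)$ (with $k=\infty$ allowed if $|Q|<1$), and $(x_1,\dots,x_r;Q)_k=\prod_i(x_i;Q)_k$. $${}_2\varphi_2\!\left({A,B\atop C,D};Q,z\right)=\sum_{k=0}^\infty\frac{(A,B;Q)_k}{(Q,C,D;Q)_k}(-1)^kQ^{k(k-1)/2}z^k .$$ As usual for such series, parameters are understood to be such that no denominator vanishes. Askey-Wilson polynomials in base $Q$: $$p_n(\cos\phi;a,b,c,d|Q)=a^{-n}(ab,ac,ad;Q)_n\sum_{k=0}^n\frac{(Q^{-n},abcdQ^{n-1},ae^{i\phi},ae^{-i\phi};Q)_k}{(Q,ab,ac,ad;Q)_k}Q^k .$$ Here $\phi$ may be complex, $\cos\phi=\mu(e^{i\phi})$; $p_n$ is a polynomial in $\cos\phi$ and in the parameters, symmetric in $a,b,c,d$ (this defines it whenever a denominator in its defining sum vanishes). Continuous dual $q$-Hahn polynomials: $P_n(x;a,b,c|Q)=p_n(x;a,b,c,0|Q)$. Al-Salam and Chihara polynomials: $s_n(x;a,b|Q)=p_n(x;a,b,0,0|Q)$ for $n\ge0$, i.e. $$s_n(\cos\phi;a,b|Q)=a^{-n}(ab;Q)_n\sum_{k=0}^n\frac{(Q^{-n},ae^{i\phi},ae^{-i\phi};Q)_k}{(Q,ab;Q)_k}Q^k ,$$ and $s_{-j}=0$ for $j\ge1$. These are used both for $Q=q^2$ and for $Q=q^{-2}$.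
   Formalization: The condition n+m ≥ 0 is added: for n+m < 0 every term on the left is zero by the convention s_{-j}=0, while the right side is in general nonzero (n=0, m=-1, s large: P_0=1 and the 2φ2 series tends to 1). *)

(* Defs.v *)
From Stdlib Require Import Reals ZArith Lia Lra.
From Coquelicot Require Import Coquelicot.
Open Scope R_scope.

Definition mu (y : C) : C := ((y + / y) / 2)%C.

Definition cis (t : R) : C := (cos t, sin t).

Fixpoint qpoch (x Q : C) (k : nat) : C :=
  match k with
  | O => 1%C
  | S j => (qpoch x Q j * (1 - x * Q ^ j))%C
  end.

(* Limits and sums in C are taken componentwise; as for [Lim_seq] and [Series],
   the value is meaningful only when the sequence or series converges. *)
Definition qpoch_inf (x Q : C) : C :=
  (real (Lim_seq (fun k => Re (qpoch x Q k))),
   real (Lim_seq (fun k => Im (qpoch x Q k)))).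

Definition CSeries (u : nat -> C) : C :=
  (Series (fun k => Re (u k)), Series (fun k => Im (u k))).

Definition phi22 (A B D E Q z : C) : C :=
  CSeries (fun k =>
    qpoch A Q k * qpoch B Q k / (qpoch Q Q k * qpoch D Q k * qpoch E Q k)
    * (-1) ^ k * Q ^ (k * (k - 1) / 2)%nat * z ^ k)%C.

(* (a y, a / y; Q)_k as a polynomial in x = mu y; see [qpoch_pair_mu]. *)
Fixpoint qpoch_pair (a x Q : C) (k : nat) : C :=
  match k with
  | O => 1%C
  | S j => (qpoch_pair a x Q j * (1 - 2 * (a * Q ^ j) * x + (a * Q ^ j) ^ 2))%C
  end.

(* The quotients (ab;Q)_n / (ab;Q)_k, and likewise for ac and ad, are written as
   (ab Q^k;Q)_(n-k), so that the value is the polynomial one also when ab, ac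
   or ad is a nonpositive power of Q; see [askey_wilson_mu] for the usual form. *)
Definition askey_wilson (n : nat) (x a b c d Q : C) : C :=
  (/ a ^ n *
   sum_n (fun k =>
     qpoch (/ Q ^ n) Q k * qpoch (a * b * c * d * Q ^ n / Q) Q k
     * qpoch_pair a x Q k / qpoch Q Q k
     * qpoch (a * b * Q ^ k) Q (n - k)
     * qpoch (a * c * Q ^ k) Q (n - k)
     * qpoch (a * d * Q ^ k) Q (n - k)
     * Q ^ k) n)%C.

Definition cont_dual_q_hahn (n : nat) (x a b c Q : C) : C :=
  askey_wilson n x a b c 0%C Q.

Definition al_salam_chihara (N : Z) (x a b Q : C) : C :=
  if (N <? 0)%Z then 0%C else askey_wilson (Z.to_nat N) x a b 0%C 0%C Q.

Definition coef (q k1 k2 s theta : R) (m : Z) (n p : nat) : C :=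
  let Q := RtoC (q ^ 2) in
  let e := cis theta in
  (qpoch (Rpower q (4 * k2 + 2) / s ^ 2)%R Q (2 * p)
   * RtoC (Cmod (qpoch_inf ((Rpower q (2 * k2 - 2 * k1 + 2 * INR p + 2))%R * e / s) Q) ^ 2)
   / (qpoch Q Q p
      * qpoch (q ^ 2 / s ^ 2)%R Q p
      * qpoch (Rpower q (4 * k2 + 2 * INR p) / s ^ 2)%R Q p)
   * RtoC ((Rpower q (2 * k2 - 2 * k1 + 3) / s ^ 2) ^ p
           * Rpower q (2 * INR p * (INR p - 1)))
   * (RtoC (powerRZ (-1) (Z.of_nat n + m)
            * Rpower q (INR n * (1 + 2 * k2))
            * powerRZ (s * Rpower q (2 * k1 - 2 * k2)) (- m)
            * Rpower q (INR n * (INR n - 1) - IZR m * (IZR m - 1)))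
      / (qpoch_inf (Rpower q (4 * k2 + 2) / s ^ 2)%R Q
         * qpoch_inf ((Rpower q (2 * k2 - 2 * k1 - 2 * IZR m + 2))%R * e / s) Q)))%C.

Lemma qpoch_pair_mu (a y Q : C) (k : nat) : y <> 0%C ->
  qpoch_pair a (mu y) Q k = (qpoch (a * y) Q k * qpoch (a / y) Q k)%C.
Proof.
intros Hy; induction k as [|k IH]; simpl.
- ring.
- rewrite IH; unfold mu; field; exact Hy.
Qed.

Lemma qpoch_add (x Q : C) (k l : nat) :
  qpoch x Q (k + l) = (qpoch x Q k * qpoch (x * Q ^ k) Q l)%C.
Proof.
induction l as [|l IH].
- rewrite Nat.add_0_r; simpl; ring.
- rewrite Nat.add_succ_r; simpl; rewrite IH, Cpow_add_r; ring.
Qed.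

Lemma cis_inv (t : R) : (/ cis t)%C = cis (- t).
Proof.
pose proof (sin2_cos2 t) as H; unfold Rsqr in H.
unfold cis; rewrite cos_neg, sin_neg; unfold Cinv; simpl.
replace (cos t * (cos t * 1) + sin t * (sin t * 1)) with 1 by lra.
apply injective_projections; simpl; field.
Qed.

Lemma mu_cis (t : R) : mu (cis t) = RtoC (cos t).
Proof.
unfold mu; rewrite cis_inv; unfold cis; rewrite cos_neg, sin_neg.
apply injective_projections; simpl; field.
Qed.

Lemma askey_wilson_mu (n : nat) (y a b c d Q : C) : y <> 0%C ->
  (forall k, (k <= n)%nat -> qpoch (a * b) Q k <> 0%C) ->
  (forall k, (k <= n)%nat -> qpoch (a * c) Q k <> 0%C) ->
  (forall k, (k <= n)%nat -> qpoch (a * d) Q k <> 0%C) ->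
  (forall k, (k <= n)%nat -> qpoch Q Q k <> 0%C) ->
  askey_wilson n (mu y) a b c d Q =
  (/ a ^ n * (qpoch (a * b) Q n * qpoch (a * c) Q n * qpoch (a * d) Q n) *
   sum_n (fun k =>
     qpoch (/ Q ^ n) Q k * qpoch (a * b * c * d * Q ^ n / Q) Q k
     * qpoch (a * y) Q k * qpoch (a / y) Q k
     / (qpoch Q Q k * qpoch (a * b) Q k * qpoch (a * c) Q k * qpoch (a * d) Q k)
     * Q ^ k) n)%C.
Proof.
intros Hy Hb Hc Hd HQ; unfold askey_wilson.
rewrite <- (Cmult_assoc (/ a ^ n)%C); f_equal.
etransitivity; [|apply (sum_n_mult_l (K := C_Ring))].
apply sum_n_ext_loc; intros k Hk.
assert (E : forall x, qpoch x Q n = (qpoch x Q k * qpoch (x * Q ^ k) Q (n - k))%C).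
{ intro x; rewrite <- qpoch_add; f_equal; lia. }
rewrite (qpoch_pair_mu a y Q k Hy), (E (a * b)%C), (E (a * c)%C), (E (a * d)%C).
unfold mult; simpl; field; auto 10.
Qed.

(* Main.v *)
Require Import Defs.
From Stdlib Require Import Reals ZArith Lia Lra.
From Coquelicot Require Import Coquelicot.
Open Scope R_scope.

(** Put Q = q^2, a = q e^(i theta)/s, b = q e^(-i theta)/s, c = q^(2 k2 - 2 k1 + 1),
    d = q^(2 k1 + 2 k2 - 1), alpha = abcd/Q and N = n + m, and write (x)_k for (x;Q)_k.
    Up to a factor independent of p, the coefficient c_p is
      W_p = (1 - alpha Q^(2p)) / (1 - alpha Q^p) . (alpha Q)_p (ac Q^p, bc Q^p)_oo
            (abc)^p Q^(p(p-1)) / (Q, ab)_p ,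
    a very-well-poised weight, and p enters the three-term recurrences, in N and in n,
    of the two Al-Salam and Chihara polynomials only through
    lambda_p = Q^(-p) + alpha Q^p.  The proof rests on these two facts.

    Case n = 0.  Expand p_p(cos psi) in the basis (a e^(i psi), a e^(-i psi))_k.
    The coefficients are W_p times (Q^(-p), alpha Q^p)_k times factors that turn W_p
    into the summand of a 6phi5 series with two parameters sent to infinity.
    After interchanging the sums one needs the moments of s_N against
    (Q^(-p), alpha Q^p)_k.  For N = 0 they are given by [vwp_sum].  Since
      (1 - Q^(k-p)) (1 - alpha Q^(p+k)) = 1 + alpha Q^(2k) - Q^k lambda_p ,
    multiplication by lambda_p only mixes k and k + 1, so the recurrence of s_N
    determines all of them ([moment_correct]), and they are the coefficients of the
    2phi2 series.  The interchange is absolute because of the factor Q^(p(p-1))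
    ([double_term_le], [double_series_swap]).

    General n.  Computing lambda_p s_N s_n once by the recurrence in N and once by the
    recurrence in n expresses the sum for (n+1, N) as a finite linear combination of
    the sums for (n, N+1), (n, N), (n, N-1) and (n-1, N); convergence is thus
    inherited from n = 0.  It remains to see that the right-hand side obeys the same
    relation ([closed_form_rec]).  There the 2phi2 series occurs with its parameter
    gamma = c Q^(n-N) replaced by gamma/Q, gamma and gamma Q, three values linked by
    the contiguous relation [phi_reg_rec]; once this is used, the remaining
    coefficients agree because the continuous dual q-Hahn polynomials with first
    parameters g and g Q are connected by the Christoffel and the Uvarov formulas
    [cdqh_christoffel] and [cdqh_uvarov].  These two formulas also yield the
    three-term recurrences just used ([al_salam_rec]).

    The induction passes through all values of n - N, hence through values of gamma
    at which a denominator of the 2phi2 series may vanish.  It is therefore carried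
    out for the entire function of gamma obtained by multiplying the series by
    (a gamma)_oo. *)

(** * Convergence of complex series *)

(** Convergence in the complex plane through the modulus, so that real squeeze arguments
    apply; [is_series_Clim] links it to the filter-based notion. *)
Definition Clim (u : nat -> C) (l : C) : Prop :=
  is_lim_seq (fun n => Cmod (u n - l)%C) 0.

Lemma is_series_Clim (u : nat -> C) (l : C) :
  is_series u l <-> Clim (sum_n u) l.
Proof.
assert (E := @filterlim_locally_ball_norm C_AbsRing nat C_NormedModule
  eventually _ (sum_n u) l).
assert (E' := @filterlim_locally nat R_UniformSpace eventually _
  (fun n => Cmod (sum_n u n - l)%C) 0).
assert (E0 : forall n (eps : posreal), ball_norm (V := C_NormedModule) l eps (sum_n u n) <->
  ball (M := R_UniformSpace) 0 eps (Cmod (sum_n u n - l)%C)).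
{ intros n eps; unfold ball; simpl; unfold AbsRing_ball, abs, minus, plus, opp; simpl.
  rewrite Ropp_0, Rplus_0_r, Rabs_pos_eq by apply Cmod_ge_0. reflexivity. }
split; intro H.
- apply E'; intro eps; apply E with (eps := eps) in H; revert H.
  apply filter_imp; intro n; apply E0.
- apply E; intro eps; apply E' with (eps := eps) in H; revert H.
  apply filter_imp; intro n; apply E0.
Qed.

Lemma Clim_squeeze (u : nat -> C) (l : C) (v : nat -> R) :
  (forall n, Cmod (u n - l)%C <= v n) -> is_lim_seq v 0 -> Clim u l.
Proof.
intros H Hv. apply is_lim_seq_le_le with (fun _ => 0) v; auto.
- intro n; split; [apply Cmod_ge_0 | apply H].
- apply is_lim_seq_const.
Qed.

Lemma Clim_ext (u v : nat -> C) (l : C) : (forall n, u n = v n) -> Clim u l -> Clim v l.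
Proof. intros H; apply is_lim_seq_ext; intro n; now rewrite H. Qed.

Lemma Clim_const (l : C) : Clim (fun _ => l) l.
Proof.
apply is_lim_seq_ext with (fun _ => 0); [|apply is_lim_seq_const].
intros _; replace (l - l)%C with (RtoC 0) by ring; symmetry; apply Cmod_0.
Qed.

Lemma Clim_plus (u v : nat -> C) (l m : C) :
  Clim u l -> Clim v m -> Clim (fun n => u n + v n)%C (l + m)%C.
Proof.
intros Hu Hv.
apply Clim_squeeze with (fun n => Cmod (u n - l) + Cmod (v n - m)).
- intro n; replace (u n + v n - (l + m))%C with ((u n - l) + (v n - m))%C by ring.
  apply Cmod_triangle.
- replace (Finite 0) with (Finite (0 + 0)) by (f_equal; ring).
  now apply is_lim_seq_plus'.
Qed.

Lemma Clim_mult (u v : nat -> C) (l m : C) :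
  Clim u l -> Clim v m -> Clim (fun n => u n * v n)%C (l * m)%C.
Proof.
intros Hu Hv.
apply Clim_squeeze with
  (fun n => Cmod (u n - l) * Cmod (v n - m) + (Cmod (u n - l) * Cmod m + Cmod l * Cmod (v n - m))).
- intro n.
  replace (u n * v n - l * m)%C with
    ((u n - l) * (v n - m) + ((u n - l) * m + l * (v n - m)))%C by ring.
  eapply Rle_trans; [apply Cmod_triangle|]; rewrite Cmod_mult.
  apply Rplus_le_compat_l.
  eapply Rle_trans; [apply Cmod_triangle|]; rewrite !Cmod_mult; apply Rle_refl.
- replace (Finite 0) with (Finite (0 * 0 + (0 * Cmod m + Cmod l * 0))) by (f_equal; ring).
  apply is_lim_seq_plus'; [now apply is_lim_seq_mult'|].
  apply is_lim_seq_plus'; apply is_lim_seq_mult'; auto; apply is_lim_seq_const.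
Qed.

Lemma Clim_unique (u : nat -> C) (l m : C) : Clim u l -> Clim u m -> l = m.
Proof.
intros Hl Hm.
assert (H : Clim (fun n => u n + (- (1)) * u n)%C (l + (- (1)) * m)%C).
{ apply Clim_plus; auto. apply (Clim_mult (fun _ => (- (1))%C)); auto. apply Clim_const. }
apply is_lim_seq_ext with (v := fun _ => Cmod (l - m)) in H.
- assert (E := is_lim_seq_unique _ _ H). rewrite Lim_seq_const in E.
  injection E as E. apply Cmod_eq_0 in E. now apply Ceq_minus.
- intro n. rewrite <- Cmod_opp; f_equal; ring.
Qed.

Lemma Clim_Cmod (u : nat -> C) (l : C) : Clim u l -> is_lim_seq (fun n => Cmod (u n)) (Cmod l).
Proof.
intro H.
apply is_lim_seq_ext with (fun n => (Cmod (u n) - Cmod l) + Cmod l).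
{ intro n; ring. }
replace (Finite (Cmod l)) with (Finite (0 + Cmod l)) by (f_equal; ring).
apply is_lim_seq_plus'; [|apply is_lim_seq_const].
apply (proj2 (is_lim_seq_abs_0 _)).
apply is_lim_seq_le_le with (fun _ => 0) (fun n => Cmod (u n - l)); auto.
2: apply is_lim_seq_const.
intro n; split; [apply Rabs_pos|].
apply Rabs_le; split.
- assert (T := Cmod_triangle (u n) (- (u n - l))%C). rewrite Cmod_opp in T.
  replace (u n + - (u n - l))%C with l in T by ring. lra.
- assert (T := Cmod_triangle l (u n - l)%C).
  replace (l + (u n - l))%C with (u n) in T by ring. lra.
Qed.

Lemma Clim_Re (u : nat -> C) (l : C) : Clim u l -> is_lim_seq (fun n => Re (u n)) (Re l).
Proof.
intro H. apply is_lim_seq_ext with (fun n => Re (u n - l) + Re l).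
{ intro n; unfold Re, Cminus, Cplus, Copp; simpl; ring. }
replace (Finite (Re l)) with (Finite (0 + Re l)) by (f_equal; ring).
apply is_lim_seq_plus'; [|apply is_lim_seq_const].
apply (proj2 (is_lim_seq_abs_0 _)).
apply is_lim_seq_le_le with (fun _ => 0) (fun n => Cmod (u n - l)); auto.
- intro n; split; [apply Rabs_pos | apply re_le_Cmod].
- apply is_lim_seq_const.
Qed.

Lemma im_le_Cmod (c : C) : Rabs (Im c) <= Cmod c.
Proof. eapply Rle_trans; [apply Rmax_r | apply Rmax_Cmod]. Qed.

Lemma Clim_Im (u : nat -> C) (l : C) : Clim u l -> is_lim_seq (fun n => Im (u n)) (Im l).
Proof.
intro H. apply is_lim_seq_ext with (fun n => Im (u n - l) + Im l).
{ intro n; unfold Im, Cminus, Cplus, Copp; simpl; ring. }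
replace (Finite (Im l)) with (Finite (0 + Im l)) by (f_equal; ring).
apply is_lim_seq_plus'; [|apply is_lim_seq_const].
apply (proj2 (is_lim_seq_abs_0 _)).
apply is_lim_seq_le_le with (fun _ => 0) (fun n => Cmod (u n - l)); auto.
- intro n; split; [apply Rabs_pos | apply im_le_Cmod].
- apply is_lim_seq_const.
Qed.

Lemma Re_sum_n (u : nat -> C) (n : nat) : Re (sum_n u n) = sum_n (fun k => Re (u k)) n.
Proof.
induction n as [|n IH]; [now rewrite !sum_O|].
rewrite !sum_Sn, <- IH; reflexivity.
Qed.

Lemma Im_sum_n (u : nat -> C) (n : nat) : Im (sum_n u n) = sum_n (fun k => Im (u k)) n.
Proof.
induction n as [|n IH]; [now rewrite !sum_O|].
rewrite !sum_Sn, <- IH; reflexivity.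
Qed.

Lemma CSeries_unique (u : nat -> C) (l : C) : is_series u l -> CSeries u = l.
Proof.
intro H; apply is_series_Clim in H; unfold CSeries.
assert (HR : is_series (fun k => Re (u k)) (Re l)).
{ apply Clim_Re in H. apply (is_lim_seq_ext _ _ _ (Re_sum_n u)) in H. exact H. }
assert (HI : is_series (fun k => Im (u k)) (Im l)).
{ apply Clim_Im in H. apply (is_lim_seq_ext _ _ _ (Im_sum_n u)) in H. exact H. }
rewrite (is_series_unique _ _ HR), (is_series_unique _ _ HI).
now destruct l.
Qed.

Lemma is_series_Cplus (u v : nat -> C) (l m : C) :
  is_series u l -> is_series v m -> is_series (fun n => u n + v n)%C (l + m)%C.
Proof. apply (is_series_plus (V := C_NormedModule)). Qed.

Lemma is_series_Cscal (c : C) (u : nat -> C) (l : C) :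
  is_series u l -> is_series (fun n => c * u n)%C (c * l)%C.
Proof. apply (is_series_scal (V := C_NormedModule)). Qed.

Lemma is_series_Cunique (u : nat -> C) (l m : C) : is_series u l -> is_series u m -> l = m.
Proof. rewrite !is_series_Clim; apply Clim_unique. Qed.

Lemma is_series_Cext (u v : nat -> C) (l m : C) :
  (forall n, u n = v n) -> l = m -> is_series u l -> is_series v m.
Proof. intros H -> Hu; now apply (is_series_ext u). Qed.

Lemma is_series_zero_prefix (u : nat -> C) (l : C) (k : nat) :
  (forall p, (p < k)%nat -> u p = 0%C) -> is_series (fun r => u (k + r)%nat) l -> is_series u l.
Proof.
revert u; induction k as [|k IH]; intros u H Hu; [exact Hu|].
apply (is_series_decr_1 (V := C_NormedModule)).
replace (plus _ _) with l.
- apply IH; [intros p Hp; apply H; lia | exact Hu].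
- rewrite H by lia. unfold plus, opp; simpl; symmetry; ring.
Qed.

(** Equalities between values of [sum_n] live in the carrier of an abelian monoid, which
    [ring] does not recognise as the complex numbers. *)
Ltac ceq := match goal with |- @eq _ ?a ?b => change (@eq C a b) end.

Lemma sum_n_Sn_C (u : nat -> C) (n : nat) : sum_n u (S n) = (sum_n u n + u (S n))%C.
Proof. exact (sum_Sn u n). Qed.

Lemma is_series_finite (u : nat -> C) (n : nat) :
  (forall k, (n < k)%nat -> u k = 0%C) -> is_series u (sum_n u n).
Proof.
intro H; apply is_series_Clim.
apply (is_lim_seq_incr_n (fun j => Cmod (sum_n u j - sum_n u n)%C) n).
apply (is_lim_seq_ext (fun _ => 0)); [|apply is_lim_seq_const].
intro j; replace (sum_n u (j + n)) with (sum_n u n).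
- replace (sum_n u n - sum_n u n)%C with (RtoC 0) by ring. now rewrite Cmod_0.
- induction j as [|j IH]; [reflexivity|].
  simpl Nat.add; rewrite sum_n_Sn_C, <- IH, H by lia. symmetry; apply Cplus_0_r.
Qed.

Lemma sum_n_shift (f : nat -> C) (n : nat) :
  sum_n f (S n) = (f 0%nat + sum_n (fun k => f (S k)) n)%C.
Proof.
induction n as [|n IH].
- rewrite sum_Sn, !sum_O; reflexivity.
- rewrite sum_Sn, IH, (sum_Sn (fun k => f (S k))); unfold plus; simpl; ceq; ring.
Qed.

Lemma sum_n_Cplus (u v : nat -> C) (n : nat) :
  (sum_n u n + sum_n v n)%C = sum_n (fun k => u k + v k)%C n.
Proof.
induction n as [|n IH]; [now rewrite !sum_O|].
rewrite !sum_Sn, <- IH; unfold plus; simpl; ceq; ring.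
Qed.

Lemma sum_n_minus (u v : nat -> C) (n : nat) :
  (sum_n u n - sum_n v n)%C = sum_n (fun k => u k - v k)%C n.
Proof.
induction n as [|n IH]; [now rewrite !sum_O|].
rewrite !sum_Sn, <- IH; unfold plus; simpl; ring.
Qed.

Lemma sum_n_Cscal (c : C) (u : nat -> C) (n : nat) :
  (c * sum_n u n)%C = sum_n (fun k => c * u k)%C n.
Proof.
induction n as [|n IH]; [now rewrite !sum_O|].
rewrite !sum_Sn, <- IH; unfold plus; simpl; ceq; ring.
Qed.

Lemma Cmod_sum_n_le (u : nat -> C) (v : nat -> R) (n : nat) :
  (forall k, Cmod (u k) <= v k) -> Cmod (sum_n u n) <= sum_n v n.
Proof.
intro H; induction n as [|n IH]; [rewrite !sum_O; apply H|].
rewrite !sum_Sn. eapply Rle_trans; [apply Cmod_triangle|].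
apply Rplus_le_compat; auto.
Qed.

Lemma is_lim_seq_geom_scal (K r : R) : 0 <= r < 1 -> is_lim_seq (fun n => K * r ^ n) 0.
Proof.
intro Hr. replace (Finite 0) with (Finite (K * 0)) by (f_equal; ring).
apply is_lim_seq_mult'; [apply is_lim_seq_const|].
apply is_lim_seq_geom. now rewrite Rabs_pos_eq.
Qed.

Lemma sum_n_increment_le (u : nat -> C) (M r : R) (n j : nat) : 0 <= r < 1 ->
  (forall k, Cmod (u k) <= M * r ^ k) ->
  Cmod (sum_n u (n + j) - sum_n u n)%C <= M * (r ^ S n - r ^ S (n + j)) / (1 - r).
Proof.
intros Hr H; induction j as [|j IH].
- rewrite Nat.add_0_r.
  replace (sum_n u n - sum_n u n)%C with (RtoC 0) by ring.
  rewrite Cmod_0; right; field; lra.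
- rewrite Nat.add_succ_r, sum_Sn.
  replace (plus (sum_n u (n + j)) (u (S (n + j))) - sum_n u n)%C
    with ((sum_n u (n + j) - sum_n u n) + u (S (n + j)))%C by (unfold plus; simpl; ring).
  eapply Rle_trans; [apply Cmod_triangle|].
  eapply Rle_trans; [apply Rplus_le_compat; [apply IH | apply H]|].
  right; simpl; field; lra.
Qed.

Lemma geo_series_tail (u : nat -> C) (l : C) (M r : R) (n : nat) : 0 <= r < 1 -> 0 <= M ->
  (forall k, Cmod (u k) <= M * r ^ k) -> is_series u l ->
  Cmod (l - sum_n u n)%C <= M * r ^ S n / (1 - r).
Proof.
intros Hr HM H Hl; apply is_series_Clim in Hl.
assert (L : is_lim_seq (fun j => M * r ^ S n / (1 - r) + Cmod (sum_n u (n + j) - l)%C)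
              (M * r ^ S n / (1 - r) + 0)).
{ apply is_lim_seq_plus'; [apply is_lim_seq_const|].
  apply (is_lim_seq_ext (fun j => Cmod (sum_n u (j + n) - l)%C)).
  { intro j; now rewrite Nat.add_comm. }
  now apply (is_lim_seq_incr_n (fun j => Cmod (sum_n u j - l)%C)). }
rewrite Rplus_0_r in L.
apply (is_lim_seq_le (fun _ => Cmod (l - sum_n u n)%C) _
  (Cmod (l - sum_n u n)%C) (M * r ^ S n / (1 - r))) in L; auto.
2: apply is_lim_seq_const.
intro j.
replace (l - sum_n u n)%C with
  ((sum_n u (n + j) - sum_n u n) + - (sum_n u (n + j) - l))%C by ring.
eapply Rle_trans; [apply Cmod_triangle|]; rewrite Cmod_opp.
apply Rplus_le_compat_r.
eapply Rle_trans; [now apply sum_n_increment_le|].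
apply Rmult_le_compat_r; [left; apply Rinv_0_lt_compat; lra|].
apply Rmult_le_compat_l; auto.
assert (0 <= r ^ S (n + j)) by (apply pow_le; lra). lra.
Qed.

Lemma geo_series_le (u : nat -> C) (l : C) (M r : R) : 0 <= r < 1 -> 0 <= M ->
  (forall k, Cmod (u k) <= M * r ^ k) -> is_series u l -> Cmod l <= M / (1 - r).
Proof.
intros Hr HM H Hl.
assert (T := geo_series_tail u l M r 0 Hr HM H Hl). rewrite sum_O in T.
replace l with ((l - u 0%nat) + u 0%nat)%C by ring.
eapply Rle_trans; [apply Cmod_triangle|].
eapply Rle_trans; [apply Rplus_le_compat; [exact T | apply H]|].
right; simpl; field; lra.
Qed.

Lemma Cmod_le_abs (c : C) : Cmod c <= Rabs (Re c) + Rabs (Im c).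
Proof.
replace c with (RtoC (Re c) + Ci * RtoC (Im c))%C at 1.
- eapply Rle_trans; [apply Cmod_triangle|].
  rewrite Cmod_mult, Cmod_Ci, !Cmod_R; lra.
- destruct c; unfold RtoC, Ci, Cplus, Cmult; simpl; f_equal; ring.
Qed.

(** Real and imaginary parts are dominated by a geometric series. *)
Lemma geo_series_converges (u : nat -> C) (M r : R) : 0 <= r < 1 ->
  (forall k, Cmod (u k) <= M * r ^ k) -> exists l : C, is_series u l.
Proof.
intros Hr H.
assert (E : ex_series (fun k => M * r ^ k)).
{ apply (ex_series_scal (V := R_NormedModule) M). apply ex_series_geom. rewrite Rabs_pos_eq; lra. }
assert (HR : ex_series (fun k => Re (u k))).
{ apply (ex_series_le (V := R_CompleteNormedModule) _ (fun k => M * r ^ k)); auto.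
  intro k. eapply Rle_trans; [apply re_le_Cmod | apply H]. }
assert (HI : ex_series (fun k => Im (u k))).
{ apply (ex_series_le (V := R_CompleteNormedModule) _ (fun k => M * r ^ k)); auto.
  intro k. eapply Rle_trans; [apply im_le_Cmod | apply H]. }
destruct HR as [x Hx], HI as [y Hy].
exists (x, y); apply is_series_Clim.
apply Clim_squeeze with
  (fun n => Rabs (sum_n (fun k => Re (u k)) n - x) + Rabs (sum_n (fun k => Im (u k)) n - y)).
- intro n; rewrite <- Re_sum_n, <- Im_sum_n.
  apply (Cmod_le_abs (sum_n u n - (x, y))%C).
- replace (Finite 0) with (Finite (0 + 0)) by (f_equal; ring).
  apply is_lim_seq_plus'.
  + apply (is_lim_seq_abs_0 (fun n => sum_n (fun k => Re (u k)) n - x)).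
    replace 0 with (x - x) by ring.
    apply is_lim_seq_minus'; [exact Hx | apply is_lim_seq_const].
  + apply (is_lim_seq_abs_0 (fun n => sum_n (fun k => Im (u k)) n - y)).
    replace 0 with (y - y) by ring.
    apply is_lim_seq_minus'; [exact Hy | apply is_lim_seq_const].
Qed.

Lemma is_series_telescope (G : nat -> C) (M r : R) : 0 <= r < 1 ->
  (forall k, Cmod (G k) <= M * r ^ k) ->
  is_series (fun p => G (S p) - G p)%C (- G 0%nat)%C.
Proof.
intros Hr H; apply is_series_Clim.
apply (Clim_ext (fun n => G (S n) + - G 0%nat)%C).
- intro n; induction n as [|n IH]; [rewrite sum_O; ring|].
  rewrite sum_Sn, <- IH; unfold plus; simpl; ring.
- replace (- G 0%nat)%C with (0 + - G 0%nat)%C at 1 by ring.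
  apply Clim_plus; [|apply Clim_const].
  apply Clim_squeeze with (fun n => (M * r) * r ^ n).
  + intro n. replace (G (S n) - 0)%C with (G (S n)) by ring.
    eapply Rle_trans; [apply H|]; right; simpl; ring.
  + now apply is_lim_seq_geom_scal.
Qed.

Lemma sum_n_geom_le (K r : R) (n : nat) : 0 <= r < 1 -> 0 <= K ->
  sum_n (fun k => K * r ^ k) n <= K / (1 - r).
Proof.
intros Hr HK.
assert (E : sum_n (fun k => K * r ^ k) n = K * (1 - r ^ S n) / (1 - r)).
{ induction n as [|n IH]; [rewrite sum_O; simpl; field; lra|].
  rewrite sum_Sn, IH; unfold plus; simpl; field; lra. }
rewrite E; apply Rmult_le_compat_r; [left; apply Rinv_0_lt_compat; lra|].
assert (0 <= r ^ S n) by (apply pow_le; lra).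
rewrite <- (Rmult_1_r K) at 2. apply Rmult_le_compat_l; lra.
Qed.

(** Fubini for a geometrically dominated double array: replacing either iterated sum by the
    finite square sum up to n costs O(r^n), by [geo_series_tail]. *)
Lemma double_series_swap (a : nat -> nat -> C) (A B : nat -> C) (S : C) (M r : R) :
  0 <= r < 1 -> 0 <= M ->
  (forall p k, Cmod (a p k) <= M * r ^ p * r ^ k) ->
  (forall p, is_series (a p) (A p)) ->
  (forall k, is_series (fun p => a p k) (B k)) ->
  is_series B S -> is_series A S.
Proof.
intros Hr HM Ha HA HB HS; apply is_series_Clim; apply is_series_Clim in HS.
set (K := M / (1 - r) * r / (1 - r)).
assert (HK : forall n, 0 <= M * r ^ n)
  by (intro n; apply Rmult_le_pos; auto; apply pow_le; lra).
assert (T : forall n, Cmod (sum_n A n - sum_n B n)%C <= 2 * K * r ^ n).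
{ intro n.
  assert (T1 : Cmod (sum_n A n - sum_n (fun p => sum_n (a p) n) n)%C <= K * r ^ n).
  { rewrite sum_n_minus.
    eapply Rle_trans;
      [apply Cmod_sum_n_le with (v := fun p => (M * r ^ Datatypes.S n / (1 - r)) * r ^ p)|].
    - intro p. eapply Rle_trans.
      + apply geo_series_tail with (M := M * r ^ p) (r := r); auto.
      + right; field; lra.
    - eapply Rle_trans; [apply sum_n_geom_le; auto|].
      + apply Rmult_le_pos; auto. left; apply Rinv_0_lt_compat; lra.
      + right; unfold K; simpl; field; lra. }
  assert (T2 : Cmod (sum_n B n - sum_n (fun p => sum_n (a p) n) n)%C <= K * r ^ n).
  { rewrite sum_n_switch, sum_n_minus.
    eapply Rle_trans;
      [apply Cmod_sum_n_le with (v := fun p => (M * r ^ Datatypes.S n / (1 - r)) * r ^ p)|].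
    - intro k. eapply Rle_trans.
      + apply geo_series_tail with (M := M * r ^ k) (r := r) (u := fun p => a p k); auto.
        intro p. eapply Rle_trans; [apply Ha|]. right; ring.
      + right; field; lra.
    - eapply Rle_trans; [apply sum_n_geom_le; auto|].
      + apply Rmult_le_pos; auto. left; apply Rinv_0_lt_compat; lra.
      + right; unfold K; simpl; field; lra. }
  set (D := sum_n (fun p => sum_n (a p) n) n) in *.
  replace (sum_n A n - sum_n B n)%C with ((sum_n A n - D) + - (sum_n B n - D))%C by ring.
  eapply Rle_trans; [apply Cmod_triangle|]; rewrite Cmod_opp; lra. }
apply Clim_ext with (fun n => sum_n B n + (sum_n A n - sum_n B n))%C.
{ intro n; ring. }
replace S with (S + 0)%C by ring.
apply Clim_plus; auto.
apply Clim_squeeze with (fun n => 2 * K * r ^ n).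
- intro n. replace (sum_n A n - sum_n B n - 0)%C with (sum_n A n - sum_n B n)%C by ring. apply T.
- now apply is_lim_seq_geom_scal.
Qed.

Lemma tri_S (k : nat) : (S k * (S k - 1) / 2 = k * (k - 1) / 2 + k)%nat.
Proof.
replace (S k * (S k - 1))%nat with (k * (k - 1) + k * 2)%nat by (destruct k; simpl; lia).
now rewrite Nat.div_add.
Qed.

Lemma tri_double (k : nat) : (k * (k - 1) = k * (k - 1) / 2 + k * (k - 1) / 2)%nat.
Proof.
induction k as [|k IH]; [reflexivity|].
rewrite tri_S. replace (S k * (S k - 1))%nat with (k * (k - 1) + k * 2)%nat by (destruct k; simpl; lia).
lia.
Qed.

Lemma pow_le_1 (r : R) (k : nat) : 0 <= r <= 1 -> r ^ k <= 1.
Proof. intros Hr; rewrite <- (pow1 k); now apply pow_incr. Qed.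

Lemma pow_tri_le (rho : R) (p : nat) : 0 <= rho <= 1 ->
  rho ^ (p * (p - 1)) <= rho ^ (p * (p - 1) / 2).
Proof.
intro H. rewrite tri_double at 1. rewrite pow_add.
rewrite <- (Rmult_1_r (rho ^ (p * (p - 1) / 2))) at 3.
apply Rmult_le_compat_l; [apply pow_le; lra | now apply pow_le_1].
Qed.

Lemma bounded_prefix (u : nat -> R) (n : nat) : exists M, 0 <= M /\ forall k, (k <= n)%nat -> u k <= M.
Proof.
induction n as [|n [M [HM H]]].
- exists (Rmax 0 (u 0%nat)); split; [apply Rmax_l|].
  intros k Hk; replace k with 0%nat by lia; apply Rmax_r.
- exists (Rmax M (u (S n))); split.
  + eapply Rle_trans; [apply HM | apply Rmax_l].
  + intros k Hk; destruct (Nat.eq_dec k (S n)) as [->|Hn]; [apply Rmax_r|].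
    eapply Rle_trans; [apply H; lia | apply Rmax_l].
Qed.

(** The ratio of consecutive values of R0^p rho^(p(p-1)/2) / r^p is (R0 / r) rho^p, which is
    eventually at most 1. *)
Lemma superexp_bound (R0 rho r : R) : 0 <= R0 -> 0 <= rho < 1 -> 0 < r ->
  exists M, 0 <= M /\ forall p : nat, R0 ^ p * rho ^ (p * (p - 1) / 2) <= M * r ^ p.
Proof.
intros HR Hrho Hr.
set (u := fun p : nat => (R0 / r) ^ p * rho ^ (p * (p - 1) / 2)).
assert (Hu : forall p, 0 <= u p).
{ intro p; apply Rmult_le_pos; apply pow_le; [|lra].
  apply Rmult_le_pos; auto; left; now apply Rinv_0_lt_compat. }
destruct (proj2 (is_lim_seq_spec _ _) (is_lim_seq_geom_scal (R0 / r) rho Hrho) (mkposreal 1 Rlt_0_1))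
  as [n0 Hn0].
destruct (bounded_prefix u n0) as [M [HM H]].
assert (Hb : forall p, u p <= M).
{ intro p; destruct (Nat.le_gt_cases p n0) as [Hp|Hp]; [now apply H|].
  induction Hp as [|p Hp IH].
  - apply Rle_trans with (u n0); [|apply H; lia].
    specialize (Hn0 n0 (Nat.le_refl _)); simpl in Hn0; rewrite Rminus_0_r in Hn0.
    unfold u at 1; rewrite tri_S, pow_add; simpl pow at 1.
    replace (R0 / r * (R0 / r) ^ n0 * (rho ^ (n0 * (n0 - 1) / 2) * rho ^ n0))
      with (u n0 * (R0 / r * rho ^ n0)) by (unfold u; ring).
    rewrite <- (Rmult_1_r (u n0)) at 2. apply Rmult_le_compat_l; auto.
    apply Rlt_le; eapply Rle_lt_trans; [apply Rle_abs | exact Hn0].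
  - apply Rle_trans with (u p); [|exact IH].
    assert (Hp' : (n0 <= p)%nat) by lia.
    specialize (Hn0 p Hp'); simpl in Hn0; rewrite Rminus_0_r in Hn0.
    unfold u at 1; rewrite tri_S, pow_add; simpl pow at 1.
    replace (R0 / r * (R0 / r) ^ p * (rho ^ (p * (p - 1) / 2) * rho ^ p))
      with (u p * (R0 / r * rho ^ p)) by (unfold u; ring).
    rewrite <- (Rmult_1_r (u p)) at 2. apply Rmult_le_compat_l; auto.
    apply Rlt_le; eapply Rle_lt_trans; [apply Rle_abs | exact Hn0]. }
exists M; split; auto; intro p.
specialize (Hb p).
replace (R0 ^ p * rho ^ (p * (p - 1) / 2)) with (u p * r ^ p).
- apply Rmult_le_compat_r; auto; apply pow_le; lra.
- unfold u, Rdiv; rewrite Rpow_mult_distr, pow_inv. field. apply pow_nonzero; lra.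
Qed.

(** * q-shifted factorials *)

Lemma Cmod_one_minus_le (x : C) : Cmod (1 - x)%C <= 1 + Cmod x.
Proof.
unfold Cminus; eapply Rle_trans; [apply Cmod_triangle|].
rewrite Cmod_1, Cmod_opp; apply Rle_refl.
Qed.

Lemma Cmod_one_minus_ge (x : C) : 1 - Cmod x <= Cmod (1 - x)%C.
Proof.
assert (H := Cmod_triangle (1 - x)%C x).
replace (1 - x + x)%C with (RtoC 1) in H by ring. rewrite Cmod_1 in H; lra.
Qed.

Lemma Cmod_mult_pow_le (x Q : C) (k : nat) : Cmod Q <= 1 -> Cmod (x * Q ^ k)%C <= Cmod x.
Proof.
intro HQ; rewrite Cmod_mult, Cmod_pow.
rewrite <- (Rmult_1_r (Cmod x)) at 2.
apply Rmult_le_compat_l; [apply Cmod_ge_0|].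
apply pow_le_1; split; [apply Cmod_ge_0 | auto].
Qed.

Lemma Cmod_pow_le_1 (Q : C) (k : nat) : Cmod Q <= 1 -> Cmod (Q ^ k)%C <= 1.
Proof. intro H; rewrite Cmod_pow; apply pow_le_1; split; [apply Cmod_ge_0 | auto]. Qed.

Lemma one_minus_neq_0 (x : C) : Cmod x < 1 -> (1 - x)%C <> 0%C.
Proof.
intros Hx E. assert (H := Cmod_one_minus_ge x). rewrite E, Cmod_0 in H; lra.
Qed.

Lemma one_minus_mult_pow_neq_0 (x Q : C) (k : nat) : Cmod Q <= 1 -> Cmod x < 1 ->
  (1 - x * Q ^ k)%C <> 0%C.
Proof.
intros HQ Hx; apply one_minus_neq_0.
eapply Rle_lt_trans; [now apply Cmod_mult_pow_le | auto].
Qed.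

Lemma Cmod_one_minus_inv_le (x : C) (h : R) : Cmod x <= h -> h < 1 ->
  Cmod (/ (1 - x))%C <= / (1 - h).
Proof.
intros Hx Hh.
rewrite Cmod_inv by (apply one_minus_neq_0; lra).
apply Rinv_le_contravar; [lra|].
eapply Rle_trans; [|apply Cmod_one_minus_ge]; lra.
Qed.

Lemma qpoch_S (x Q : C) (k : nat) : qpoch x Q (S k) = (qpoch x Q k * (1 - x * Q ^ k))%C.
Proof. reflexivity. Qed.

Lemma qpoch_0 (Q : C) (k : nat) : qpoch 0 Q k = 1%C.
Proof. induction k as [|k IH]; simpl; [reflexivity | rewrite IH; ring]. Qed.

Lemma qpoch_shift (x Q : C) (k : nat) :
  (qpoch x Q k * (1 - x * Q ^ k) = (1 - x) * qpoch (x * Q) Q k)%C.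
Proof.
change (qpoch x Q (1 + k) = (1 - x) * qpoch (x * Q) Q k)%C.
rewrite qpoch_add; simpl. now rewrite !Cmult_1_r, Cmult_1_l.
Qed.

Lemma qpoch_shift_eq (x Q : C) (k : nat) : (1 - x)%C <> 0%C ->
  qpoch (x * Q) Q k = (qpoch x Q k * (1 - x * Q ^ k) / (1 - x))%C.
Proof. intro H; rewrite qpoch_shift; field; exact H. Qed.

Lemma qpoch_le (x Q : C) (h : R) (k : nat) : Cmod Q <= 1 -> Cmod x <= h ->
  Cmod (qpoch x Q k) <= (1 + h) ^ k.
Proof.
intros HQ Hx; induction k as [|k IH]; simpl; [rewrite Cmod_1; lra|].
rewrite Cmod_mult, Rmult_comm.
apply Rmult_le_compat; try apply Cmod_ge_0; auto.
eapply Rle_trans; [apply Cmod_one_minus_le|].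
assert (H := Cmod_mult_pow_le x Q k HQ); lra.
Qed.

Lemma qpoch_neq_0 (x Q : C) (k : nat) :
  (forall j, (1 - x * Q ^ j)%C <> 0%C) -> qpoch x Q k <> 0%C.
Proof.
intro H; induction k as [|k IH]; simpl; [apply C1_nz | now apply Cmult_neq_0].
Qed.

Lemma qpoch_neq_0_lt1 (x Q : C) (k : nat) : Cmod Q <= 1 -> Cmod x < 1 -> qpoch x Q k <> 0%C.
Proof. intros HQ Hx; apply qpoch_neq_0; intro j; now apply one_minus_mult_pow_neq_0. Qed.

Lemma qpoch_inv_le (x Q : C) (h : R) (k : nat) : Cmod Q <= 1 -> Cmod x <= h -> h < 1 ->
  Cmod (/ qpoch x Q k)%C <= (/ (1 - h)) ^ k.
Proof.
intros HQ Hx Hh.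
assert (N : qpoch x Q k <> 0%C) by (apply qpoch_neq_0_lt1; auto; lra).
rewrite Cmod_inv by auto. rewrite pow_inv.
apply Rinv_le_contravar; [apply pow_lt; lra|].
clear N; induction k as [|k IH]; simpl; [rewrite Cmod_1; lra|].
rewrite Cmod_mult, Rmult_comm.
apply Rmult_le_compat; auto; [apply pow_le; lra | lra |].
eapply Rle_trans; [|apply Cmod_one_minus_ge].
assert (H := Cmod_mult_pow_le x Q k HQ); lra.
Qed.

Lemma exp_le_exp (u v : R) : u <= v -> exp u <= exp v.
Proof. intros [H| ->]; [left; now apply exp_increasing | right; auto]. Qed.

(** Each factor satisfies 1 + t <= exp t, and the exponents add up to a geometric sum. *)
Lemma qpoch_le_exp (x Q : C) (k : nat) : Cmod Q < 1 ->
  Cmod (qpoch x Q k) <= exp (Cmod x * (1 - Cmod Q ^ k) / (1 - Cmod Q)).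
Proof.
intro HQ; induction k as [|k IH].
- simpl. rewrite Cmod_1.
  replace (Cmod x * (1 - 1) / (1 - Cmod Q)) with 0 by (field; lra).
  rewrite exp_0; lra.
- simpl qpoch; rewrite Cmod_mult.
  replace (Cmod x * (1 - Cmod Q ^ S k) / (1 - Cmod Q))
    with (Cmod x * (1 - Cmod Q ^ k) / (1 - Cmod Q) + Cmod x * Cmod Q ^ k)
    by (simpl; field; lra).
  rewrite exp_plus.
  apply Rmult_le_compat; try apply Cmod_ge_0; auto.
  eapply Rle_trans; [apply Cmod_one_minus_le|].
  rewrite Cmod_mult, Cmod_pow; apply exp_ineq1_le.
Qed.

Lemma qpoch_bounded (x Q : C) (k : nat) : Cmod Q < 1 ->
  Cmod (qpoch x Q k) <= exp (Cmod x / (1 - Cmod Q)).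
Proof.
intro HQ; eapply Rle_trans; [now apply qpoch_le_exp|].
apply exp_le_exp; apply Rmult_le_compat_r; [left; apply Rinv_0_lt_compat; lra|].
rewrite <- (Rmult_1_r (Cmod x)) at 2; apply Rmult_le_compat_l; [apply Cmod_ge_0|].
assert (0 <= Cmod Q ^ k) by (apply pow_le, Cmod_ge_0); lra.
Qed.

(** The increments -x Q^k (x;Q)_k are geometrically small because the partial products are
    bounded. *)
Lemma qpoch_Clim (x Q : C) : Cmod Q < 1 -> Clim (qpoch x Q) (qpoch_inf x Q).
Proof.
intro HQ.
assert (HQ0 := Cmod_ge_0 Q).
destruct (geo_series_converges (fun k => qpoch x Q (S k) - qpoch x Q k)%C
  (exp (Cmod x / (1 - Cmod Q)) * Cmod x) (Cmod Q)) as [l Hl]; [lra| |].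
{ intro k; simpl.
  replace (qpoch x Q k * (1 - x * Q ^ k) - qpoch x Q k)%C
    with (- (qpoch x Q k * (x * Q ^ k)))%C by ring.
  rewrite Cmod_opp, !Cmod_mult, Cmod_pow, <- Rmult_assoc.
  apply Rmult_le_compat_r; [now apply pow_le|].
  apply Rmult_le_compat_r; [apply Cmod_ge_0|]. now apply qpoch_bounded. }
apply is_series_Clim in Hl.
assert (H : Clim (qpoch x Q) (1 + l)%C).
{ apply (is_lim_seq_incr_1 (fun n => Cmod (qpoch x Q n - (1 + l))%C)).
  apply (Clim_ext (fun n => 1 + sum_n (fun k => qpoch x Q (S k) - qpoch x Q k)%C n)%C).
  - intro n; induction n as [|n IH]; [rewrite sum_O; simpl; ring|].
    rewrite sum_Sn.
    transitivity ((1 + sum_n (fun k => qpoch x Q (S k) - qpoch x Q k)%C n)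
      + (qpoch x Q (S (S n)) - qpoch x Q (S n)))%C.
    { unfold plus; simpl; ring. }
    rewrite IH; ring.
  - apply Clim_plus; auto; apply Clim_const. }
replace (qpoch_inf x Q) with (1 + l)%C; auto.
unfold qpoch_inf.
rewrite (is_lim_seq_unique _ _ (Clim_Re _ _ H)), (is_lim_seq_unique _ _ (Clim_Im _ _ H)).
now destruct (1 + l)%C.
Qed.

Lemma qpoch_inf_split (x Q : C) (k : nat) : Cmod Q < 1 ->
  qpoch_inf x Q = (qpoch x Q k * qpoch_inf (x * Q ^ k) Q)%C.
Proof.
intro HQ.
apply (Clim_unique (fun n => qpoch x Q (k + n))).
- apply (Clim_ext (fun n => qpoch x Q (n + k))); [intro n; now rewrite Nat.add_comm|].
  apply (is_lim_seq_incr_n (fun n => Cmod (qpoch x Q n - qpoch_inf x Q)%C)).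
  now apply qpoch_Clim.
- apply (Clim_ext (fun n => qpoch x Q k * qpoch (x * Q ^ k) Q n)%C).
  + intro n; now rewrite qpoch_add.
  + apply Clim_mult; [apply Clim_const | now apply qpoch_Clim].
Qed.

Lemma qpoch_inf_S (x Q : C) : Cmod Q < 1 ->
  qpoch_inf x Q = ((1 - x) * qpoch_inf (x * Q) Q)%C.
Proof.
intro HQ; rewrite (qpoch_inf_split x Q 1 HQ); simpl. now rewrite !Cmult_1_r, Cmult_1_l.
Qed.

Lemma qpoch_inf_bounded (x Q : C) : Cmod Q < 1 ->
  Cmod (qpoch_inf x Q) <= exp (Cmod x / (1 - Cmod Q)).
Proof.
intro HQ.
apply (is_lim_seq_le (fun n => Cmod (qpoch x Q n)) (fun _ => exp (Cmod x / (1 - Cmod Q)))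
  (Cmod (qpoch_inf x Q)) (exp (Cmod x / (1 - Cmod Q)))).
- intro n; now apply qpoch_bounded.
- apply Clim_Cmod; now apply qpoch_Clim.
- apply is_lim_seq_const.
Qed.

(** Weierstrass's inequality: a product of factors 1 - t_j with t_j in [0, 1] is at least 1
    minus the sum of the t_j. *)
Lemma qpoch_ge (x Q : C) (k : nat) : Cmod Q < 1 -> Cmod x / (1 - Cmod Q) <= 1 ->
  1 - Cmod x * (1 - Cmod Q ^ k) / (1 - Cmod Q) <= Cmod (qpoch x Q k).
Proof.
intros HQ Hx.
assert (HQ0 := Cmod_ge_0 Q). assert (Hx0 := Cmod_ge_0 x).
assert (D : Cmod x <= 1 - Cmod Q).
{ apply (Rmult_le_reg_r (/ (1 - Cmod Q))); [apply Rinv_0_lt_compat; lra|].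
  rewrite Rinv_r by lra; exact Hx. }
induction k as [|k IH].
- simpl. rewrite Cmod_1. right; field; lra.
- simpl qpoch; rewrite Cmod_mult.
  assert (P0 : 0 <= Cmod Q ^ k) by (apply pow_le; lra).
  assert (P1 : Cmod Q ^ k <= 1) by (apply pow_le_1; lra).
  assert (G := Cmod_one_minus_ge (x * Q ^ k)%C).
  rewrite Cmod_mult, Cmod_pow in G.
  replace (1 - Cmod x * (1 - Cmod Q ^ S k) / (1 - Cmod Q))
    with (1 - Cmod x * (1 - Cmod Q ^ k) / (1 - Cmod Q) - Cmod x * Cmod Q ^ k)
    by (simpl; field; lra).
  set (s := Cmod x * (1 - Cmod Q ^ k) / (1 - Cmod Q)) in *.
  set (t := Cmod x * Cmod Q ^ k) in *.
  assert (Ht : 0 <= t <= 1).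
  { split; [apply Rmult_le_pos; auto|].
    replace 1 with (1 * 1) by ring. apply Rmult_le_compat; lra. }
  assert (Hs : 0 <= s <= 1).
  { unfold s; split.
    - apply Rmult_le_pos; [apply Rmult_le_pos; lra | left; apply Rinv_0_lt_compat; lra].
    - eapply Rle_trans; [|exact Hx].
      apply Rmult_le_compat_r; [left; apply Rinv_0_lt_compat; lra|].
      rewrite <- (Rmult_1_r (Cmod x)) at 2; apply Rmult_le_compat_l; lra. }
  apply Rle_trans with ((1 - s) * (1 - t)); [nra|].
  apply Rmult_le_compat; lra.
Qed.

(** After splitting off finitely many nonzero factors, the sum of the remaining |x Q^j| is
    below 1/2, and [qpoch_ge] bounds the tail of the product away from 0. *)
Lemma qpoch_inf_neq_0 (x Q : C) : Cmod Q < 1 ->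
  (forall j, (1 - x * Q ^ j)%C <> 0%C) -> qpoch_inf x Q <> 0%C.
Proof.
intros HQ Hx.
assert (HQ0 := Cmod_ge_0 Q). assert (Hx0 := Cmod_ge_0 x).
destruct (proj2 (is_lim_seq_spec _ _)
  (is_lim_seq_geom_scal (Cmod x / (1 - Cmod Q)) (Cmod Q) (conj HQ0 HQ))
  (mkposreal (1 / 2) ltac:(lra))) as [k Hk].
specialize (Hk k (Nat.le_refl _)); simpl in Hk; rewrite Rminus_0_r in Hk.
rewrite (qpoch_inf_split x Q k HQ).
apply Cmult_neq_0; [now apply qpoch_neq_0|].
set (y := (x * Q ^ k)%C).
assert (Hy : Cmod y / (1 - Cmod Q) < 1 / 2).
{ eapply Rle_lt_trans; [|exact Hk]. eapply Rle_trans; [|apply Rle_abs].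
  unfold y; rewrite Cmod_mult, Cmod_pow; right; field; lra. }
intro E.
assert (L : 1 / 2 <= Cmod (qpoch_inf y Q)).
{ apply (is_lim_seq_le (fun _ => 1 / 2) (fun n => Cmod (qpoch y Q n))
    (1 / 2) (Cmod (qpoch_inf y Q))).
  - intro n; eapply Rle_trans; [|apply qpoch_ge; lra].
    assert (Cmod y * (1 - Cmod Q ^ n) / (1 - Cmod Q) <= Cmod y / (1 - Cmod Q)); [|lra].
    apply Rmult_le_compat_r; [left; apply Rinv_0_lt_compat; lra|].
    rewrite <- (Rmult_1_r (Cmod y)) at 2; apply Rmult_le_compat_l; [apply Cmod_ge_0|].
    assert (0 <= Cmod Q ^ n) by (apply pow_le; lra); lra.
  - apply is_lim_seq_const.
  - apply Clim_Cmod; now apply qpoch_Clim. }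
rewrite E, Cmod_0 in L; lra.
Qed.

Lemma qpoch_conj (x Q : C) (k : nat) : Cconj (qpoch x Q k) = qpoch (Cconj x) (Cconj Q) k.
Proof.
assert (E1 : Cconj 1 = 1%C) by (unfold Cconj; simpl; now rewrite Ropp_0).
induction k as [|k IH]; simpl; [exact E1|].
now rewrite Cmult_conj, IH, Cminus_conj, Cmult_conj, Cpow_conj, E1.
Qed.

Lemma qpoch_inf_conj (x Q : C) : Cmod Q < 1 ->
  Cconj (qpoch_inf x Q) = qpoch_inf (Cconj x) (Cconj Q).
Proof.
intro HQ.
apply (Clim_unique (qpoch (Cconj x) (Cconj Q))).
- apply is_lim_seq_ext with (fun n => Cmod (qpoch x Q n - qpoch_inf x Q)%C).
  + intro n. rewrite <- Cmod_conj, Cminus_conj, qpoch_conj; reflexivity.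
  + now apply qpoch_Clim.
- apply qpoch_Clim; now rewrite Cmod_conj.
Qed.

(** Reversal of (Q^(-n);Q)_k with n = k + r, multiplied out so that no quotient of
    factorials is left. *)
Lemma qpoch_inv_pow_reverse (Q : C) (k r : nat) : Q <> 0%C ->
  (qpoch (/ Q ^ (k + r)) Q k * qpoch Q Q r =
   (- (1)) ^ k * Q ^ (k * (k - 1) / 2) / (Q ^ (k + r)) ^ k * qpoch Q Q (k + r))%C.
Proof.
intro HQ; revert r; induction k as [|k IH]; intro r.
- simpl; field.
- specialize (IH (S r)).
  replace (S k + r)%nat with (k + S r)%nat by lia.
  assert (N := Cpow_nz Q (k + S r) HQ).
  assert (E : (1 - / Q ^ (k + S r) * Q ^ k = - / Q ^ S r * (1 - Q * Q ^ r))%C).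
  { rewrite Cpow_add_r, Cpow_S.
    assert (N1 := Cpow_nz Q k HQ). assert (N2 := Cpow_nz Q r HQ). field; auto. }
  rewrite qpoch_S, E, tri_S.
  transitivity (- / Q ^ S r * (qpoch (/ Q ^ (k + S r)) Q k * qpoch Q Q (S r)))%C.
  { rewrite qpoch_S; ring. }
  rewrite IH, !(Cpow_S _ k), (Cpow_add_r Q (k * (k - 1) / 2)).
  rewrite Cpow_add_r in *.
  assert (N1 := Cpow_nz Q k HQ). assert (N2 := Cpow_nz Q (S r) HQ).
  assert (N3 := Cpow_nz _ k N). 
  field; auto 10.
Qed.

(** The factor with index p vanishes. *)
Lemma qpoch_inv_pow_zero (Q : C) (p k : nat) : Q <> 0%C -> (p < k)%nat -> qpoch (/ Q ^ p) Q k = 0%C.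
Proof.
intros HQ H. assert (N := Cpow_nz Q p HQ).
replace k with (S p + (k - S p))%nat by lia.
rewrite qpoch_add, qpoch_S.
replace (1 - / Q ^ p * Q ^ p)%C with (RtoC 0) by (field; auto). ring.
Qed.

(** (Q^(-p);Q)_k grows like the inverse of a Gaussian in p.  Its growth is at most half of
    what the factor Q^(p(p-1)) of the weight provides, which makes the double series of the
    case n = 0 absolutely convergent. *)
Lemma qpoch_inv_pow_le (Q : C) (k r : nat) : Q <> 0%C -> Cmod Q < 1 ->
  Cmod (qpoch (/ Q ^ (k + r)) Q k) * Cmod Q ^ (S (k + r) * (S (k + r) - 1) / 2)
  <= 2 ^ k * Cmod Q ^ (S r * (S r - 1) / 2).
Proof.
intros HQ HQ1; assert (H0 : 0 < Cmod Q) by (now apply Cmod_gt_0).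
revert r; induction k as [|k IH]; intro r; [simpl; rewrite Cmod_1; lra|].
specialize (IH (S r)).
replace (S k + r)%nat with (k + S r)%nat by lia.
rewrite qpoch_S, Cmod_mult.
set (t := Cmod Q ^ (S (k + S r) * (S (k + S r) - 1) / 2)) in *.
assert (E : Cmod (1 - / Q ^ (k + S r) * Q ^ k)%C <= 2 * / Cmod Q ^ S r).
{ replace (/ Q ^ (k + S r) * Q ^ k)%C with (/ Q ^ S r)%C.
  2: { rewrite Cpow_add_r; field; split; now apply Cpow_nz. }
  eapply Rle_trans; [apply Cmod_one_minus_le|].
  rewrite Cmod_inv, Cmod_pow by (now apply Cpow_nz).
  assert (1 <= / Cmod Q ^ S r); [|lra].
  rewrite <- Rinv_1; apply Rinv_le_contravar; [now apply pow_lt | apply pow_le_1; lra]. }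
rewrite (tri_S (S r)), pow_add in IH.
replace (2 ^ S k * Cmod Q ^ (S r * (S r - 1) / 2)) with
  (2 ^ k * (Cmod Q ^ (S r * (S r - 1) / 2) * Cmod Q ^ S r) * (2 * / Cmod Q ^ S r)).
2: { simpl (2 ^ S k); field; apply pow_nonzero; lra. }
rewrite Rmult_assoc, (Rmult_comm (Cmod (1 - _)%C)), <- Rmult_assoc.
apply Rmult_le_compat; auto; try apply Cmod_ge_0.
apply Rmult_le_pos; [apply Cmod_ge_0 | apply pow_le; lra].
Qed.

(** * A very-well-poised sum *)

(** The summand of a 6phi5 series with parameters alpha, be and h = alpha Q / be, the other
    two parameters being sent to infinity.  Since (alpha Q;Q)_p / (1 - alpha Q^p) equals
    (alpha;Q)_p / (1 - alpha), this is the usual very-well-poised form. *)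
Definition vwp (al be h Q : C) (p : nat) : C :=
  ((1 - al * (Q ^ p) ^ 2) / (1 - al * Q ^ p) * qpoch (al * Q) Q p
   * qpoch be Q p / (qpoch Q Q p * qpoch h Q p) * h ^ p * Q ^ (p * (p - 1)))%C.

(** The bound is uniform in alpha and h in compact subsets of the unit disc and keeps the
    factor |h|^p, so that it also controls the limit h -> 0 in [vwp_sum]. *)
Lemma vwp_le (be Q : C) (al0 h0 : R) : Cmod Q < 1 -> 0 <= al0 < 1 -> 0 <= h0 < 1 ->
  exists M, 0 <= M /\ forall al h p, Cmod al <= al0 -> Cmod h <= h0 ->
    Cmod (vwp al be h Q p) <= M * (1 / 2) ^ p * Cmod h ^ p.
Proof.
intros HQ Ha0 Hh0. assert (HQ0 := Cmod_ge_0 Q).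
set (R0 := 2 * (1 + Cmod be) * / (1 - Cmod Q) * / (1 - h0)).
assert (I1 : 0 < / (1 - Cmod Q)) by (apply Rinv_0_lt_compat; lra).
assert (I2 : 0 < / (1 - h0)) by (apply Rinv_0_lt_compat; lra).
assert (I3 : 0 < / (1 - al0)) by (apply Rinv_0_lt_compat; lra).
assert (Hb := Cmod_ge_0 be).
destruct (superexp_bound R0 (Cmod Q) (1 / 2)) as [M [HM H]]; [|lra|lra|].
{ unfold R0; repeat apply Rmult_le_pos; lra. }
exists (2 * / (1 - al0) * M); split; [repeat apply Rmult_le_pos; lra|].
intros al h p Hal Hh.
assert (E : Cmod (vwp al be h Q p) <=
  2 * / (1 - al0) * 2 ^ p * (1 + Cmod be) ^ p * ((/ (1 - Cmod Q)) ^ p * (/ (1 - h0)) ^ p)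
  * Cmod h ^ p * Cmod Q ^ (p * (p - 1) / 2)).
{ unfold vwp, Cdiv.
  rewrite !Cmod_mult.
  assert (Hi : Cmod (/ (qpoch Q Q p * qpoch h Q p))%C
     = Cmod (/ qpoch Q Q p)%C * Cmod (/ qpoch h Q p)%C).
  { rewrite <- Cmod_mult; f_equal; field.
    split; apply qpoch_neq_0_lt1; lra. }
  rewrite Hi.
  repeat (apply Rmult_le_compat; [repeat apply Rmult_le_pos; apply Cmod_ge_0 | try apply Cmod_ge_0 | | ]).
  all: try (repeat apply Rmult_le_pos; apply Cmod_ge_0).
  all: try (rewrite !Cmod_pow; try apply Rle_refl).
  - eapply Rle_trans; [apply Cmod_one_minus_le|].
    assert (T : Cmod (al * (Q ^ p) ^ 2)%C <= Cmod al).
    { apply Cmod_mult_pow_le; apply Cmod_pow_le_1; lra. }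
    lra.
  - apply Cmod_one_minus_inv_le; [|lra].
    eapply Rle_trans; [apply Cmod_mult_pow_le; lra | auto].
  - replace 2 with (1 + 1) by ring. apply qpoch_le; [lra|].
    rewrite Cmod_mult; replace 1 with (1 * 1) by ring.
    apply Rmult_le_compat; try apply Cmod_ge_0; lra.
  - apply qpoch_le; lra.
  - apply qpoch_inv_le; lra.
  - apply qpoch_inv_le; lra.
  - apply pow_tri_le; lra. }
eapply Rle_trans; [exact E|].
replace (2 * / (1 - al0) * 2 ^ p * (1 + Cmod be) ^ p * ((/ (1 - Cmod Q)) ^ p * (/ (1 - h0)) ^ p)
  * Cmod h ^ p * Cmod Q ^ (p * (p - 1) / 2))
 with (2 * / (1 - al0) * (R0 ^ p * Cmod Q ^ (p * (p - 1) / 2)) * Cmod h ^ p)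
 by (unfold R0; rewrite !Rpow_mult_distr; ring).
apply Rmult_le_compat_r; [apply pow_le, Cmod_ge_0|].
rewrite !Rmult_assoc; apply Rmult_le_compat_l; [lra|].
apply Rmult_le_compat_l; [lra|]. apply H.
Qed.

(** The telescoping certificate of [vwp_step], of Wilf-Zeilberger type. *)
Definition vwp_cert (al be h Q : C) (p : nat) : C :=
  (- ((1 - h) * (1 - Q ^ p) / (1 - al * (Q ^ p) ^ 2)) * vwp al be h Q p)%C.

Lemma Cpow_S_pred (Q : C) (p : nat) : (Q ^ (S p * (S p - 1)) = Q ^ (p * (p - 1)) * (Q ^ p) ^ 2)%C.
Proof.
replace (S p * (S p - 1))%nat with (p * (p - 1) + p * 2)%nat by (destruct p; simpl; lia).
now rewrite Cpow_add_r, (Cpow_mult_r Q p 2).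
Qed.

(** Shifting alpha and h by Q while keeping be fixed changes the summand, up to the factors
    of the closed form, by a difference in p; hence the sum satisfies a first-order
    recurrence under this shift. *)
Lemma vwp_step (al be h Q : C) (p : nat) : Q <> 0%C -> Cmod Q < 1 ->
  (al * Q = h * be)%C -> Cmod al < 1 -> Cmod h < 1 ->
  ((1 - h) * vwp al be h Q p - (1 - al * Q) * vwp (al * Q) be (h * Q) Q p =
   vwp_cert al be h Q (S p) - vwp_cert al be h Q p)%C.
Proof.
intros HQ HQ1 E Hal Hh.
assert (Nh : forall j, (1 - h * Q ^ j)%C <> 0%C) by (intro; apply one_minus_mult_pow_neq_0; lra).
assert (Na : forall j, (1 - al * Q ^ j)%C <> 0%C) by (intro; apply one_minus_mult_pow_neq_0; lra).
assert (NQ : forall j, (1 - Q * Q ^ j)%C <> 0%C) by (intro; apply one_minus_mult_pow_neq_0; lra).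
unfold vwp_cert, vwp. rewrite Cpow_S_pred.
rewrite (qpoch_shift_eq (al * Q)) by (specialize (Na 1%nat); now rewrite Cpow_1_r in Na).
rewrite (qpoch_shift_eq h) by (specialize (Nh 0%nat); simpl in Nh; now rewrite Cmult_1_r in Nh).
assert (Nq : qpoch Q Q p <> 0%C) by now apply qpoch_neq_0.
assert (Nhp : qpoch h Q p <> 0%C) by now apply qpoch_neq_0.
rewrite Cpow_mult_l.
simpl qpoch. rewrite !Cpow_S.
assert (Na1 := Na 0%nat); assert (Nau := Na p); assert (Nau1 := Na (S p));
assert (Na2 := Na (p * 2)%nat); assert (Na3 := Na (S p * 2)%nat); assert (Na4 := Na 1%nat).
assert (Nh1 := Nh 0%nat); assert (Nhu := Nh p); assert (Nhu1 := Nh (S p)); assert (Nqu := NQ p).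
clear Na Nh NQ.
rewrite !Cpow_mult_r, !Cpow_S in *.
generalize dependent (qpoch Q Q p); intros qQ Nq.
generalize dependent (qpoch h Q p); intros qh Nhp.
generalize (qpoch (al * Q) Q p) (qpoch be Q p) (Q ^ (p * (p - 1)))%C (h ^ p)%C; intros qa qb w H.
generalize dependent (Q ^ p)%C; intros u.
simpl Cpow; intros.
rewrite !Cmult_1_r in *.
assert (Ea : al = (h * be / Q)%C) by (rewrite <- E; field; auto).
subst al.
field; repeat split; auto.
- replace (Q - h * be * u)%C with (Q * (1 - h * be / Q * u))%C by (field; auto).
  now apply Cmult_neq_0.
- replace (Q - h * be * (u * u))%C with (Q * (1 - h * be / Q * (u * u)))%C by (field; auto).
  now apply Cmult_neq_0.
- replace (h * be * u)%C with (h * be / Q * (Q * u))%C by (field; auto). exact Nau1.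
- replace (h * be * (u * (Q * u)))%C with (h * be / Q * (Q * u * (Q * u)))%C by (field; auto).
  exact Na3.
- now rewrite <- E.
Qed.

Lemma vwp_0 (al be h Q : C) : Cmod al < 1 -> vwp al be h Q 0 = 1%C.
Proof.
intro Hal; assert (N := one_minus_neq_0 al Hal).
unfold vwp; simpl. field. exact N.
Qed.

Lemma vwp_converges (al be h Q : C) : Cmod Q < 1 -> Cmod al < 1 -> Cmod h < 1 ->
  exists l : C, is_series (vwp al be h Q) l.
Proof.
intros HQ Hal Hh.
destruct (vwp_le be Q (Cmod al) (Cmod h)) as [M [HM H]]; auto.
{ split; [apply Cmod_ge_0 | auto]. }
{ split; [apply Cmod_ge_0 | auto]. }
apply geo_series_converges with (M := M) (r := 1 / 2); [lra|].
intro k; eapply Rle_trans; [apply H; lra|].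
rewrite <- (Rmult_1_r (M * (1 / 2) ^ k)) at 2.
apply Rmult_le_compat_l; [apply Rmult_le_pos; auto; apply pow_le; lra|].
apply pow_le_1; split; [apply Cmod_ge_0 | lra].
Qed.

Lemma vwp_sum_shift (al be h Q l l' : C) : Q <> 0%C -> Cmod Q < 1 ->
  (al * Q = h * be)%C -> Cmod al < 1 -> Cmod h < 1 ->
  is_series (vwp al be h Q) l -> is_series (vwp (al * Q) be (h * Q) Q) l' ->
  ((1 - h) * l = (1 - al * Q) * l')%C.
Proof.
intros HQ HQ1 E Hal Hh Hl Hl'.
assert (HG : is_series (fun p => vwp_cert al be h Q (S p) - vwp_cert al be h Q p)%C
               (- vwp_cert al be h Q 0)%C).
{ destruct (vwp_le be Q (Cmod al) (Cmod h)) as [M [HM H]]; auto.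
  { split; [apply Cmod_ge_0 | auto]. }
  { split; [apply Cmod_ge_0 | auto]. }
  apply is_series_telescope with (M := 2 * 2 * / (1 - Cmod al) * M) (r := 1 / 2); [lra|].
  intro k; unfold vwp_cert, Cdiv.
  rewrite Cmod_mult, Cmod_opp, !Cmod_mult, !Rmult_assoc.
  assert (HQ0 := Cmod_ge_0 Q). assert (Ha0 := Cmod_ge_0 al). assert (Hh0 := Cmod_ge_0 h).
  apply Rmult_le_compat; try (repeat apply Rmult_le_pos; apply Cmod_ge_0).
  { eapply Rle_trans; [apply Cmod_one_minus_le|]; lra. }
  apply Rmult_le_compat; try (repeat apply Rmult_le_pos; apply Cmod_ge_0).
  { eapply Rle_trans; [apply Cmod_one_minus_le|].
    assert (T := Cmod_pow_le_1 Q k); lra. }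
  apply Rmult_le_compat; try (repeat apply Rmult_le_pos; apply Cmod_ge_0).
  { apply Cmod_one_minus_inv_le; [|lra].
    apply Cmod_mult_pow_le; apply Cmod_pow_le_1; lra. }
  eapply Rle_trans; [apply H; lra|].
  rewrite <- (Rmult_1_r (M * (1 / 2) ^ k)) at 2.
  apply Rmult_le_compat_l; [apply Rmult_le_pos; auto; apply pow_le; lra|].
  apply pow_le_1; lra. }
assert (HS : is_series (fun p => vwp_cert al be h Q (S p) - vwp_cert al be h Q p)%C
               ((1 - h) * l + (- (1 - al * Q)) * l')%C).
{ eapply is_series_Cext; [|reflexivity|
    apply is_series_Cplus; apply is_series_Cscal; [exact Hl | exact Hl']].
  intro p; cbv beta; rewrite <- vwp_step by auto; ring. }
assert (Z := is_series_Cunique _ _ _ HS HG).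
unfold vwp_cert in Z; simpl in Z.
apply Ceq_minus.
transitivity ((1 - h) * l + - (1 - al * Q) * l')%C; [ring|].
rewrite Z; field.
now apply one_minus_neq_0.
Qed.

(** Iterating [vwp_sum_shift] M times gives (h;Q)_M S(alpha, h) = (alpha Q;Q)_M S(alpha Q^M,
    h Q^M).  As M grows the last sum tends to its first term 1, because all its other terms
    carry a power of h Q^M. *)
Theorem vwp_sum (al be h Q : C) : Q <> 0%C -> Cmod Q < 1 ->
  (al * Q = h * be)%C -> Cmod al < 1 -> Cmod h < 1 ->
  is_series (vwp al be h Q) (qpoch_inf (al * Q) Q / qpoch_inf h Q)%C.
Proof.
intros HQ HQ1 E Hal Hh.
assert (Hm : forall z (M : nat), Cmod z < 1 -> Cmod (z * Q ^ M)%C < 1).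
{ intros z M Hz; eapply Rle_lt_trans; [apply Cmod_mult_pow_le; lra | auto]. }
set (t := fun M : nat => vwp (al * Q ^ M) be (h * Q ^ M) Q).
assert (Hs : forall M, exists l : C, is_series (t M) l).
{ intro M; exact (vwp_converges _ be _ Q HQ1 (Hm al M Hal) (Hm h M Hh)). }
set (L := fun M => CSeries (t M)).
assert (HL : forall M, is_series (t M) (L M)).
{ intro M; destruct (Hs M) as [l Hl]; unfold L; now rewrite (CSeries_unique _ _ Hl). }
assert (Hr : forall M, (qpoch h Q M * L 0%nat = qpoch (al * Q) Q M * L M)%C).
{ induction M as [|M IH]; [reflexivity|].
  simpl qpoch.
  assert (St : ((1 - h * Q ^ M) * L M = (1 - al * Q ^ M * Q) * L (S M))%C).
  { apply (vwp_sum_shift (al * Q ^ M) be (h * Q ^ M) Q); auto.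
    - replace (al * Q ^ M * Q)%C with (al * Q * Q ^ M)%C by ring. rewrite E; ring.
    - exact (HL M).
    - replace (al * Q ^ M * Q)%C with (al * Q ^ S M)%C by (rewrite Cpow_S; ring).
      replace (h * Q ^ M * Q)%C with (h * Q ^ S M)%C by (rewrite Cpow_S; ring).
      exact (HL (S M)). }
  transitivity ((1 - h * Q ^ M) * (qpoch h Q M * L 0%nat))%C; [ring|].
  rewrite IH.
  transitivity (qpoch (al * Q) Q M * ((1 - h * Q ^ M) * L M))%C; [ring|].
  rewrite St; ring. }
assert (L1 : Clim L 1%C).
{ destruct (vwp_le be Q (Cmod al) (Cmod h)) as [K [HK H]]; auto.
  { split; [apply Cmod_ge_0 | auto]. }
  { split; [apply Cmod_ge_0 | auto]. }
  apply Clim_squeeze with (fun M => K / (1 - 1 / 2) * Cmod Q ^ M).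
  2: { apply is_lim_seq_geom_scal; split; [apply Cmod_ge_0 | auto]. }
  intro M.
  assert (T : is_series (fun p => t M (S p)) (L M - 1)%C).
  { apply (is_series_incr_1 (V := C_NormedModule) (t M)).
    replace (plus _ _) with (L M); [exact (HL M)|].
    unfold t at 1; rewrite vwp_0 by auto; unfold plus; simpl; ring. }
  apply geo_series_le with (M := K * Cmod Q ^ M) (r := 1 / 2) in T.
  - eapply Rle_trans; [exact T|]; right; field.
  - lra.
  - apply Rmult_le_pos; auto; apply pow_le, Cmod_ge_0.
  - intro p; unfold t.
    eapply Rle_trans; [apply H; apply Cmod_mult_pow_le; lra|].
    rewrite Cmod_mult, Cmod_pow.
    assert (P : 0 <= Cmod Q ^ M <= 1).
    { split; [apply pow_le, Cmod_ge_0 | apply pow_le_1; split; [apply Cmod_ge_0 | lra]]. }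
    assert (Hh0 := Cmod_ge_0 h).
    assert (X : (Cmod h * Cmod Q ^ M) ^ S p <= Cmod Q ^ M).
    { simpl.
      assert (0 <= Cmod h * Cmod Q ^ M <= Cmod Q ^ M) by (split; nra).
      assert (0 <= (Cmod h * Cmod Q ^ M) ^ p <= 1).
      { split; [apply pow_le; lra | apply pow_le_1; lra]. }
      nra. }
    assert (Y : 0 <= (1 / 2) ^ p) by (apply pow_le; lra).
    simpl pow at 1.
    replace (K * Cmod Q ^ M * (1 / 2) ^ p) with (K * (1 / 2) ^ p * Cmod Q ^ M) by ring.
    apply Rmult_le_compat; auto.
    + repeat apply Rmult_le_pos; lra.
    + apply pow_le, Rmult_le_pos; lra.
    + rewrite <- Rmult_assoc, (Rmult_comm K), Rmult_assoc, (Rmult_comm (1 / 2)).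
      assert (0 <= K * (1 / 2) ^ p) by now apply Rmult_le_pos. lra. }
assert (F : (qpoch_inf h Q * L 0%nat = qpoch_inf (al * Q) Q * 1)%C).
{ apply (Clim_unique (fun M => qpoch h Q M * L 0%nat)%C).
  - apply (Clim_mult _ (fun _ => L 0%nat)); [now apply qpoch_Clim | apply Clim_const].
  - apply (Clim_ext (fun M => qpoch (al * Q) Q M * L M)%C); [intro; now rewrite Hr|].
    apply Clim_mult; auto; now apply qpoch_Clim. }
assert (Nh : qpoch_inf h Q <> 0%C).
{ apply qpoch_inf_neq_0; auto; intro j; apply one_minus_mult_pow_neq_0; lra. }
replace (qpoch_inf (al * Q) Q / qpoch_inf h Q)%C with (L 0%nat).
- apply (is_series_Cext (t 0%nat) _ (L 0%nat)); auto.
  intro p; unfold t; simpl; now rewrite !Cmult_1_r.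
- replace (qpoch_inf (al * Q) Q) with (qpoch_inf h Q * L 0%nat)%C by (rewrite F; ring).
  field; auto.
Qed.

(** * Contiguous relations of continuous dual q-Hahn polynomials *)

(** The part of the coefficients of an expansion in [qpoch_pair] that depends only on n and
    k.  It vanishes for k > n. *)
Definition qcoef (Q : C) (n k : nat) : C := (qpoch (/ Q ^ n) Q k / qpoch Q Q k * Q ^ k)%C.

Definition no_root_of_unity (Q : C) : Prop := forall j : nat, (1 - Q ^ S j)%C <> 0%C.

Lemma qpoch_Q_neq_0 (Q : C) (k : nat) : no_root_of_unity Q -> qpoch Q Q k <> 0%C.
Proof. intro H; apply qpoch_neq_0; intro j; exact (H j). Qed.

Lemma cont_dual_q_hahn_eq (n : nat) (x g c d Q : C) :
  cont_dual_q_hahn n x g c d Q =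
  (/ g ^ n * sum_n (fun k => qcoef Q n k
     * (qpoch (g * c * Q ^ k) Q (n - k) * qpoch (g * d * Q ^ k) Q (n - k))
     * qpoch_pair g x Q k) n)%C.
Proof.
unfold cont_dual_q_hahn, askey_wilson; f_equal; apply sum_n_ext; intro k; ceq.
replace (g * c * d * 0 * Q ^ n / Q)%C with (RtoC 0) by (unfold Cdiv; ring).
replace (g * 0 * Q ^ k)%C with (RtoC 0) by ring.
rewrite !qpoch_0; unfold qcoef, Cdiv; ring.
Qed.

Lemma qpoch_inv_pow_S (Q : C) (n k : nat) : Q <> 0%C ->
  (qpoch (/ Q ^ S n) Q k * (1 - Q ^ k / Q ^ S n) = (1 - / Q ^ S n) * qpoch (/ Q ^ n) Q k)%C.
Proof.
intro HQ.
replace (Q ^ k / Q ^ S n)%C with (/ Q ^ S n * Q ^ k)%C by (unfold Cdiv; ring).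
rewrite qpoch_shift; do 2 f_equal. rewrite Cpow_S; field.
split; auto. now apply Cpow_nz.
Qed.

(** The q-Pascal rule behind the Christoffel formula. *)
Lemma qcoef_diff (Q : C) (n k : nat) : Q <> 0%C -> no_root_of_unity Q ->
  (qcoef Q n (S k) - qcoef Q (S n) (S k) = / Q ^ n * qcoef Q n k)%C.
Proof.
intros HQ HU; unfold qcoef.
assert (E : qpoch (/ Q ^ S n) Q (S k) = ((1 - / Q ^ S n) * qpoch (/ Q ^ n) Q k)%C).
{ rewrite <- qpoch_inv_pow_S by auto; rewrite qpoch_S; unfold Cdiv; ring. }
rewrite E, !qpoch_S, !Cpow_S.
assert (N := qpoch_Q_neq_0 Q k HU). assert (N1 := HU k); rewrite Cpow_S in N1.
assert (N2 := Cpow_nz Q n HQ).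
field; auto.
Qed.

Lemma qcoef_succ (Q : C) (n k : nat) : no_root_of_unity Q ->
  qcoef Q n (S k) = (qcoef Q n k * (1 - / Q ^ n * Q ^ k) * Q / (1 - Q ^ S k))%C.
Proof.
intros HU; unfold qcoef; rewrite !qpoch_S, !Cpow_S.
assert (N := qpoch_Q_neq_0 Q k HU). assert (N1 := HU k); rewrite Cpow_S in N1.
generalize (/ Q ^ n)%C; intro i; field; auto.
Qed.

Lemma qcoef_pred (Q : C) (n k : nat) : Q <> 0%C -> no_root_of_unity Q ->
  qcoef Q n k = (qcoef Q (S n) k * (1 - / Q ^ S n * Q ^ k) / (1 - / Q ^ S n))%C.
Proof.
intros HQ HU.
assert (N := HU n). assert (NS := Cpow_nz Q (S n) HQ).
assert (N1 : (1 - / Q ^ S n)%C <> 0%C).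
{ intro Z; apply N.
  transitivity (- Q ^ S n * (1 - / Q ^ S n))%C; [field; auto | rewrite Z; ring]. }
assert (E := qpoch_inv_pow_S Q n k HQ).
unfold qcoef.
transitivity ((1 - / Q ^ S n) * qpoch (/ Q ^ n) Q k / (1 - / Q ^ S n) / qpoch Q Q k * Q ^ k)%C.
- generalize dependent (/ Q ^ S n)%C; intros i; intros; field.
  split; auto; now apply qpoch_Q_neq_0.
- rewrite <- E; unfold Cdiv; ring.
Qed.

Lemma qcoef_0 (Q : C) (n : nat) : qcoef Q n 0 = 1%C.
Proof. unfold qcoef; simpl; field. Qed.

Lemma qcoef_out (Q : C) (n : nat) : Q <> 0%C -> no_root_of_unity Q -> qcoef Q n (S n) = 0%C.
Proof.
intros HQ HU; rewrite qcoef_succ by auto.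
assert (N := Cpow_nz Q n HQ).
replace (1 - / Q ^ n * Q ^ n)%C with (RtoC 0) by (field; auto).
unfold Cdiv; ring.
Qed.

Lemma qpoch_pair_shift (g x Q : C) (k : nat) :
  ((1 - 2 * g * x + g ^ 2) * qpoch_pair (g * Q) x Q k = qpoch_pair g x Q (S k))%C.
Proof.
induction k as [|k IH]; [simpl; ring|].
change (qpoch_pair (g * Q) x Q (S k)) with
 (qpoch_pair (g * Q) x Q k * (1 - 2 * (g * Q * Q ^ k) * x + (g * Q * Q ^ k) ^ 2))%C.
change (qpoch_pair g x Q (S (S k))) with
 (qpoch_pair g x Q (S k) * (1 - 2 * (g * Q ^ S k) * x + (g * Q ^ S k) ^ 2))%C.
rewrite <- IH, !Cpow_S; simpl Cpow; ring.
Qed.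

(** Changing the base point g to g Q affects only the first and the last quadratic factor,
    so the connection coefficients are two-term. *)
Lemma qpoch_pair_connect (g x Q : C) (k : nat) : Q <> 0%C ->
  qpoch_pair g x Q (S k) = (/ Q ^ S k * qpoch_pair (g * Q) x Q (S k)
    + (1 - / Q ^ S k) * (1 - g ^ 2 * Q ^ S k) * qpoch_pair (g * Q) x Q k)%C.
Proof.
intro HQ; rewrite <- qpoch_pair_shift; simpl qpoch_pair; rewrite !Cpow_S; simpl Cpow.
assert (N := Cpow_nz Q k HQ). field; auto.
Qed.

Lemma qpoch_last (x Q : C) (n k : nat) : (k <= n)%nat ->
  qpoch (x * Q ^ k) Q (S n - k) = (qpoch (x * Q ^ k) Q (n - k) * (1 - x * Q ^ n))%C.
Proof.
intro H. rewrite Nat.sub_succ_l by auto. simpl qpoch. do 2 f_equal.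
rewrite <- Cmult_assoc, <- Cpow_add_r. do 2 f_equal. lia.
Qed.

Lemma qpoch_first (x Q : C) (n k : nat) : (k <= n)%nat ->
  qpoch (x * Q ^ k) Q (S n - k) = ((1 - x * Q ^ k) * qpoch (x * Q * Q ^ k) Q (n - k))%C.
Proof.
intro H. rewrite Nat.sub_succ_l by auto.
change (qpoch (x * Q ^ k) Q (1 + (n - k)) = (1 - x * Q ^ k) * qpoch (x * Q * Q ^ k) Q (n - k))%C.
rewrite qpoch_add; simpl. f_equal; [ring|]. f_equal; ring.
Qed.

Lemma cdqh_0 (x g c d Q : C) : cont_dual_q_hahn 0 x g c d Q = 1%C.
Proof. rewrite cont_dual_q_hahn_eq, sum_O, qcoef_0; simpl; field. Qed.

(** Multiplication by the factor with roots g and 1/g turns the basis with base point g Q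
    into the one with base point g, shifted by one index; comparing coefficients leaves
    [qcoef_diff]. *)
Lemma cdqh_christoffel (n : nat) (x g c d Q : C) : Q <> 0%C -> no_root_of_unity Q -> g <> 0%C ->
  ((1 - 2 * g * x + g ^ 2) * cont_dual_q_hahn n x (g * Q) c d Q =
   (1 - g * c * Q ^ n) * (1 - g * d * Q ^ n) * cont_dual_q_hahn n x g c d Q
   - g * cont_dual_q_hahn (S n) x g c d Q)%C.
Proof.
intros HQ HU Hg. rewrite !cont_dual_q_hahn_eq.
assert (Ng := Cpow_nz g n Hg). assert (NQ := Cpow_nz Q n HQ).
set (Pi := fun k => (qpoch (g * c * Q ^ k) Q (S n - k) * qpoch (g * d * Q ^ k) Q (S n - k)
   * qpoch_pair g x Q k)%C).
assert (E1 : ((1 - g * c * Q ^ n) * (1 - g * d * Q ^ n) * sum_n (fun k => qcoef Q n k *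
     (qpoch (g * c * Q ^ k) Q (n - k) * qpoch (g * d * Q ^ k) Q (n - k)) *
     qpoch_pair g x Q k) n)%C = sum_n (fun k => qcoef Q n k * Pi k)%C (S n)).
{ rewrite sum_Sn, qcoef_out by auto.
  rewrite sum_n_Cscal.
  replace (plus _ _) with (sum_n (fun k => qcoef Q n k * Pi k)%C n)
    by (unfold plus; simpl; symmetry; ring).
  apply sum_n_ext_loc; intros k Hk; ceq; unfold Pi.
  rewrite !qpoch_last by auto; ring. }
assert (E2 : ((1 - 2 * g * x + g ^ 2) * sum_n (fun k => qcoef Q n k *
     (qpoch (g * Q * c * Q ^ k) Q (n - k) * qpoch (g * Q * d * Q ^ k) Q (n - k)) *
     qpoch_pair (g * Q) x Q k) n)%C = sum_n (fun k => qcoef Q n k * Pi (S k))%C n).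
{ rewrite sum_n_Cscal. apply sum_n_ext_loc; intros k Hk; ceq; unfold Pi.
  rewrite <- qpoch_pair_shift.
  replace (S n - S k)%nat with (n - k)%nat by lia.
  replace (g * c * Q ^ S k)%C with (g * Q * c * Q ^ k)%C by (rewrite Cpow_S; ring).
  replace (g * d * Q ^ S k)%C with (g * Q * d * Q ^ k)%C by (rewrite Cpow_S; ring).
  ring. }
assert (E3 : sum_n (fun k => qcoef Q n k * Pi k)%C (S n) =
   (sum_n (fun k => qcoef Q (S n) k * Pi k)%C (S n)
    + / Q ^ n * sum_n (fun k => qcoef Q n k * Pi (S k)) n)%C).
{ rewrite !sum_n_shift, !qcoef_0, sum_n_Cscal.
  rewrite <- Cplus_assoc, sum_n_Cplus. f_equal.
  apply sum_n_ext; intro k; ceq.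
  replace (qcoef Q n (S k)) with (qcoef Q (S n) (S k) + / Q ^ n * qcoef Q n k)%C; [ring|].
  rewrite <- qcoef_diff by auto; ring. }
assert (E4 : sum_n (fun k => qcoef Q (S n) k *
    (qpoch (g * c * Q ^ k) Q (S n - k) * qpoch (g * d * Q ^ k) Q (S n - k)) *
    qpoch_pair g x Q k)%C (S n) = sum_n (fun k => qcoef Q (S n) k * Pi k)%C (S n)).
{ apply sum_n_ext; intro k; ceq; unfold Pi; ring. }
rewrite E4.
match goal with |- (?w * (/ ?gq * ?S1) = ?f1 * ?f2 * (/ _ * ?S2) - _)%C =>
  transitivity (/ gq * (w * S1))%C; [ring|];
  rewrite E2;
  transitivity (/ g ^ n * (f1 * f2 * S2) - g * (/ g ^ S n * sum_n (fun k => qcoef Q (S n) k * Pi k) (S n)))%C; [|ring];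
  rewrite E1, E3 end.
rewrite Cpow_mult_l, Cpow_S; field; auto.
Qed.

(** Both sides are expanded in the basis with base point g Q by means of
    [qpoch_pair_connect]. *)
Lemma cdqh_uvarov (n : nat) (x g c d Q : C) : Q <> 0%C -> no_root_of_unity Q -> g <> 0%C ->
  (cont_dual_q_hahn (S n) x g c d Q = cont_dual_q_hahn (S n) x (g * Q) c d Q
   - g * (1 - Q ^ S n) * (1 - c * d * Q ^ n) * cont_dual_q_hahn n x (g * Q) c d Q)%C.
Proof.
intros HQ HU Hg. rewrite !cont_dual_q_hahn_eq.
assert (Ng := Cpow_nz g n Hg). assert (NQ := Cpow_nz Q n HQ).
set (psi := qpoch_pair (g * Q) x Q).
set (Pi := fun k => (qpoch (g * Q * c * Q ^ k) Q (n - k) * qpoch (g * Q * d * Q ^ k) Q (n - k)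
   * psi k)%C).
assert (E1 : sum_n (fun k => qcoef Q (S n) k
     * (qpoch (g * c * Q ^ k) Q (S n - k) * qpoch (g * d * Q ^ k) Q (S n - k))
     * qpoch_pair g x Q k)%C (S n) =
   (sum_n (fun k => (qcoef Q (S n) k * / Q ^ k * (1 - g * c * Q ^ k) * (1 - g * d * Q ^ k)
      + qcoef Q (S n) (S k) * (1 - / Q ^ S k) * (1 - g ^ 2 * Q ^ S k)) * Pi k) n
    + qcoef Q (S n) (S n) * / Q ^ S n * psi (S n))%C).
{ set (A := fun k => (qcoef Q (S n) k
     * (qpoch (g * c * Q ^ k) Q (S n - k) * qpoch (g * d * Q ^ k) Q (S n - k)))%C).
  rewrite sum_n_shift.
  rewrite (sum_n_ext _ (fun k => A (S k) * / Q ^ S k * psi (S k)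
     + A (S k) * (1 - / Q ^ S k) * (1 - g ^ 2 * Q ^ S k) * psi k)%C).
  2: { intro k; ceq; rewrite qpoch_pair_connect by auto; fold psi; unfold A; ring. }
  rewrite <- sum_n_Cplus, Cplus_assoc.
  transitivity (sum_n (fun k => A k * / Q ^ k * psi k)%C (S n) +
    sum_n (fun k => A (S k) * (1 - / Q ^ S k) * (1 - g ^ 2 * Q ^ S k) * psi k)%C n)%C.
  { f_equal. rewrite sum_n_shift. f_equal. unfold A, psi; simpl; field. }
  rewrite sum_Sn.
  transitivity ((sum_n (fun k => A k * / Q ^ k * psi k)%C n +
    sum_n (fun k => A (S k) * (1 - / Q ^ S k) * (1 - g ^ 2 * Q ^ S k) * psi k)%C n)
    + A (S n) * / Q ^ S n * psi (S n))%C.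
  { unfold plus; simpl; ceq; ring. }
  f_equal.
  - rewrite sum_n_Cplus; apply sum_n_ext_loc; intros k Hk; ceq.
    unfold A, Pi.
    replace (S n - S k)%nat with (n - k)%nat by lia.
    rewrite !qpoch_first by auto.
    replace (g * c * Q * Q ^ k)%C with (g * Q * c * Q ^ k)%C by ring.
    replace (g * d * Q * Q ^ k)%C with (g * Q * d * Q ^ k)%C by ring.
    replace (g * c * Q ^ S k)%C with (g * Q * c * Q ^ k)%C by (rewrite Cpow_S; ring).
    replace (g * d * Q ^ S k)%C with (g * Q * d * Q ^ k)%C by (rewrite Cpow_S; ring).
    ring.
  - unfold A; rewrite Nat.sub_diag; simpl qpoch; ring. }
assert (E2 : sum_n (fun k => qcoef Q (S n) k
     * (qpoch (g * Q * c * Q ^ k) Q (S n - k) * qpoch (g * Q * d * Q ^ k) Q (S n - k))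
     * psi k)%C (S n) =
   (sum_n (fun k => qcoef Q (S n) k * (1 - g * c * Q ^ S n) * (1 - g * d * Q ^ S n) * Pi k) n
    + qcoef Q (S n) (S n) * psi (S n))%C).
{ rewrite sum_n_Sn_C, Nat.sub_diag. f_equal; [|simpl qpoch; ring].
  apply sum_n_ext_loc; intros k Hk; ceq; unfold Pi; rewrite !qpoch_last by auto.
  rewrite !Cpow_S. ring. }
assert (E3 : sum_n (fun k => qcoef Q n k
     * (qpoch (g * Q * c * Q ^ k) Q (n - k) * qpoch (g * Q * d * Q ^ k) Q (n - k))
     * psi k)%C n = sum_n (fun k => qcoef Q n k * Pi k)%C n).
{ apply sum_n_ext; intro k; ceq; unfold Pi; ring. }
assert (N1 : (1 - Q * Q ^ n)%C <> 0%C) by exact (HU n).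
assert (E4 : sum_n (fun k => (qcoef Q (S n) k * / Q ^ k * (1 - g * c * Q ^ k) * (1 - g * d * Q ^ k)
      + qcoef Q (S n) (S k) * (1 - / Q ^ S k) * (1 - g ^ 2 * Q ^ S k)) * Pi k)%C n =
  (/ Q ^ S n * sum_n (fun k =>
      qcoef Q (S n) k * (1 - g * c * Q ^ S n) * (1 - g * d * Q ^ S n) * Pi k) n
   + (- (g ^ 2 * (1 - Q ^ S n) * (1 - c * d * Q ^ n) * / Q ^ n))
      * sum_n (fun k => qcoef Q n k * Pi k) n)%C).
{ rewrite !sum_n_Cscal, sum_n_Cplus. apply sum_n_ext; intro k; ceq.
  rewrite qcoef_succ, (qcoef_pred Q n k), !Cpow_S by auto.
  assert (Nk := Cpow_nz Q k HQ). assert (N2 := HU k); rewrite Cpow_S in N2.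
  simpl Cpow. field. repeat split; auto.
  intro Z; apply N1; transitivity (- (Q * Q ^ n - 1))%C; [ring | rewrite Z; ring]. }
rewrite E1, E2, E3, E4, !Cpow_mult_l, !Cpow_S. simpl Cpow. field; auto.
Qed.

Lemma al_salam_rec_0 (x g c Q : C) : Q <> 0%C -> no_root_of_unity Q -> g <> 0%C ->
  cont_dual_q_hahn 1 x g c 0 Q = (2 * x - (g + c))%C.
Proof.
intros HQ HU Hg.
assert (E := cdqh_christoffel 0 x g c 0 Q HQ HU Hg).
rewrite !cdqh_0 in E; simpl Cpow in E.
transitivity ((g * cont_dual_q_hahn 1 x g c 0 Q) / g)%C; [field; auto|].
transitivity (((1 - g * c * 1) * (1 - g * 0 * 1) * 1 - ((1 - g * c * 1) * (1 - g * 0 * 1) * 1 - g * cont_dual_q_hahn 1 x g c 0 Q)) / g)%C.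
{ field; auto. }
rewrite <- E; field; auto.
Qed.

(** Multiply the Uvarov formula by the Christoffel factor and eliminate the polynomials with
    parameter g Q. *)
Lemma al_salam_rec (n : nat) (x g c Q : C) : Q <> 0%C -> no_root_of_unity Q -> g <> 0%C ->
  (cont_dual_q_hahn (S (S n)) x g c 0 Q =
   (2 * x - (g + c) * Q ^ S n) * cont_dual_q_hahn (S n) x g c 0 Q
   - (1 - Q ^ S n) * (1 - g * c * Q ^ n) * cont_dual_q_hahn n x g c 0 Q)%C.
Proof.
intros HQ HU Hg.
assert (C1 := cdqh_uvarov n x g c 0 Q HQ HU Hg).
assert (C2 := cdqh_christoffel (S n) x g c 0 Q HQ HU Hg).
assert (C3 := cdqh_christoffel n x g c 0 Q HQ HU Hg).
assert (E : (- g * cont_dual_q_hahn (S (S n)) x g c 0 Q =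
   (1 - 2 * g * x + g ^ 2) * cont_dual_q_hahn (S n) x g c 0 Q
   - (1 - g * c * Q ^ S n) * cont_dual_q_hahn (S n) x g c 0 Q
   + g * (1 - Q ^ S n) * ((1 - g * c * Q ^ n) * cont_dual_q_hahn n x g c 0 Q
      - g * cont_dual_q_hahn (S n) x g c 0 Q))%C).
{ rewrite C1 at 1.
  transitivity ((1 - 2 * g * x + g ^ 2) * cont_dual_q_hahn (S n) x (g * Q) c 0 Q
    - (1 - g * c * Q ^ S n) * cont_dual_q_hahn (S n) x g c 0 Q
    + g * (1 - Q ^ S n) * ((1 - g * c * Q ^ n) * cont_dual_q_hahn n x g c 0 Q
      - g * cont_dual_q_hahn (S n) x g c 0 Q
      - (1 - 2 * g * x + g ^ 2) * cont_dual_q_hahn n x (g * Q) c 0 Q))%C; [|ring].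
  rewrite C2, C3; ring. }
transitivity ((- g * cont_dual_q_hahn (S (S n)) x g c 0 Q) / (- g))%C.
- field; auto.
- rewrite E; simpl (g ^ 2)%C; field; auto.
Qed.

(** * The regularised 2phi2 series *)

(** The terms of the 2phi2 series with parameters a y, a / y; ab, a gam and argument b gam,
    at x = mu y, multiplied by (a gam;Q)_oo.  The product absorbs the denominator parameter
    a gam, so that the sum is entire in gam. *)
Definition phi_term (x a b Q gam : C) (k : nat) : C :=
  (qpoch_pair a x Q k / (qpoch Q Q k * qpoch (a * b) Q k)
   * qpoch_inf (a * gam * Q ^ k) Q * (- (b * gam)) ^ k * Q ^ (k * (k - 1) / 2))%C.

Definition phi_reg (x a b Q gam : C) : C := CSeries (phi_term x a b Q gam).

Lemma qpoch_pair_le (a x Q : C) (k : nat) : Cmod Q <= 1 ->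
  Cmod (qpoch_pair a x Q k) <= (1 + 2 * Cmod a * Cmod x + Cmod a ^ 2) ^ k.
Proof.
intro HQ; induction k as [|k IH]; [simpl; rewrite Cmod_1; lra|].
simpl qpoch_pair; rewrite Cmod_mult, Rmult_comm; simpl pow at 2.
apply Rmult_le_compat; try apply Cmod_ge_0; auto.
assert (T := Cmod_mult_pow_le a Q k HQ).
set (u := (a * Q ^ k)%C) in *.
eapply Rle_trans; [apply Cmod_triangle|].
apply Rplus_le_compat.
- eapply Rle_trans; [apply Cmod_one_minus_le|].
  rewrite !Cmod_mult, Cmod_R, Rabs_pos_eq by lra.
  apply Rplus_le_compat_l, Rmult_le_compat_r; [apply Cmod_ge_0|].
  apply Rmult_le_compat_l; lra.
- rewrite Cmod_mult, Cmult_1_r, <- (Rmult_1_r (Cmod a)).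
  rewrite Rmult_1_r. apply Rmult_le_compat; try apply Cmod_ge_0; lra.
Qed.

Lemma phi_term_le (x a b Q gam : C) (r : R) : Cmod Q < 1 -> Cmod (a * b) < 1 -> 0 < r ->
  exists M, 0 <= M /\ forall k, Cmod (phi_term x a b Q gam k) <= M * r ^ k.
Proof.
intros HQ Hab Hr. assert (HQ0 := Cmod_ge_0 Q).
assert (I1 : 0 < / (1 - Cmod Q)) by (apply Rinv_0_lt_compat; lra).
assert (I2 : 0 < / (1 - Cmod (a * b)%C)) by (apply Rinv_0_lt_compat; lra).
assert (Ha := Cmod_ge_0 a). assert (Hx := Cmod_ge_0 x).
assert (I3 : 0 <= 1 + 2 * Cmod a * Cmod x + Cmod a ^ 2) by (simpl; nra).
set (R0 := (1 + 2 * Cmod a * Cmod x + Cmod a ^ 2)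
  * (/ (1 - Cmod Q) * / (1 - Cmod (a * b)%C)) * Cmod (b * gam)%C).
destruct (superexp_bound R0 (Cmod Q) r) as [M [HM H]]; [|lra|lra|].
{ unfold R0; repeat apply Rmult_le_pos; try lra; apply Cmod_ge_0. }
set (K := exp (Cmod (a * gam)%C / (1 - Cmod Q))).
assert (HK : 0 < K) by apply exp_pos.
exists (K * M); split; [apply Rmult_le_pos; lra|].
intro k. rewrite Rmult_assoc.
eapply Rle_trans; [|apply Rmult_le_compat_l; [lra | apply H]].
unfold phi_term, Cdiv; rewrite !Cmod_mult.
assert (Hi : Cmod (/ (qpoch Q Q k * qpoch (a * b) Q k))%C
   = Cmod (/ qpoch Q Q k)%C * Cmod (/ qpoch (a * b) Q k)%C).
{ rewrite <- Cmod_mult; f_equal; field; split; apply qpoch_neq_0_lt1; lra. }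
rewrite Hi.
replace (K * (R0 ^ k * Cmod Q ^ (k * (k - 1) / 2))) with
 ((1 + 2 * Cmod a * Cmod x + Cmod a ^ 2) ^ k
  * ((/ (1 - Cmod Q)) ^ k * (/ (1 - Cmod (a * b)%C)) ^ k) * K * Cmod (b * gam)%C ^ k
  * Cmod Q ^ (k * (k - 1) / 2))
 by (unfold R0; rewrite !Rpow_mult_distr; ring).
repeat (apply Rmult_le_compat; [repeat apply Rmult_le_pos; apply Cmod_ge_0 | try apply Cmod_ge_0 | | ]).
all: try (repeat apply Rmult_le_pos; apply Cmod_ge_0).
- apply qpoch_pair_le; lra.
- apply qpoch_inv_le; lra.
- apply qpoch_inv_le; lra.
- eapply Rle_trans; [now apply qpoch_inf_bounded|].
  assert (T := Cmod_mult_pow_le (a * gam) Q k).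
  apply exp_le_exp, Rmult_le_compat_r; lra.
- rewrite Cmod_pow, Cmod_opp; lra.
- rewrite Cmod_pow; lra.
Qed.

Lemma phi_reg_correct (x a b Q gam : C) : Cmod Q < 1 -> Cmod (a * b) < 1 ->
  is_series (phi_term x a b Q gam) (phi_reg x a b Q gam).
Proof.
intros HQ Hab.
destruct (phi_term_le x a b Q gam (1 / 2) HQ Hab) as [M [HM H]]; [lra|].
destruct (geo_series_converges _ M (1 / 2) ltac:(lra) H) as [l Hl].
unfold phi_reg; now rewrite (CSeries_unique _ _ Hl).
Qed.

(** The telescoping certificate of [phi_term_rec]. *)
Definition phi_cert (x a b Q gam : C) (k : nat) : C :=
  ((1 - Q ^ k) * (1 - a * b * Q ^ k / Q) / Q ^ k * phi_term x a b Q (Q * gam) k)%C.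

Lemma phi_term_rec (x a b Q gam : C) (k : nat) : Q <> 0%C -> Cmod Q < 1 -> Cmod (a * b) < 1 ->
  (phi_term x a b Q gam k
   - (1 + a * b / Q - gam * (a + b)) * phi_term x a b Q (Q * gam) k
   + a * b / Q * (1 - 2 * (Q * gam) * x + (Q * gam) ^ 2) * phi_term x a b Q (Q * (Q * gam)) k
   = phi_cert x a b Q gam k - phi_cert x a b Q gam (S k))%C.
Proof.
intros HQ HQ1 Hab.
unfold phi_cert, phi_term. rewrite tri_S, Cpow_add_r.
set (V := qpoch_inf (a * gam * Q ^ k * Q * Q) Q).
replace (qpoch_inf (a * (Q * (Q * gam)) * Q ^ k) Q) with V by (unfold V; f_equal; ring).
replace (qpoch_inf (a * (Q * gam) * Q ^ S k) Q) with V by (unfold V; f_equal; rewrite Cpow_S; ring).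
replace (qpoch_inf (a * (Q * gam) * Q ^ k) Q) with ((1 - a * gam * Q ^ k * Q) * V)%C.
2: { unfold V; rewrite <- qpoch_inf_S by auto; f_equal; ring. }
replace (qpoch_inf (a * gam * Q ^ k) Q) with
  ((1 - a * gam * Q ^ k) * ((1 - a * gam * Q ^ k * Q) * V))%C.
2: { unfold V; rewrite <- !qpoch_inf_S by auto; reflexivity. }
assert (N1 : qpoch Q Q k <> 0%C) by (apply qpoch_neq_0_lt1; lra).
assert (N2 : qpoch (a * b) Q k <> 0%C) by (apply qpoch_neq_0_lt1; lra).
assert (N3 : (1 - Q * Q ^ k)%C <> 0%C) by (apply one_minus_mult_pow_neq_0; lra).
assert (N4 : (1 - a * b * Q ^ k)%C <> 0%C) by (apply one_minus_mult_pow_neq_0; lra).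
assert (N5 := Cpow_nz Q k HQ).
replace (- (b * (Q * (Q * gam))))%C with (Q * (Q * (- (b * gam))))%C by ring.
replace (- (b * (Q * gam)))%C with (Q * (- (b * gam)))%C by ring.
rewrite !qpoch_S, !Cpow_mult_l, !Cpow_S.
simpl qpoch_pair.
field; auto 10.
Qed.

(** A second-order q-difference equation in gam.  Its middle coefficient does not contain x,
    which is what allows it to be matched with the relations between the polynomials in
    [closed_form_rec]. *)
Lemma phi_reg_rec (x a b Q gam : C) : Q <> 0%C -> Cmod Q < 1 -> Cmod (a * b) < 1 ->
  (phi_reg x a b Q gam
   - (1 + a * b / Q - gam * (a + b)) * phi_reg x a b Q (Q * gam)
   + a * b / Q * (1 - 2 * (Q * gam) * x + (Q * gam) ^ 2) * phi_reg x a b Q (Q * (Q * gam))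
   = 0)%C.
Proof.
intros HQ HQ1 Hab.
assert (HQ0 : 0 < Cmod Q) by now apply Cmod_gt_0.
assert (HG : is_series (fun k => phi_cert x a b Q gam (S k) - phi_cert x a b Q gam k)%C
               (- phi_cert x a b Q gam 0)%C).
{ destruct (phi_term_le x a b Q (Q * gam) (Cmod Q * (1 / 2)) HQ1 Hab) as [M [HM H]]; [lra|].
  apply is_series_telescope with (M := 2 * (1 + Cmod (a * b / Q)%C) * M) (r := 1 / 2); [lra|].
  intro k; unfold phi_cert, Cdiv.
  rewrite !Cmod_mult.
  replace (2 * (1 + Cmod a * Cmod b * Cmod (/ Q)%C) * M * (1 / 2) ^ k)
    with (2 * (1 + Cmod (a * b / Q)%C) * / (Cmod Q ^ k) * (M * (Cmod Q * (1 / 2)) ^ k)).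
  2: { unfold Cdiv; rewrite Rpow_mult_distr, !Cmod_mult; field. apply pow_nonzero; lra. }
  apply Rmult_le_compat; auto; try (repeat apply Rmult_le_pos; apply Cmod_ge_0).
  apply Rmult_le_compat; auto; try (repeat apply Rmult_le_pos; apply Cmod_ge_0).
  2: { rewrite Cmod_inv, Cmod_pow by (now apply Cpow_nz). lra. }
  apply Rmult_le_compat; auto; try (repeat apply Rmult_le_pos; apply Cmod_ge_0).
  - eapply Rle_trans; [apply Cmod_one_minus_le|].
    assert (T := Cmod_pow_le_1 Q k); lra.
  - eapply Rle_trans; [apply Cmod_one_minus_le|].
    replace (a * b * Q ^ k * / Q)%C with (a * b / Q * Q ^ k)%C by (unfold Cdiv; ring).
    apply Rplus_le_compat_l, Cmod_mult_pow_le; lra. }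
assert (HS : is_series (fun k => phi_cert x a b Q gam (S k) - phi_cert x a b Q gam k)%C
  (- (1) * (phi_reg x a b Q gam
   + (- (1 + a * b / Q - gam * (a + b)) * phi_reg x a b Q (Q * gam)
   + a * b / Q * (1 - 2 * (Q * gam) * x + (Q * gam) ^ 2) * phi_reg x a b Q (Q * (Q * gam)))))%C).
{ eapply is_series_Cext; [|reflexivity|].
  2: { apply is_series_Cscal, is_series_Cplus; [|apply is_series_Cplus; apply is_series_Cscal];
       apply phi_reg_correct; auto. }
  intro k; cbv beta.
  match goal with |- _ = (?u - ?v)%C => transitivity (- (v - u))%C; [|ring] end.
  rewrite <- phi_term_rec by auto; ring. }
assert (Z := is_series_Cunique _ _ _ HS HG).
assert (Z0 : phi_cert x a b Q gam 0 = 0%C).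
{ unfold phi_cert; simpl Cpow. unfold Cdiv; ring. }
rewrite Z0 in Z.
match goal with |- ?l = _ => transitivity (- (- (1) * l))%C; [ring|] end.
match type of Z with ?l = _ => transitivity (- l)%C; [ring | rewrite Z; ring] end.
Qed.

Lemma phi22_phi_reg (a b gam y Q : C) : Cmod Q < 1 -> Cmod (a * b) < 1 -> y <> 0%C ->
  (forall j, (1 - a * gam * Q ^ j)%C <> 0%C) ->
  phi22 (a / y) (a * y) (a * b) (a * gam) Q (b * gam)
  = (phi_reg (mu y) a b Q gam / qpoch_inf (a * gam) Q)%C.
Proof.
intros HQ Hab Hy HD.
assert (ND := qpoch_inf_neq_0 (a * gam) Q HQ HD).
apply CSeries_unique.
eapply is_series_Cext; [| |exact (is_series_Cscal (/ qpoch_inf (a * gam) Q)%C _ _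
  (phi_reg_correct (mu y) a b Q gam HQ Hab))].
2: { unfold Cdiv; ring. }
intro k; cbv beta; unfold phi_term; rewrite qpoch_pair_mu by auto.
assert (E := qpoch_inf_split (a * gam) Q k HQ).
assert (NI : qpoch_inf (a * gam * Q ^ k) Q <> 0%C).
{ intro Z; apply ND; rewrite E, Z; ring. }
assert (NP : qpoch (a * gam) Q k <> 0%C) by now apply qpoch_neq_0.
rewrite E.
replace (- (b * gam))%C with ((-1) * (b * gam))%C by ring; rewrite Cpow_mult_l.
field; repeat split; auto; apply qpoch_neq_0_lt1; lra.
Qed.

(** * Geometric growth *)

(** All factors of the summand except the Gaussian ones Q^(p(p-1)) and (Q^(-p);Q)_k are of
    this kind. *)
Definition geo_bounded (u : nat -> C) : Prop :=
  exists K R0 : R, 0 <= K /\ 1 <= R0 /\ forall p, Cmod (u p) <= K * R0 ^ p.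

Lemma geo_bounded_ext (u v : nat -> C) : (forall p, u p = v p) -> geo_bounded u -> geo_bounded v.
Proof.
intros E (K & R0 & HK & HR & H); exists K, R0; repeat split; auto; intro p; now rewrite <- E.
Qed.

Lemma geo_bounded_bounded (u : nat -> C) (K : R) : (forall p, Cmod (u p) <= K) -> geo_bounded u.
Proof.
intro H; exists K, 1; repeat split; try lra.
- eapply Rle_trans; [apply Cmod_ge_0 | apply (H 0%nat)].
- intro p; rewrite pow1, Rmult_1_r; apply H.
Qed.

Lemma geo_bounded_le (u : nat -> C) (R0 : R) : (forall p, Cmod (u p) <= R0 ^ p) -> geo_bounded u.
Proof.
intro H; exists 1, (Rmax 1 R0); repeat split; try lra; [apply Rmax_l|].
intro p; rewrite Rmult_1_l; eapply Rle_trans; [apply H|].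
assert (P := H 1%nat); simpl in P; rewrite Rmult_1_r in P.
apply pow_incr; split; [|apply Rmax_r].
eapply Rle_trans; [apply Cmod_ge_0 | exact P].
Qed.

Lemma geo_bounded_const (z : C) : geo_bounded (fun _ => z).
Proof. apply (geo_bounded_bounded _ (Cmod z)); intro; lra. Qed.

Lemma geo_bounded_pow (z : C) : geo_bounded (fun p => z ^ p)%C.
Proof. apply (geo_bounded_le _ (Cmod z)); intro; rewrite Cmod_pow; lra. Qed.

Lemma geo_bounded_inv_pow (z : C) : z <> 0%C -> geo_bounded (fun p => / z ^ p)%C.
Proof.
intro Hz; apply (geo_bounded_le _ (/ Cmod z)); intro p.
rewrite Cmod_inv, Cmod_pow, pow_inv by (now apply Cpow_nz); lra.
Qed.

Lemma geo_bounded_qpoch (z Q : C) : Cmod Q <= 1 -> geo_bounded (qpoch z Q).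
Proof. intro HQ; apply (geo_bounded_le _ (1 + Cmod z)); intro p; apply qpoch_le; lra. Qed.

Lemma geo_bounded_qpoch_inv (z Q : C) : Cmod Q <= 1 -> Cmod z < 1 ->
  geo_bounded (fun p => / qpoch z Q p)%C.
Proof.
intros HQ Hz; apply (geo_bounded_le _ (/ (1 - Cmod z))); intro p; apply qpoch_inv_le; lra.
Qed.

Lemma geo_bounded_plus (u v : nat -> C) :
  geo_bounded u -> geo_bounded v -> geo_bounded (fun p => u p + v p)%C.
Proof.
intros (K & R0 & HK & HR & H) (K' & R0' & HK' & HR' & H').
exists (K + K'), (Rmax R0 R0'); repeat split; [lra | eapply Rle_trans; [exact HR | apply Rmax_l] |].
intro p; eapply Rle_trans; [apply Cmod_triangle|].
rewrite Rmult_plus_distr_r; apply Rplus_le_compat.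
- eapply Rle_trans; [apply H|]. apply Rmult_le_compat_l; auto.
  apply pow_incr; split; [lra | apply Rmax_l].
- eapply Rle_trans; [apply H'|]. apply Rmult_le_compat_l; auto.
  apply pow_incr; split; [lra | apply Rmax_r].
Qed.

Lemma geo_bounded_mult (u v : nat -> C) :
  geo_bounded u -> geo_bounded v -> geo_bounded (fun p => u p * v p)%C.
Proof.
intros (K & R0 & HK & HR & H) (K' & R0' & HK' & HR' & H').
exists (K * K'), (R0 * R0'); repeat split; [now apply Rmult_le_pos | nra |].
intro p; rewrite Cmod_mult, Rpow_mult_distr.
replace (K * K' * (R0 ^ p * R0' ^ p)) with (K * R0 ^ p * (K' * R0' ^ p)) by ring.
apply Rmult_le_compat; auto; apply Cmod_ge_0.
Qed.

(** * The bilinear sum with free parameters *)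

Lemma Cinv_neq_0 (z : C) : z <> 0%C -> (/ z)%C <> 0%C.
Proof. intros Hz E; apply C1_nz; rewrite <- (Cinv_r z Hz), E; ring. Qed.

Lemma Cdiv_neq_0 (u v : C) : u <> 0%C -> v <> 0%C -> (u / v)%C <> 0%C.
Proof. intros Hu Hv; apply Cmult_neq_0; auto; now apply Cinv_neq_0. Qed.

Lemma two_mu (y : C) : y <> 0%C -> (2 * mu y = y + / y)%C.
Proof. intro Hy; unfold mu; field; auto. Qed.

Section BilinearSum.

(** Free parameters: in the end e is e^(i theta) and tau is s / q^(2 k2), and the two
    equations are the relations that then hold between them and a, b, c, d. *)
Variables Q a b c d e tau x : C.
Hypothesis Q_neq_0 : Q <> 0%C.
Hypothesis Q_lt_1 : Cmod Q < 1.
Hypothesis b_neq_0 : b <> 0%C.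
Hypothesis c_neq_0 : c <> 0%C.
Hypothesis d_neq_0 : d <> 0%C.
Hypothesis e_neq_0 : e <> 0%C.
Hypothesis tau_neq_0 : tau <> 0%C.
Hypothesis a_b_e : a = (b * e ^ 2)%C.
Hypothesis abcd_tau : (a * b * c * d * tau ^ 2 = Q)%C.
Hypothesis ab_lt_1 : Cmod (a * b) < 1.
Hypothesis ac_lt_1 : Cmod (a * c) < 1.
Hypothesis ad_lt_1 : Cmod (a * d) < 1.
Hypothesis bc_lt_1 : Cmod (b * c) < 1.

Let alpha : C := (a * b * c * d / Q)%C.

Let sigma : C := (Q / (b * c * e))%C.

Hypothesis alpha_lt_1 : Cmod alpha < 1.

Let a_neq_0 : a <> 0%C.
Proof. rewrite a_b_e; apply Cmult_neq_0; auto; now apply Cpow_nz. Qed.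

Let Q_no_root_of_unity : no_root_of_unity Q.
Proof. intro j; rewrite Cpow_S; apply one_minus_mult_pow_neq_0; lra. Qed.

(** The coefficient c_p without the factors that do not depend on p. *)
Definition weight (p : nat) : C :=
  ((1 - alpha * (Q ^ p) ^ 2) / (1 - alpha * Q ^ p) * qpoch (alpha * Q) Q p
   * (qpoch_inf (a * c * Q ^ p) Q * qpoch_inf (b * c * Q ^ p) Q)
   / (qpoch Q Q p * qpoch (a * b) Q p) * (a * b * c) ^ p * Q ^ (p * (p - 1)))%C.

(** Both Al-Salam and Chihara polynomials and all members of [lam_basis] are polynomials in
    this quantity. *)
Definition lam (p : nat) : C := (/ Q ^ p + alpha * Q ^ p)%C.

Definition lam_basis (p k : nat) : C := (qpoch (/ Q ^ p) Q k * qpoch (alpha * Q ^ p) Q k)%C.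

(** The factors (ab, ac, ad;Q)_p / a^p are those of the Askey-Wilson polynomial of degree p;
    together with [weight] they form a very-well-poised summand. *)
Definition moment_term (p k : nat) : C :=
  (weight p * (/ a ^ p * (qpoch (a * b) Q p * qpoch (a * c) Q p * qpoch (a * d) Q p))
   * lam_basis p k)%C.

(** The value of the series of [moment_term] times the polynomial of degree N.  It is found
    by solving the recurrence [moment_rec] from N = 0. *)
Definition moment (k N : nat) : C :=
  (qpoch_inf (alpha * Q) Q * (qpoch (a * c) Q k * qpoch (a * d) Q k)
   * (- (b * c)) ^ k * Q ^ (k * (k - 1) / 2) / Q ^ k
   * ((- sigma) ^ N * Q ^ (N * (N - 1) / 2) / (Q ^ N) ^ k)
   * qpoch_inf (a * c * Q ^ k / Q ^ N) Q)%C.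

Lemma alpha_pow_neq_0 (k : nat) : (1 - alpha * Q ^ k)%C <> 0%C.
Proof. apply one_minus_mult_pow_neq_0; lra. Qed.

(** The terms with p < k vanish, and the others form again a very-well-poised series, with
    alpha Q^(2k) for alpha. *)
Lemma moment_term_shift (k r : nat) :
  moment_term (k + r) k =
  (qpoch_inf (a * c) Q * qpoch_inf (b * c) Q * (- (b * c)) ^ k * Q ^ (k * (k - 1) / 2) / Q ^ k
   * qpoch (a * d) Q k / qpoch (b * c) Q k * qpoch (alpha * Q) Q (2 * k)
   * vwp (alpha * Q ^ (2 * k)) (a * d * Q ^ k) (b * c * Q ^ k) Q r)%C.
Proof.
unfold moment_term, weight, lam_basis, vwp.
assert (Nab : forall p, qpoch (a * b) Q p <> 0%C) by (intro; apply qpoch_neq_0_lt1; lra).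
assert (Nac : forall p, qpoch (a * c) Q p <> 0%C) by (intro; apply qpoch_neq_0_lt1; lra).
assert (Nbc : forall p, qpoch (b * c) Q p <> 0%C) by (intro; apply qpoch_neq_0_lt1; lra).
assert (NQ : forall p, qpoch Q Q p <> 0%C) by (intro; apply qpoch_neq_0_lt1; lra).
assert (NP : forall p, (Q ^ p)%C <> 0%C) by (intro; now apply Cpow_nz).
assert (Nbk : qpoch (b * c * Q ^ k) Q r <> 0%C).
{ apply qpoch_neq_0_lt1; [lra|]. eapply Rle_lt_trans; [apply Cmod_mult_pow_le; lra | lra]. }
rewrite (qpoch_inf_split (a * c) Q (k + r)), (qpoch_inf_split (b * c) Q (k + r)) by auto.
set (A := qpoch_inf (a * c * Q ^ (k + r)) Q). set (B := qpoch_inf (b * c * Q ^ (k + r)) Q).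
assert (R := qpoch_inv_pow_reverse Q k r Q_neq_0).
assert (R' : qpoch (/ Q ^ (k + r)) Q k =
  ((- (1)) ^ k * Q ^ (k * (k - 1) / 2) / (Q ^ (k + r)) ^ k * qpoch Q Q (k + r) / qpoch Q Q r)%C).
{ rewrite <- R; field; auto. }
rewrite R'; clear R R'.
(* Both sides equal (alpha Q;Q)_(2k+r) / (1 - alpha Q^(2k+r)). *)
assert (Al : (qpoch (alpha * Q) Q (k + r) * qpoch (alpha * Q ^ (k + r)) Q k / (1 - alpha * Q ^ (k + r))
  = qpoch (alpha * Q) Q (2 * k) * qpoch (alpha * Q ^ (2 * k) * Q) Q r / (1 - alpha * Q ^ (2 * k) * Q ^ r))%C).
{ assert (N1 := alpha_pow_neq_0 (k + r)). assert (N2 := alpha_pow_neq_0 (2 * k + r)).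
  assert (E1 : (qpoch (alpha * Q ^ (k + r)) Q k * (1 - alpha * Q ^ (k + r) * Q ^ k) =
     (1 - alpha * Q ^ (k + r)) * qpoch (alpha * Q ^ (k + r) * Q) Q k)%C) by apply qpoch_shift.
  assert (E2 : (qpoch (alpha * Q) Q (k + r) * qpoch (alpha * Q ^ (k + r) * Q) Q k
     = qpoch (alpha * Q) Q (2 * k) * qpoch (alpha * Q ^ (2 * k) * Q) Q r)%C).
  { replace (alpha * Q ^ (k + r) * Q)%C with (alpha * Q * Q ^ (k + r))%C by ring.
    replace (alpha * Q ^ (2 * k) * Q)%C with (alpha * Q * Q ^ (2 * k))%C by ring.
    rewrite <- !qpoch_add; f_equal; lia. }
  replace (alpha * Q ^ (2 * k) * Q ^ r)%C with (alpha * Q ^ (2 * k + r))%C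
    by (rewrite Cpow_add_r; ring).
  replace (alpha * Q ^ (k + r) * Q ^ k)%C with (alpha * Q ^ (2 * k + r))%C in E1
    by (replace (2 * k + r)%nat with (k + r + k)%nat by lia; rewrite (Cpow_add_r Q (k + r) k); ring).
  rewrite <- E2.
  transitivity (qpoch (alpha * Q) Q (k + r)
     * (qpoch (alpha * Q ^ (k + r)) Q k * (1 - alpha * Q ^ (2 * k + r)))
     / (1 - alpha * Q ^ (k + r)) / (1 - alpha * Q ^ (2 * k + r)))%C; [field; auto|].
  rewrite E1; field; auto. }
assert (Pw : ((Q ^ (k + r)) ^ 2 = Q ^ (2 * k) * (Q ^ r) ^ 2)%C).
{ rewrite Cpow_add_r, Cpow_mult_l, <- !Cpow_mult_r. do 2 f_equal. lia. }
rewrite Pw.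
transitivity (
  (qpoch (alpha * Q) Q (k + r) * qpoch (alpha * Q ^ (k + r)) Q k / (1 - alpha * Q ^ (k + r)))
  * (1 - alpha * Q ^ (2 * k) * (Q ^ r) ^ 2) * (A * B) * qpoch (a * c) Q (k + r) * qpoch (a * d) Q (k + r)
  / qpoch Q Q r * ((a * b * c) ^ (k + r) / a ^ (k + r)) * (- (1)) ^ k * Q ^ (k * (k - 1) / 2)
  * (Q ^ ((k + r) * (k + r - 1)) / (Q ^ (k + r)) ^ k))%C.
{ assert (N1 := alpha_pow_neq_0 (k + r)). assert (N2 := Cpow_nz a (k + r) a_neq_0).
  assert (N3 := Cpow_nz _ k (NP (k + r)%nat)).
  field; repeat split; auto. }
rewrite Al.
assert (Pa : ((a * b * c) ^ (k + r) / a ^ (k + r) = (b * c) ^ k * (b * c) ^ r)%C).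
{ rewrite <- Cpow_add_r, <- Cmult_assoc, Cpow_mult_l; field. now apply Cpow_nz. }
assert (PQ : (Q ^ ((k + r) * (k + r - 1)) / (Q ^ (k + r)) ^ k
   = / Q ^ k * (Q ^ k) ^ r * Q ^ (r * (r - 1)))%C).
{ assert (Z : (Q ^ ((k + r) * (k + r - 1)) * Q ^ k = (Q ^ (k + r)) ^ k * (Q ^ k) ^ r * Q ^ (r * (r - 1)))%C).
  { rewrite <- !Cpow_mult_r, <- !Cpow_add_r; f_equal. destruct r, k; simpl; nia. }
  assert (N3 := Cpow_nz _ k (NP (k + r)%nat)).
  transitivity ((Q ^ ((k + r) * (k + r - 1)) * Q ^ k) / Q ^ k / (Q ^ (k + r)) ^ k)%C.
  { field; auto. }
  rewrite Z; field; auto. }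
rewrite Pa, PQ, (qpoch_add (b * c)), (qpoch_add (a * d)).
replace (- (b * c))%C with ((- (1)) * (b * c))%C by ring.
rewrite !(Cpow_mult_l _ _ k), !(Cpow_mult_l _ _ r).
assert (N2 : (1 - alpha * Q ^ (2 * k) * Q ^ r)%C <> 0%C).
{ assert (N2 := alpha_pow_neq_0 (2 * k + r)). rewrite Cpow_add_r, Cmult_assoc in N2; exact N2. }
field; repeat split; auto.
Qed.

Lemma moment_0_correct (k : nat) : is_series (fun p => moment_term p k) (moment k 0).
Proof.
assert (Hm : forall z (M : nat), Cmod z < 1 -> Cmod (z * Q ^ M)%C < 1).
{ intros z M Hz; eapply Rle_lt_trans; [apply Cmod_mult_pow_le; lra | auto]. }
apply (is_series_zero_prefix _ _ k).
{ intros p Hp; unfold moment_term, lam_basis; rewrite qpoch_inv_pow_zero by auto; ring. }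
eapply is_series_Cext; [intro r; symmetry; apply moment_term_shift| |].
2: { apply is_series_Cscal, vwp_sum; auto.
     unfold alpha.
     replace (Q ^ (2 * k))%C with (Q ^ k * Q ^ k)%C
       by (rewrite <- Cpow_add_r; f_equal; lia).
     field; auto. }
unfold moment.
replace (alpha * Q ^ (2 * k) * Q)%C with (alpha * Q * Q ^ (2 * k))%C by ring.
rewrite (qpoch_inf_split (alpha * Q) Q (2 * k)) by auto.
rewrite (qpoch_inf_split (b * c) Q k), (qpoch_inf_split (a * c) Q k) by auto.
replace (a * c * Q ^ k / Q ^ 0)%C with (a * c * Q ^ k)%C by (simpl; field).
simpl (0 * (0 - 1) / 2)%nat.
assert (N1 : qpoch (b * c) Q k <> 0%C) by (apply qpoch_neq_0_lt1; lra).
assert (N2 : qpoch_inf (b * c * Q ^ k) Q <> 0%C).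
{ apply qpoch_inf_neq_0; auto; intro j; apply one_minus_mult_pow_neq_0; [lra|]; auto. }
assert (N3 := Cpow_nz Q k Q_neq_0).
replace ((Q ^ 0) ^ k)%C with (RtoC 1) by (simpl; now rewrite Cpow_1_l).
field; auto 10.
Qed.

Lemma sigma_neq_0 : sigma <> 0%C.
Proof. unfold sigma; unfold Cdiv. apply Cmult_neq_0; auto. apply Cinv_neq_0; auto using Cmult_neq_0. Qed.

Lemma moment_rec_0 (k : nat) :
  moment k 1 = ((e + / e) * moment k 0
    - sigma / Q ^ k * ((1 + alpha * (Q ^ k) ^ 2) * moment k 0 - moment (S k) 0))%C.
Proof.
unfold moment.
set (V := qpoch_inf (a * c * Q ^ k * Q) Q).
replace (a * c * Q ^ S k / Q ^ 0)%C with (a * c * Q ^ k * Q)%C by (rewrite Cpow_S; simpl; field).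
replace (a * c * Q ^ k / Q ^ 0)%C with (a * c * Q ^ k)%C by (simpl; field).
replace (a * c * Q ^ k / Q ^ 1)%C with (a * c * Q ^ k / Q)%C by (rewrite Cpow_1_r; reflexivity).
fold V.
replace (qpoch_inf (a * c * Q ^ k) Q) with ((1 - a * c * Q ^ k) * V)%C
  by (unfold V; now rewrite <- qpoch_inf_S).
replace (qpoch_inf (a * c * Q ^ k / Q) Q) with
  ((1 - a * c * Q ^ k / Q) * ((1 - a * c * Q ^ k) * V))%C.
2: { rewrite (qpoch_inf_S (a * c * Q ^ k / Q)) by auto. f_equal.
     unfold V; rewrite <- qpoch_inf_S by auto; f_equal; field; auto. }
assert (N := Cpow_nz Q k Q_neq_0).
simpl (1 * (1 - 1) / 2)%nat; simpl (0 * (0 - 1) / 2)%nat.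
rewrite tri_S, !qpoch_S, (Cpow_add_r Q (k * (k - 1) / 2) k), !Cpow_S.
change (Q ^ 0)%C with (RtoC 1). rewrite !Cmult_1_r, !Cpow_1_l.
change ((- sigma) ^ 0)%C with (RtoC 1).
unfold sigma, alpha; rewrite a_b_e; simpl Cpow; field; auto 10.
Qed.

Lemma moment_rec (k N : nat) :
  moment k (S (S N)) = ((e + / e) * moment k (S N)
    - Q ^ S N * sigma / Q ^ k * ((1 + alpha * (Q ^ k) ^ 2) * moment k (S N) - moment (S k) (S N))
    - (1 - Q ^ S N) * (1 - d / c * Q ^ S N) * moment k N)%C.
Proof.
unfold moment.
assert (N1 := Cpow_nz Q k Q_neq_0). assert (N2 := Cpow_nz Q N Q_neq_0).
set (V := qpoch_inf (a * c * Q ^ k / Q ^ N) Q).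
replace (a * c * Q ^ S k / Q ^ S N)%C with (a * c * Q ^ k / Q ^ N)%C
  by (rewrite !Cpow_S; field; auto).
fold V.
replace (qpoch_inf (a * c * Q ^ k / Q ^ S (S N)) Q) with
  ((1 - a * c * Q ^ k / Q ^ N / Q / Q) * ((1 - a * c * Q ^ k / Q ^ N / Q) * V))%C.
2: { rewrite (qpoch_inf_S (a * c * Q ^ k / Q ^ S (S N))) by auto. f_equal.
     - f_equal; rewrite !Cpow_S; field; auto 10.
     - rewrite (qpoch_inf_S (_ * Q)) by auto. unfold V; f_equal.
       + f_equal; rewrite !Cpow_S; field; auto 10.
       + f_equal; rewrite !Cpow_S; field; auto. }
replace (qpoch_inf (a * c * Q ^ k / Q ^ S N) Q) with ((1 - a * c * Q ^ k / Q ^ N / Q) * V)%C.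
2: { rewrite (qpoch_inf_S (a * c * Q ^ k / Q ^ S N)) by auto. unfold V; f_equal.
     - f_equal; rewrite !Cpow_S; field; auto 10.
     - f_equal; rewrite !Cpow_S; field; auto. }
rewrite !tri_S, !qpoch_S, !(Cpow_add_r Q), !Cpow_S, !Cpow_mult_l.
assert (N3 := Cpow_nz _ k N2).
generalize dependent (Q ^ N)%C; intros M; intros.
generalize dependent (M ^ k)%C; intros Mk; intros.
unfold sigma, alpha; rewrite a_b_e; simpl Cpow; field; auto 10.
Qed.

(** The polynomial s_N(cos theta) of the sum, with e = e^(i theta); its parameters have sum
    sigma lambda_p and product d Q / c. *)
Definition asc (N p : nat) : C :=
  cont_dual_q_hahn N (mu e) (sigma / Q ^ p) (sigma * alpha * Q ^ p) 0 Q.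

Lemma asc_0 (p : nat) : asc 0 p = 1%C.
Proof. apply cdqh_0. Qed.

Lemma sigma_div_pow_neq_0 (p : nat) : (sigma / Q ^ p)%C <> 0%C.
Proof. apply Cmult_neq_0; [apply sigma_neq_0 | apply Cinv_neq_0; now apply Cpow_nz]. Qed.

Lemma asc_1 (p : nat) : asc 1 p = (e + / e - sigma * lam p)%C.
Proof.
unfold asc; rewrite al_salam_rec_0 by (auto; apply sigma_div_pow_neq_0).
rewrite two_mu by auto. unfold lam; field; auto. split; auto; now apply Cpow_nz.
Qed.

Lemma asc_rec (N p : nat) :
  asc (S (S N)) p = ((e + / e) * asc (S N) p - Q ^ S N * sigma * lam p * asc (S N) p
     - (1 - Q ^ S N) * (1 - d / c * Q ^ S N) * asc N p)%C.
Proof.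
unfold asc; rewrite al_salam_rec by (auto; apply sigma_div_pow_neq_0).
rewrite two_mu by auto. assert (Np := Cpow_nz Q p Q_neq_0).
replace (1 - sigma / Q ^ p * (sigma * alpha * Q ^ p) * Q ^ N)%C
  with (1 - d / c * Q ^ S N)%C.
- unfold lam; field; auto 10.
- unfold sigma, alpha; rewrite a_b_e, Cpow_S; simpl Cpow; field; auto 10.
Qed.

(** Multiplication by lambda_p acts on the index k as a two-term operator. *)
Lemma moment_term_S (p k : nat) :
  moment_term p (S k) = ((1 + alpha * (Q ^ k) ^ 2 - Q ^ k * lam p) * moment_term p k)%C.
Proof.
unfold moment_term, lam_basis, lam; rewrite !qpoch_S. assert (Np := Cpow_nz Q p Q_neq_0).
unfold Cdiv; simpl (_ ^ 2)%C.
generalize (/ a ^ p)%C; intro i. field; auto 10.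
Qed.

(** Induction on N.  The recurrence of [asc] multiplies by lambda_p, which raises k, so all
    k have to be treated at once. *)
Lemma moment_correct (N k : nat) : is_series (fun p => moment_term p k * asc N p)%C (moment k N).
Proof.
cut ((forall k, is_series (fun p => moment_term p k * asc N p)%C (moment k N)) /\
     (forall k, is_series (fun p => moment_term p k * asc (S N) p)%C (moment k (S N)))).
{ intros [H _]; apply H. }
clear k; induction N as [|N [IH0 IH1]].
- assert (H0 : forall k, is_series (fun p => moment_term p k * asc 0 p)%C (moment k 0)).
  { intro k; eapply is_series_Cext; [|reflexivity|apply moment_0_correct].
    intro p; rewrite asc_0; ring. }
  split; auto; intro k; rewrite moment_rec_0.
  assert (Nk := Cpow_nz Q k Q_neq_0).
  eapply is_series_Cext; [| |
    exact (is_series_Cplus _ _ _ _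
      (is_series_Cscal ((e + / e) - sigma / Q ^ k * (1 + alpha * (Q ^ k) ^ 2))%C _ _ (H0 k))
      (is_series_Cscal (sigma / Q ^ k)%C _ _ (H0 (S k))))].
  2: ring.
  intro p; cbv beta; rewrite moment_term_S, asc_1, asc_0; simpl (_ ^ 2)%C; field; auto 10.
- split; auto; intro k; rewrite moment_rec.
  assert (Nk := Cpow_nz Q k Q_neq_0).
  eapply is_series_Cext; [| |
    exact (is_series_Cplus _ _ _ _ (is_series_Cplus _ _ _ _
      (is_series_Cscal ((e + / e) - Q ^ S N * sigma / Q ^ k * (1 + alpha * (Q ^ k) ^ 2))%C _ _ (IH1 k))
      (is_series_Cscal (Q ^ S N * sigma / Q ^ k)%C _ _ (IH1 (S k))))
      (is_series_Cscal (- ((1 - Q ^ S N) * (1 - d / c * Q ^ S N)))%C _ _ (IH0 k)))].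
  2: ring.
  intro p; cbv beta; rewrite moment_term_S, asc_rec; simpl (_ ^ 2)%C; field; auto 10.
Qed.

Lemma geo_bounded_lam : geo_bounded lam.
Proof.
apply geo_bounded_plus; [now apply geo_bounded_inv_pow|].
apply (geo_bounded_mult (fun _ => alpha)); [apply geo_bounded_const | apply geo_bounded_pow].
Qed.

Lemma geo_bounded_asc (N : nat) : geo_bounded (asc N).
Proof.
assert (Hc : forall (z : C) u, geo_bounded u -> geo_bounded (fun p => z * u p)%C).
{ intros z u Hu; apply (geo_bounded_mult (fun _ => z)); auto using geo_bounded_const. }
cut (geo_bounded (asc N) /\ geo_bounded (asc (S N))); [tauto|].
induction N as [|N [IH0 IH1]]; split; auto.
- apply geo_bounded_ext with (fun _ => RtoC 1); [intro; now rewrite asc_0 | apply geo_bounded_const].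
- apply geo_bounded_ext with (fun p => (e + / e) + (- sigma) * lam p)%C.
  { intro p; rewrite asc_1; ring. }
  apply geo_bounded_plus; [apply geo_bounded_const | apply Hc, geo_bounded_lam].
- apply geo_bounded_ext with (fun p => (e + / e) * asc (S N) p
    + ((- (Q ^ S N * sigma)) * (lam p * asc (S N) p)
       + (- ((1 - Q ^ S N) * (1 - d / c * Q ^ S N))) * asc N p))%C.
  { intro p; rewrite asc_rec; ring. }
  apply geo_bounded_plus; [now apply Hc|].
  apply geo_bounded_plus; apply Hc; auto.
  apply geo_bounded_mult; auto using geo_bounded_lam.
Qed.

Definition basis_coef (k : nat) : C :=
  (qpoch_pair a x Q k * Q ^ k
   / (qpoch Q Q k * qpoch (a * b) Q k * qpoch (a * c) Q k * qpoch (a * d) Q k))%C.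

Lemma geo_bounded_basis_coef : geo_bounded basis_coef.
Proof.
apply geo_bounded_ext with (fun k => qpoch_pair a x Q k * Q ^ k * / qpoch Q Q k
  * / qpoch (a * b) Q k * / qpoch (a * c) Q k * / qpoch (a * d) Q k)%C.
{ intro k; unfold basis_coef; field; repeat split; apply qpoch_neq_0_lt1; lra. }
repeat (apply geo_bounded_mult); try (apply geo_bounded_qpoch_inv; lra).
- apply (geo_bounded_le _ (1 + 2 * Cmod a * Cmod x + Cmod a ^ 2)); intro; apply qpoch_pair_le; lra.
- apply geo_bounded_pow.
Qed.

(** The summand of the case n = 0 without Q^(p(p-1)) and the factors that depend on k. *)
Definition weight_geo (N p : nat) : C :=
  ((1 - alpha * (Q ^ p) ^ 2) * / (1 - alpha * Q ^ p) * qpoch (alpha * Q) Q p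
   * (qpoch_inf (a * c * Q ^ p) Q * qpoch_inf (b * c * Q ^ p) Q)
   * (/ qpoch Q Q p * / qpoch (a * b) Q p) * (a * b * c) ^ p
   * (/ a ^ p * (qpoch (a * b) Q p * qpoch (a * c) Q p * qpoch (a * d) Q p)) * asc N p)%C.

Lemma geo_bounded_weight_geo (N : nat) : geo_bounded (weight_geo N).
Proof.
assert (Hinf : forall z, geo_bounded (fun p => qpoch_inf (z * Q ^ p) Q)).
{ intro z; apply geo_bounded_bounded with (exp (Cmod z / (1 - Cmod Q))); intro p.
  eapply Rle_trans; [now apply qpoch_inf_bounded|].
  apply exp_le_exp, Rmult_le_compat_r; [left; apply Rinv_0_lt_compat; lra|].
  apply Cmod_mult_pow_le; lra. }
apply geo_bounded_mult; [|apply geo_bounded_asc].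
repeat (apply geo_bounded_mult); auto;
  try (apply geo_bounded_qpoch_inv; lra); try (apply geo_bounded_qpoch; lra).
- apply geo_bounded_bounded with 2; intro p.
  eapply Rle_trans; [apply Cmod_one_minus_le|].
  assert (T : Cmod (alpha * (Q ^ p) ^ 2)%C <= Cmod alpha).
  { apply Cmod_mult_pow_le; apply Cmod_pow_le_1; lra. }
  lra.
- apply geo_bounded_bounded with (/ (1 - Cmod alpha)); intro p.
  apply Cmod_one_minus_inv_le; [|lra]. apply Cmod_mult_pow_le; lra.
- apply geo_bounded_pow.
- now apply geo_bounded_inv_pow.
Qed.

Lemma moment_term_geo (N p k : nat) :
  (moment_term p k * asc N p = weight_geo N p * (Q ^ (p * (p - 1)) * lam_basis p k))%C.
Proof.
unfold moment_term, weight, weight_geo.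
assert (N1 := alpha_pow_neq_0 p).
field; repeat split; auto; try (apply qpoch_neq_0_lt1; lra). now apply Cpow_nz.
Qed.

(** For k <= p, half of the factor Q^(p(p-1)) compensates the growth of (Q^(-p);Q)_k and the
    other half beats every geometric factor.  A bound by (1/4)^p then splits evenly between
    p and k because k <= p; for k > p the term is zero. *)
Lemma double_term_le (N : nat) : exists M, 0 <= M /\ forall p k,
  Cmod (moment_term p k * asc N p * basis_coef k)%C <= M * (1 / 2) ^ p * (1 / 2) ^ k.
Proof.
destruct (geo_bounded_weight_geo N) as (K & R0 & HK & HR & H).
destruct geo_bounded_basis_coef as (K' & R1 & HK' & HR1 & H').
assert (HQ0 : 0 < Cmod Q) by (now apply Cmod_gt_0).
assert (I : 0 < / Cmod Q) by (now apply Rinv_0_lt_compat).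
destruct (superexp_bound (R0 * (2 * / Cmod Q) * 2 * R1) (Cmod Q) (1 / 4)) as [M [HM HS]];
  [repeat apply Rmult_le_pos; lra | lra | lra |].
exists (K * K' * M); split; [repeat apply Rmult_le_pos; lra|].
intros p k; rewrite moment_term_geo.
destruct (Nat.lt_ge_cases p k) as [Hk|Hk].
{ unfold lam_basis; rewrite qpoch_inv_pow_zero by auto.
  match goal with |- Cmod ?z <= _ => replace z with (RtoC 0) by ring end.
  rewrite Cmod_0; repeat apply Rmult_le_pos; auto; apply pow_le; lra. }
set (t := Cmod Q ^ (p * (p - 1) / 2)).
assert (Ht : 0 <= t) by (apply pow_le; lra).
assert (B1 : Cmod (qpoch (/ Q ^ p) Q k) * t <= (2 * / Cmod Q) ^ p).
{ assert (L := qpoch_inv_pow_le Q k (p - k) Q_neq_0 Q_lt_1).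
  replace (k + (p - k))%nat with p in L by lia.
  rewrite tri_S, pow_add in L; fold t in L.
  assert (P : 0 < Cmod Q ^ p) by (now apply pow_lt).
  apply Rmult_le_reg_r with (Cmod Q ^ p); auto.
  rewrite Rmult_assoc; eapply Rle_trans; [exact L|].
  rewrite Rpow_mult_distr, Rmult_assoc, <- Rpow_mult_distr, Rinv_l, pow1 by lra.
  apply Rmult_le_compat; try (apply pow_le; lra).
  - apply Rle_pow; [lra | auto].
  - apply pow_le_1; lra. }
assert (B2 : Cmod (qpoch (alpha * Q ^ p) Q k) <= 2 ^ p).
{ apply Rle_trans with (2 ^ k); [|apply Rle_pow; [lra | auto]].
  replace 2 with (1 + 1) by ring; apply qpoch_le; [lra|].
  eapply Rle_trans; [apply Cmod_mult_pow_le; lra | lra]. }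
assert (B3 : Cmod (basis_coef k) <= K' * R1 ^ p).
{ eapply Rle_trans; [apply H'|]. apply Rmult_le_compat_l; auto. now apply Rle_pow. }
apply Rle_trans with (K * R0 ^ p * ((2 * / Cmod Q) ^ p * t * 2 ^ p) * (K' * R1 ^ p)).
- rewrite !Cmod_mult. unfold lam_basis; rewrite Cmod_mult.
  apply Rmult_le_compat; auto; try (repeat apply Rmult_le_pos; apply Cmod_ge_0).
  apply Rmult_le_compat; auto; try (repeat apply Rmult_le_pos; apply Cmod_ge_0).
  rewrite Cmod_pow, tri_double, pow_add. fold t.
  replace (t * t * (Cmod (qpoch (/ Q ^ p) Q k) * Cmod (qpoch (alpha * Q ^ p) Q k)))
    with ((Cmod (qpoch (/ Q ^ p) Q k) * t) * t * Cmod (qpoch (alpha * Q ^ p) Q k)) by ring.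
  apply Rmult_le_compat; auto; try apply Cmod_ge_0.
  + repeat apply Rmult_le_pos; auto; apply Cmod_ge_0.
  + now apply Rmult_le_compat_r.
- replace (K * R0 ^ p * ((2 * / Cmod Q) ^ p * t * 2 ^ p) * (K' * R1 ^ p))
    with (K * K' * ((R0 * (2 * / Cmod Q) * 2 * R1) ^ p * t))
    by (rewrite !Rpow_mult_distr; ring).
  replace (K * K' * M * (1 / 2) ^ p * (1 / 2) ^ k)
    with (K * K' * (M * ((1 / 2) ^ p * (1 / 2) ^ k))) by ring.
  apply Rmult_le_compat_l; [now apply Rmult_le_pos|].
  eapply Rle_trans; [apply HS|].
  apply Rmult_le_compat_l; auto.
  replace (1 / 4) with (1 / 2 * (1 / 2)) by field. rewrite Rpow_mult_distr.
  apply Rmult_le_compat_l; [apply pow_le; lra|].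
  replace p with (k + (p - k))%nat by lia. rewrite pow_add.
  rewrite <- (Rmult_1_r ((1 / 2) ^ k)) at 2.
  apply Rmult_le_compat_l; [apply pow_le; lra | apply pow_le_1; lra].
Qed.

Lemma moment_phi_term (N k : nat) :
  (moment k N * basis_coef k =
   qpoch_inf (alpha * Q) Q * ((- sigma) ^ N * Q ^ (N * (N - 1) / 2))
   * phi_term x a b Q (c / Q ^ N) k)%C.
Proof.
unfold moment, basis_coef, phi_term.
assert (N1 := Cpow_nz Q k Q_neq_0). assert (N2 := Cpow_nz Q N Q_neq_0).
assert (N3 := Cpow_nz _ k N2).
replace (a * (c / Q ^ N) * Q ^ k)%C with (a * c * Q ^ k / Q ^ N)%C by (field; auto).
replace (- (b * (c / Q ^ N)))%C with (- (b * c) * / Q ^ N)%C by (field; auto).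
rewrite Cpow_mult_l, Cpow_inv by auto.
field; repeat split; auto; apply qpoch_neq_0_lt1; lra.
Qed.

Lemma askey_wilson_finite (p N : nat) :
  is_series (fun k => moment_term p k * asc N p * basis_coef k)%C
    (weight p * asc N p * askey_wilson p x a b c d Q)%C.
Proof.
replace (weight p * asc N p * askey_wilson p x a b c d Q)%C
  with (sum_n (fun k => moment_term p k * asc N p * basis_coef k)%C p).
- apply is_series_finite; intros k Hk.
  unfold moment_term, lam_basis; rewrite qpoch_inv_pow_zero by auto; ring.
- unfold askey_wilson.
  transitivity (weight p * asc N p * / a ^ p * sum_n (fun k =>
    qpoch (/ Q ^ p) Q k * qpoch (a * b * c * d * Q ^ p / Q) Q k * qpoch_pair a x Q k / qpoch Q Q k *
    qpoch (a * b * Q ^ k) Q (p - k) * qpoch (a * c * Q ^ k) Q (p - k) * qpoch (a * d * Q ^ k) Q (p - k) * Q ^ k)%C p)%C; [|ceq; ring].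
  rewrite sum_n_Cscal; apply sum_n_ext_loc; intros k Hk; ceq.
  assert (E : forall z, qpoch z Q p = (qpoch z Q k * qpoch (z * Q ^ k) Q (p - k))%C).
  { intro z; rewrite <- qpoch_add; f_equal; lia. }
  unfold moment_term, lam_basis, basis_coef.
  rewrite (E (a * b)%C), (E (a * c)%C), (E (a * d)%C).
  replace (a * b * c * d * Q ^ p / Q)%C with (alpha * Q ^ p)%C by (unfold alpha; field; auto).
  field; repeat split; try (apply qpoch_neq_0_lt1; lra). now apply Cpow_nz.
Qed.

(** Summation over k first gives the Askey-Wilson polynomial, summation over p first gives
    the moments, that is the terms of the 2phi2 series. *)
Lemma bilinear_sum_0 (N : nat) :
  is_series (fun p => weight p * asc N p * askey_wilson p x a b c d Q)%C
   (qpoch_inf (alpha * Q) Q * ((- sigma) ^ N * Q ^ (N * (N - 1) / 2))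
    * phi_reg x a b Q (c / Q ^ N))%C.
Proof.
destruct (double_term_le N) as [M [HM H]].
apply (double_series_swap (fun p k => moment_term p k * asc N p * basis_coef k)%C _
  (fun k => moment k N * basis_coef k)%C _ M (1 / 2)); auto; try lra.
- intro p; apply askey_wilson_finite.
- intro k. eapply is_series_Cext; [| |exact (is_series_Cscal (basis_coef k) _ _ (moment_correct N k))].
  + intro p; cbv beta; ring.
  + ring.
- eapply is_series_Cext; [intro k; symmetry; apply moment_phi_term | reflexivity |].
  apply is_series_Cscal, phi_reg_correct; auto.
Qed.

(** The polynomial s_n in base 1/Q, with tau = s / q^(2 k2).  Twice its argument is tau
    lambda_p. *)
Definition asc_dual (n p : nat) : C :=
  cont_dual_q_hahn n (mu (Q ^ p / tau)) tau (tau * a * b / Q) 0 (/ Q).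

Lemma no_root_of_unity_inv : no_root_of_unity (/ Q).
Proof.
intros j E. apply (Q_no_root_of_unity j).
assert (N := Cpow_nz Q (S j) Q_neq_0).
rewrite Cpow_inv in E by auto.
transitivity (- Q ^ S j * (1 - / Q ^ S j))%C; [field; auto | rewrite E; ring].
Qed.

(** The relations between the parameters solved rationally for d, so that [field] can decide
    identities modulo them. *)
Lemma d_eq : d = (Q / (b ^ 2 * e ^ 2 * c * tau ^ 2))%C.
Proof. rewrite <- abcd_tau, a_b_e; simpl Cpow; field; auto 10. Qed.

Lemma asc_dual_0 (p : nat) : asc_dual 0 p = 1%C.
Proof. apply cdqh_0. Qed.

Lemma two_mu_dual (p : nat) : (2 * mu (Q ^ p / tau) = tau * lam p)%C.
Proof.
assert (N := Cpow_nz Q p Q_neq_0).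
assert (Na := a_neq_0).
rewrite two_mu by (apply Cmult_neq_0; auto; now apply Cinv_neq_0).
unfold lam, alpha. rewrite d_eq, a_b_e; simpl Cpow; field; auto 10.
Qed.

Lemma asc_dual_rec (n p : nat) :
  asc_dual (S n) p = ((tau * lam p - tau * (1 + a * b / Q) / Q ^ n) * asc_dual n p
    - (1 - / Q ^ n) * (1 - Q / (c * d * Q ^ n)) * asc_dual (pred n) p)%C.
Proof.
assert (HQi : (/ Q)%C <> 0%C) by now apply Cinv_neq_0.
unfold asc_dual; destruct n as [|n].
- rewrite al_salam_rec_0, cdqh_0, two_mu_dual by (auto; apply no_root_of_unity_inv).
  simpl; field; auto.
- rewrite al_salam_rec, two_mu_dual by (auto; apply no_root_of_unity_inv).
  assert (N := Cpow_nz Q n Q_neq_0).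
  rewrite !Cpow_inv, Cpow_S by auto. simpl pred.
  replace (1 - tau * (tau * a * b / Q) * / Q ^ n)%C with (1 - Q / (c * d * (Q * Q ^ n)))%C.
  + field; auto.
  + rewrite d_eq, a_b_e; simpl Cpow; field; auto 10.
Qed.

Lemma asc_rec_pred (N p : nat) :
  asc (S N) p = ((e + / e) * asc N p - Q ^ N * sigma * lam p * asc N p
     - (1 - Q ^ N) * (1 - d / c * Q ^ N) * asc (pred N) p)%C.
Proof.
destruct N as [|N]; [rewrite asc_1, asc_0; simpl; field; auto | apply asc_rec].
Qed.

Definition closed_form_const (n N : nat) : C :=
  (qpoch_inf (alpha * Q) Q * ((- sigma) ^ N * Q ^ (N * (N - 1) / 2)) / (d * tau * Q ^ N) ^ n)%C.

(** The right-hand side divided by the p-independent factor of c_p.  The infinite product with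
    parameter a gam in the latter turns the 2phi2 series into its regularised form. *)
Definition closed_form (n N : nat) : C :=
  (closed_form_const n N * cont_dual_q_hahn n x (Q * Q ^ N / (Q ^ n * c)) d c Q
   * phi_reg x a b Q (c * Q ^ n / Q ^ N))%C.

Lemma cdqh_uvarov_pred (n : nat) (g : C) : g <> 0%C ->
  (cont_dual_q_hahn n x g d c Q = cont_dual_q_hahn n x (g * Q) d c Q
   - g * (1 - Q ^ n) * (1 - c * d * Q ^ n / Q) * cont_dual_q_hahn (pred n) x (g * Q) d c Q)%C.
Proof.
intro Hg; destruct n as [|n].
- rewrite !cdqh_0; simpl; ring.
- rewrite cdqh_uvarov by auto. simpl pred.
  replace (1 - c * d * Q ^ S n / Q)%C with (1 - d * c * Q ^ n)%C; [reflexivity|].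
  rewrite Cpow_S; field; auto.
Qed.

Lemma closed_form_succ_n (n N : nat) :
  closed_form (S n) N = (closed_form_const n N / (d * tau * Q ^ N)
    * cont_dual_q_hahn (S n) x (Q * Q ^ N / (Q ^ n * c) / Q) d c Q
    * phi_reg x a b Q (c * Q ^ n / Q ^ N * Q))%C.
Proof.
assert (N1 := Cpow_nz Q n Q_neq_0). assert (N2 := Cpow_nz Q N Q_neq_0).
unfold closed_form, closed_form_const; rewrite !Cpow_S.
replace (Q * Q ^ N / (Q * Q ^ n * c))%C with (Q * Q ^ N / (Q ^ n * c) / Q)%C by (field; auto).
replace (c * (Q * Q ^ n) / Q ^ N)%C with (c * Q ^ n / Q ^ N * Q)%C by (field; auto).
assert (Nd : (d * tau * Q ^ N)%C <> 0%C) by auto using Cmult_neq_0.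
assert (Ndn := Cpow_nz _ n Nd).
field; auto.
Qed.

Lemma closed_form_succ_N (n N : nat) :
  closed_form n (S N) = (closed_form_const n N * (- sigma) * Q ^ N / Q ^ n
    * cont_dual_q_hahn n x (Q * Q ^ N / (Q ^ n * c) * Q) d c Q
    * phi_reg x a b Q (c * Q ^ n / Q ^ N / Q))%C.
Proof.
assert (N1 := Cpow_nz Q n Q_neq_0). assert (N2 := Cpow_nz Q N Q_neq_0).
unfold closed_form, closed_form_const; rewrite tri_S, !Cpow_S, Cpow_add_r.
replace (Q * (Q * Q ^ N) / (Q ^ n * c))%C with (Q * Q ^ N / (Q ^ n * c) * Q)%C by (field; auto).
replace (c * Q ^ n / (Q * Q ^ N))%C with (c * Q ^ n / Q ^ N / Q)%C by (field; auto).
assert (Nd : (d * tau * Q ^ N)%C <> 0%C) by auto using Cmult_neq_0.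
assert (Ndn := Cpow_nz _ n Nd).
replace (d * tau * (Q * Q ^ N))%C with (d * tau * Q ^ N * Q)%C by ring.
rewrite (Cpow_mult_l _ Q n); field; auto.
Qed.

(** The factor 1 - Q^N makes the formula true for N = 0, where pred N is not N - 1. *)
Lemma closed_form_pred_N (n N : nat) :
  ((1 - Q ^ N) * closed_form n (pred N) = (1 - Q ^ N) * (closed_form_const n N / (- sigma) * Q / Q ^ N * Q ^ n
    * cont_dual_q_hahn n x (Q * Q ^ N / (Q ^ n * c) / Q) d c Q
    * phi_reg x a b Q (c * Q ^ n / Q ^ N * Q)))%C.
Proof.
destruct N as [|N]; [simpl; ring|]. simpl pred; f_equal.
assert (N1 := Cpow_nz Q n Q_neq_0). assert (N2 := Cpow_nz Q N Q_neq_0).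
assert (N3 := sigma_neq_0).
unfold closed_form, closed_form_const; rewrite tri_S, !Cpow_S, Cpow_add_r.
replace (Q * (Q * Q ^ N) / (Q ^ n * c) / Q)%C with (Q * Q ^ N / (Q ^ n * c))%C by (field; auto).
replace (c * Q ^ n / (Q * Q ^ N) * Q)%C with (c * Q ^ n / Q ^ N)%C by (field; auto).
assert (Nd : (d * tau * Q ^ N)%C <> 0%C) by auto using Cmult_neq_0.
assert (Ndn := Cpow_nz _ n Nd).
replace (d * tau * (Q * Q ^ N))%C with (d * tau * Q ^ N * Q)%C by ring.
rewrite (Cpow_mult_l _ Q n); field; auto.
Qed.

Lemma closed_form_pred_n (n N : nat) :
  ((1 - / Q ^ n) * closed_form (pred n) N = (1 - / Q ^ n) * (closed_form_const n N * (d * tau * Q ^ N)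
    * cont_dual_q_hahn (pred n) x (Q * Q ^ N / (Q ^ n * c) * Q) d c Q
    * phi_reg x a b Q (c * Q ^ n / Q ^ N / Q)))%C.
Proof.
destruct n as [|n]; [simpl; field; auto|]. simpl pred; f_equal.
assert (N1 := Cpow_nz Q n Q_neq_0). assert (N2 := Cpow_nz Q N Q_neq_0).
unfold closed_form, closed_form_const; rewrite !(Cpow_S Q).
replace (Q * Q ^ N / (Q * Q ^ n * c) * Q)%C with (Q * Q ^ N / (Q ^ n * c))%C by (field; auto).
replace (c * (Q * Q ^ n) / Q ^ N / Q)%C with (c * Q ^ n / Q ^ N)%C by (field; auto).
assert (Nd : (d * tau * Q ^ N)%C <> 0%C) by auto using Cmult_neq_0.
assert (Ndn := Cpow_nz _ n Nd).
rewrite Cpow_S; field; auto.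
Qed.

(** With gam = c Q^n / Q^N and g = Q / gam, the contiguous relation eliminates the series
    with gam / Q, the Uvarov formula eliminates P_n with parameter g Q, and the Christoffel
    formula eliminates P_(n+1) with parameter g / Q.  What remains is a rational identity. *)
Lemma closed_form_rec (n N : nat) :
  closed_form (S n) N = (tau / (sigma * Q ^ N) * ((e + / e) * closed_form n N - closed_form n (S N)
      - (1 - d / c * Q ^ N) * ((1 - Q ^ N) * closed_form n (pred N)))
    - tau * (1 + a * b / Q) / Q ^ n * closed_form n N
    - (1 - Q / (c * d * Q ^ n)) * ((1 - / Q ^ n) * closed_form (pred n) N))%C.
Proof.
rewrite closed_form_succ_n, closed_form_succ_N, closed_form_pred_N, closed_form_pred_n.
unfold closed_form.
assert (N1 := Cpow_nz Q n Q_neq_0). assert (N2 := Cpow_nz Q N Q_neq_0).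
assert (Na := a_neq_0).
set (g := (Q * Q ^ N / (Q ^ n * c))%C).
set (gam := (c * Q ^ n / Q ^ N)%C).
assert (Ng : g <> 0%C) by (apply Cmult_neq_0; auto using Cmult_neq_0, Cinv_neq_0).
assert (NgQ : (g / Q)%C <> 0%C) by (apply Cmult_neq_0; auto using Cinv_neq_0).
assert (C1 := cdqh_uvarov_pred n g Ng).
assert (C2 := cdqh_christoffel n x (g / Q) d c Q Q_neq_0 Q_no_root_of_unity NgQ).
assert (C3 := phi_reg_rec x a b Q (gam / Q) Q_neq_0 Q_lt_1 ab_lt_1).
replace (g / Q * Q)%C with g in C2 by (field; auto).
replace (Q * (gam / Q))%C with gam in C3 by (field; auto).
replace (Q * gam)%C with (gam * Q)%C in C3 by ring.
generalize dependent (phi_reg x a b Q (gam / Q)); intros E1 C3.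
generalize dependent (phi_reg x a b Q (gam * Q)); intros E3 C3.
generalize dependent (phi_reg x a b Q gam); intros E2 C3.
generalize dependent (cont_dual_q_hahn (pred n) x (g * Q) d c Q); intros Pm C1.
generalize dependent (cont_dual_q_hahn (S n) x (g / Q) d c Q); intros Pp C2.
generalize dependent (cont_dual_q_hahn n x (g / Q) d c Q); intros P1 C2.
generalize dependent (cont_dual_q_hahn n x (g * Q) d c Q); intros P3 C1.
generalize dependent (cont_dual_q_hahn n x g d c Q); intros P2 C2 C1.
generalize (closed_form_const n N); intro K.
assert (C1' : P3 = (P2 + g * (1 - Q ^ n) * (1 - c * d * Q ^ n / Q) * Pm)%C).
{ rewrite C1; ring. }
assert (C2' : Pp = (((1 - g / Q * d * Q ^ n) * (1 - g / Q * c * Q ^ n) * P1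
   - (1 - 2 * (g / Q) * x + (g / Q) ^ 2) * P2) / (g / Q))%C).
{ rewrite C2; field; auto. }
assert (C3' : E1 = ((1 + a * b / Q - gam / Q * (a + b)) * E2
   - a * b / Q * (1 - 2 * gam * x + gam ^ 2) * E3)%C).
{ match type of C3 with ?l = _ => transitivity (l + ((1 + a * b / Q - gam / Q * (a + b)) * E2
   - a * b / Q * (1 - 2 * gam * x + gam ^ 2) * E3))%C; [ring | rewrite C3; ring] end. }
clear C1 C2 C3. subst P3 Pp E1. unfold g, gam, sigma.
clear g gam Ng NgQ.
rewrite d_eq, a_b_e.
generalize dependent (Q ^ n)%C; intros u N1.
generalize dependent (Q ^ N)%C; intros M N2.
simpl Cpow; field; auto 20.
Qed.

(** The recurrences of [asc] and [asc_dual] both multiply by lambda_p; eliminating it shows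
    that the sums satisfy [closed_form_rec]. *)
Theorem bilinear_sum (n N : nat) :
  is_series (fun p => weight p * asc N p * asc_dual n p * askey_wilson p x a b c d Q)%C (closed_form n N).
Proof.
revert N.
cut ((forall N, is_series (fun p => weight p * asc N p * asc_dual n p
       * askey_wilson p x a b c d Q)%C (closed_form n N)) /\
     (forall N, is_series (fun p => weight p * asc N p * asc_dual (pred n) p
       * askey_wilson p x a b c d Q)%C (closed_form (pred n) N))); [tauto|].
induction n as [|n [IH IHp]].
- simpl pred. cut (forall N, is_series (fun p => weight p * asc N p * asc_dual 0 p
       * askey_wilson p x a b c d Q)%C (closed_form 0 N)); [tauto|].
  intro N; eapply is_series_Cext; [| |exact (bilinear_sum_0 N)].
  + intro p; rewrite asc_dual_0; ring.
  + unfold closed_form, closed_form_const; rewrite cdqh_0; simpl (_ ^ 0)%C.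
    replace (c * 1 / Q ^ N)%C with (c / Q ^ N)%C by (unfold Cdiv; ring).
    field. 
- simpl pred; split; auto; intro N.
  assert (N1 := Cpow_nz Q n Q_neq_0). assert (N2 := Cpow_nz Q N Q_neq_0).
  assert (N3 := sigma_neq_0).
  eapply is_series_Cext; [| |
    exact (is_series_Cplus _ _ _ _ (is_series_Cplus _ _ _ _
     (is_series_Cscal (tau / (sigma * Q ^ N) * (e + / e) - tau * (1 + a * b / Q) / Q ^ n)%C _ _ (IH N))
     (is_series_Cscal (- (tau / (sigma * Q ^ N)))%C _ _ (IH (S N))))
     (is_series_Cplus _ _ _ _
     (is_series_Cscal (- (tau / (sigma * Q ^ N)) * (1 - d / c * Q ^ N) * (1 - Q ^ N))%C _ _ (IH (pred N)))
     (is_series_Cscal (- ((1 - Q / (c * d * Q ^ n)) * (1 - / Q ^ n)))%C _ _ (IHp N))))].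
  2: { rewrite closed_form_rec; ring. }
  intro p; cbv beta; rewrite asc_dual_rec, asc_rec_pred; field; auto 10.
Qed.

End BilinearSum.

(** * Specialisation of the parameters *)

Lemma cis_neq_0 (t : R) : cis t <> 0%C.
Proof.
intro E. assert (H := sin2_cos2 t). unfold cis in E.
injection E as E1 E2. rewrite E1, E2 in H. unfold Rsqr in H; lra.
Qed.

Lemma cis_add (t u : R) : cis (t + u) = (cis t * cis u)%C.
Proof. unfold cis, Cmult; simpl; rewrite cos_plus, sin_plus; f_equal; ring. Qed.

Lemma Cmod_cis (t : R) : Cmod (cis t) = 1.
Proof.
unfold Cmod, cis; simpl. rewrite !Rmult_1_r.
assert (H := sin2_cos2 t). unfold Rsqr in H.
replace (cos t * cos t + sin t * sin t) with 1 by lra. apply sqrt_1.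
Qed.

Lemma Cconj_RtoC (r : R) : Cconj r = RtoC r.
Proof. unfold Cconj, RtoC; simpl; now rewrite Ropp_0. Qed.

Lemma Cconj_cis (t : R) : Cconj (cis t) = cis (- t).
Proof. unfold Cconj, cis; simpl; now rewrite cos_neg, sin_neg. Qed.

(** The quotient of factorials in c_p, rewritten in very-well-poised form. *)
Lemma alpha_coef (al Q : C) (p : nat) : (forall j, (1 - al * Q ^ j)%C <> 0%C) ->
  (qpoch (al * Q) Q (2 * p) / qpoch (al * Q ^ p) Q p
   = (1 - al * (Q ^ p) ^ 2) / (1 - al * Q ^ p) * qpoch (al * Q) Q p)%C.
Proof.
intro H.
assert (N1 : qpoch (al * Q ^ p) Q p <> 0%C).
{ apply qpoch_neq_0; intro j; rewrite <- Cmult_assoc, <- Cpow_add_r; apply H. }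
replace (2 * p)%nat with (p + p)%nat by lia.
rewrite qpoch_add.
assert (E := qpoch_shift (al * Q ^ p) Q p).
replace (al * Q ^ p * Q)%C with (al * Q * Q ^ p)%C in E by ring.
replace (al * (Q ^ p) ^ 2)%C with (al * Q ^ p * Q ^ p)%C by (simpl Cpow; ring).
transitivity (qpoch (al * Q) Q p * ((1 - al * Q ^ p) * qpoch (al * Q * Q ^ p) Q p)
   / (1 - al * Q ^ p) / qpoch (al * Q ^ p) Q p)%C; [field; auto|].
rewrite <- E; field; auto.
Qed.

Lemma exp_pow (L : R) (n : nat) : exp L ^ n = exp (INR n * L).
Proof.
induction n as [|n IH]; [simpl; now rewrite Rmult_0_l, exp_0|].
rewrite S_INR; simpl pow; rewrite IH, <- exp_plus; f_equal; ring.
Qed.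

Lemma INR_tri (n : nat) : 2 * INR (n * (n - 1) / 2) = INR n * (INR n - 1).
Proof.
assert (E := f_equal INR (tri_double n)). rewrite plus_INR, mult_INR in E.
destruct n as [|n]; [simpl; ring|].
rewrite (minus_INR (S n) 1) in E by lia. simpl (INR 1) in E. lra.
Qed.

(** Reduces an identity between products of powers of q to the identity of the exponents:
    every factor becomes the exponential of a multiple of ln q. *)
Ltac rpow q :=
  replace q with (exp (ln q)) by (apply exp_ln; assumption);
  unfold Rpower, Rdiv; rewrite ?ln_exp;
  repeat first [rewrite exp_pow | rewrite <- exp_Ropp | rewrite <- exp_plus]; f_equal;
  change (INR 2) with (1 + 1); change (INR 3) with (1 + 1 + 1).

Lemma Rpower_quadratic (q : R) (p : nat) : 0 < q ->
  Rpower q (2 * INR p * (INR p - 1)) = (q ^ 2) ^ (p * (p - 1)).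
Proof.
intro q_pos; rpow q. rewrite tri_double, plus_INR.
assert (E := INR_tri p).
replace (INR (p * (p - 1) / 2)) with (INR p * (INR p - 1) / 2) by lra. field.
Qed.

Lemma Rpower_quadratic_diff (q : R) (n N : nat) : 0 < q ->
  Rpower q (INR n * (INR n - 1) - (INR N - INR n) * (INR N - INR n - 1))
  = ((q ^ 2) ^ N) ^ n / ((q ^ 2) ^ (N * (N - 1) / 2) * (q ^ 2) ^ n).
Proof.
intro q_pos; rpow q. assert (E := INR_tri N).
replace (INR (N * (N - 1) / 2)) with (INR N * (INR N - 1) / 2) by lra. field.
Qed.

Theorem theorem3p10 :
  forall (q k1 k2 s theta psi : R) (m : Z) (n : nat),
  0 < q < 1 ->
  0 < k1 <= k2 ->
  / q <= Rabs s ->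
  (0 <= Z.of_nat n + m)%Z ->
  let Q := RtoC (q ^ 2) in
  let e := cis theta in
  let D := ((Rpower q (2 * k2 - 2 * k1 - 2 * IZR m + 2))%R * e / s)%C in
  (forall j : nat, (1 - D * Q ^ j)%C <> 0%C) ->
  is_series
    (fun p : nat =>
       coef q k1 k2 s theta m n p
       * al_salam_chihara (Z.of_nat n + m) (cos theta)
           (s * Rpower q (2 * k1 - 2 * k2 - 2 * INR p))%R
           (Rpower q (2 * k1 + 2 * k2 + 2 * INR p) / s)%R Q
       * al_salam_chihara (Z.of_nat n)
           (mu (Rpower q (2 * k2 + 2 * INR p) / s)%R)
           (s * Rpower q (- 2 * k2))%R (Rpower q (- 2 * k2) / s)%R (/ Q)
       * askey_wilson p (cos psi)
           (q * e / s) (q * cis (- theta) / s)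
           (Rpower q (2 * k2 - 2 * k1 + 1))%R
           (Rpower q (2 * k1 + 2 * k2 - 1))%R Q)%C
    (cont_dual_q_hahn n (cos psi)
       (Rpower q (2 * k1 - 2 * k2 + 2 * IZR m + 1))%R
       (Rpower q (2 * k1 + 2 * k2 - 1))%R
       (Rpower q (2 * k2 - 2 * k1 + 1))%R Q
     * phi22 (q * cis (theta - psi) / s) (q * cis (theta + psi) / s)
         (q ^ 2 / s ^ 2)%R D Q
         ((Rpower q (2 * k2 - 2 * k1 - 2 * IZR m + 2))%R * cis (- theta) / s))%C.
Proof.
intros q k1 k2 s theta psi m n Hq Hk Hs Hm Q e D HD.
assert (q_pos : 0 < q) by lra.
assert (s_neq : s <> 0).
{ intro Z; rewrite Z, Rabs_R0 in Hs. assert (0 < / q) by (apply Rinv_0_lt_compat; lra). lra. }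
destruct (Z_of_nat_complete _ Hm) as [N HN].
assert (Hm' : IZR m = INR N - INR n).
{ rewrite !INR_IZR_INZ, <- HN, plus_IZR; ring. }
set (A := Rpower q (2 * k1)); set (B := Rpower q (2 * k2)).
assert (HL : ln q < 0) by (rewrite <- ln_1; apply ln_increasing; lra).
assert (A_pos : 0 < A) by apply exp_pos.
assert (B_pos : 0 < B) by apply exp_pos.
assert (A_lt : A < 1) by (rewrite <- exp_0; apply exp_increasing; nra).
assert (B_lt : B < 1) by (rewrite <- exp_0; apply exp_increasing; nra).
assert (B_le : B <= A).
{ destruct (proj2 Hk) as [Lk| ->]; [|right; reflexivity].
  left; apply exp_increasing; nra. }
set (qc := RtoC q). set (sc := RtoC s). set (Ac := RtoC A). set (Bc := RtoC B).
assert (Rneq : forall r : R, r <> 0 -> RtoC r <> 0%C) by (intros r Hr E; apply Hr; now apply RtoC_inj).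
assert (qn : qc <> 0%C) by (apply Rneq; lra).
assert (sn : sc <> 0%C) by (now apply Rneq).
assert (An : Ac <> 0%C) by (apply Rneq; lra).
assert (Bn : Bc <> 0%C) by (apply Rneq; lra).
assert (en : e <> 0%C) by apply cis_neq_0.
assert (HQ : Q = (qc ^ 2)%C) by (unfold Q; now rewrite RtoC_pow).
assert (Qn : Q <> 0%C) by (rewrite HQ; now apply Cpow_nz).
assert (q2n : q ^ 2 <> 0) by (apply pow_nonzero; lra).
assert (CQ : forall p, RtoC ((q ^ 2) ^ p) = (Q ^ p)%C) by (intro p; unfold Q; apply RtoC_pow).
set (a := (qc * e / sc)%C). set (b := (qc * cis (- theta) / sc)%C).
set (c := RtoC (Rpower q (2 * k2 - 2 * k1 + 1))).
set (d := RtoC (Rpower q (2 * k1 + 2 * k2 - 1))).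
set (tau := RtoC (s * Rpower q (- 2 * k2))).
assert (Hc : c = (Bc / Ac * qc)%C).
{ unfold c; replace (Rpower q (2 * k2 - 2 * k1 + 1)) with (B / A * q)
    by (unfold A, B; rpow q; ring). rewrite RtoC_mult, RtoC_div by lra; reflexivity. }
assert (Hd : d = (Ac * Bc / qc)%C).
{ unfold d; replace (Rpower q (2 * k1 + 2 * k2 - 1)) with (A * B / q)
    by (unfold A, B; rpow q; ring). rewrite RtoC_div, RtoC_mult by lra; reflexivity. }
assert (Ht : tau = (sc / Bc)%C).
{ unfold tau; replace (Rpower q (- 2 * k2)) with (/ B)
    by (unfold A, B; rpow q; ring). rewrite RtoC_mult, RtoC_inv by lra; reflexivity. }
assert (He : cis (- theta) = (/ e)%C) by (symmetry; apply cis_inv).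
assert (Hb : b = (qc / (e * sc))%C) by (unfold b; rewrite He; field; auto).
(* All products of two parameters needed below lie in the unit disc, because
   |a| = |b| = q / |s| is at most q^2 and k1 <= k2. *)
set (r := q / Rabs s).
assert (Hr : 0 < r <= q ^ 2).
{ unfold r; assert (0 < / q) by (apply Rinv_0_lt_compat; lra).
  split; [apply Rmult_lt_0_compat; [|apply Rinv_0_lt_compat]; lra|].
  replace (q ^ 2) with (q * / (/ q)) by (field; lra).
  apply Rmult_le_compat_l; [lra|]. apply Rinv_le_contravar; auto. }
assert (Ma : Cmod a = r).
{ unfold a, e, qc, sc; rewrite Cmod_div, Cmod_mult, !Cmod_R, Cmod_cis by auto.
  rewrite (Rabs_pos_eq q) by lra; unfold r; now rewrite Rmult_1_r. }
assert (Mb : Cmod b = r).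
{ unfold b, qc, sc; rewrite Cmod_div, Cmod_mult, !Cmod_R, Cmod_cis by auto.
  rewrite (Rabs_pos_eq q) by lra; unfold r; now rewrite Rmult_1_r. }
assert (Mc : Cmod c = B / A * q).
{ unfold c; replace (Rpower q (2 * k2 - 2 * k1 + 1)) with (B / A * q)
    by (unfold A, B; rpow q; ring). rewrite Cmod_R; apply Rabs_pos_eq.
  apply Rmult_le_pos; [|lra]. apply Rlt_le, Rdiv_lt_0_compat; lra. }
assert (Md : Cmod d = A * B / q).
{ unfold d; replace (Rpower q (2 * k1 + 2 * k2 - 1)) with (A * B / q)
    by (unfold A, B; rpow q; ring). rewrite Cmod_R; apply Rabs_pos_eq.
  apply Rlt_le, Rdiv_lt_0_compat; nra. }
assert (HBA : 0 < B / A <= 1).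
{ split; [apply Rdiv_lt_0_compat; lra|].
  apply Rmult_le_reg_r with A; auto. unfold Rdiv; rewrite Rmult_assoc, Rinv_l; lra. }
assert (Hr1 : r < 1) by nra.
assert (Q_lt : Cmod Q < 1).
{ unfold Q; rewrite Cmod_R, Rabs_pos_eq by nra. nra. }
assert (ab_lt : Cmod (a * b) < 1) by (rewrite Cmod_mult, Ma, Mb; nra).
assert (Hrc : r * (B / A * q) < 1).
{ assert (B / A * q <= 1) by nra. assert (0 <= B / A * q) by nra. nra. }
assert (ac_lt : Cmod (a * c) < 1) by (rewrite Cmod_mult, Ma, Mc; exact Hrc).
assert (bc_lt : Cmod (b * c) < 1) by (rewrite Cmod_mult, Mb, Mc; exact Hrc).
assert (ad_lt : Cmod (a * d) < 1).
{ rewrite Cmod_mult, Ma, Md.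
  apply Rle_lt_trans with (q ^ 2 * (A * B / q)).
  - apply Rmult_le_compat_r; [apply Rlt_le, Rdiv_lt_0_compat; nra | lra].
  - replace (q ^ 2 * (A * B / q)) with (q * (A * B)) by (field; lra).
    assert (A * B < 1) by nra. nra. }
assert (al_lt : Cmod (a * b * c * d / Q)%C < 1).
{ replace (a * b * c * d / Q)%C with (a * b * (c * d / Q))%C by (field; auto).
  replace (c * d / Q)%C with (Bc ^ 2 / Q)%C by (rewrite Hc, Hd; simpl Cpow; field; auto).
  rewrite !Cmod_mult, Ma, Mb. unfold Bc, Q.
  rewrite <- RtoC_pow, <- RtoC_div, Cmod_R by auto.
  rewrite Rabs_pos_eq by (apply Rlt_le, Rdiv_lt_0_compat; nra).
  apply Rle_lt_trans with (q ^ 2 * q ^ 2 * (B ^ 2 / q ^ 2)).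
  - apply Rmult_le_compat_r; [apply Rlt_le, Rdiv_lt_0_compat; nra | nra].
  - replace (q ^ 2 * q ^ 2 * (B ^ 2 / q ^ 2)) with (q ^ 2 * B ^ 2) by (field; lra).
    assert (q ^ 2 < 1) by nra. assert (B ^ 2 < 1) by nra. assert (0 < B ^ 2) by nra. nra. }
assert (bn : b <> 0%C) by (apply Cmod_gt_0; lra).
assert (cn : c <> 0%C) by (rewrite Hc; auto 10 using Cmult_neq_0, Cdiv_neq_0).
assert (dn : d <> 0%C) by (rewrite Hd; auto 10 using Cmult_neq_0, Cdiv_neq_0).
assert (tn : tau <> 0%C) by (rewrite Ht; auto 10 using Cmult_neq_0, Cdiv_neq_0).
assert (abe : a = (b * e ^ 2)%C) by (rewrite Hb; unfold a; simpl Cpow; field; auto).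
assert (abcd : (a * b * c * d * tau ^ 2 = Q)%C).
{ rewrite Hb, Hc, Hd, Ht, HQ; unfold a; simpl Cpow; field; auto. }
assert (Main := bilinear_sum Q a b c d e tau (RtoC (cos psi)) Qn Q_lt bn cn dn en tn abe abcd
  ab_lt ac_lt ad_lt bc_lt al_lt n N).
set (alpha := (a * b * c * d / Q)%C) in *.
assert (Hal : alpha = (Bc ^ 2 / sc ^ 2)%C).
{ unfold alpha; rewrite Hb, Hc, Hd, HQ; unfold a; simpl Cpow; field; auto. }
set (gam := (c * Q ^ n / Q ^ N)%C).
assert (NQ : forall p, (Q ^ p)%C <> 0%C) by (intro p; now apply Cpow_nz).
assert (s2n : s ^ 2 <> 0) by (now apply pow_nonzero).
assert (HDg : D = (a * gam)%C).
{ unfold D; rewrite Hm'.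
  replace (Rpower q (2 * k2 - 2 * k1 - 2 * (INR N - INR n) + 2)) with (B / A * q ^ 2 * (q ^ 2) ^ n / (q ^ 2) ^ N)
    by (unfold A, B; rpow q; ring).
  rewrite RtoC_div by (now apply pow_nonzero). rewrite !RtoC_mult, RtoC_div, !CQ by lra.
  fold qc sc Ac Bc. unfold gam, a; rewrite Hc. fold Q.
  assert (N1 := NQ n); assert (N2 := NQ N); revert N1 N2.
  generalize (Q ^ n)%C (Q ^ N)%C; intros u v N1 N2. rewrite HQ; simpl Cpow. field; auto. }
assert (ND := qpoch_inf_neq_0 (a * gam) Q Q_lt).
rewrite <- HDg in ND. specialize (ND HD).
assert (Nal : forall j, (1 - alpha * Q ^ j)%C <> 0%C)
  by (intro j; apply one_minus_mult_pow_neq_0; lra).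
assert (NY : qpoch_inf (alpha * Q) Q <> 0%C).
{ apply qpoch_inf_neq_0; auto; intro j. rewrite <- Cmult_assoc, <- Cpow_S; apply Nal. }
set (sig := (Q / (b * c * e))%C) in *.
assert (Hsig : sig = (sc * Ac / Bc)%C).
{ unfold sig; rewrite Hb, Hc, HQ; simpl Cpow; field; auto 10. }
set (kap := RtoC (powerRZ (-1) (Z.of_nat n + m) * Rpower q (INR n * (1 + 2 * k2))
   * powerRZ (s * Rpower q (2 * k1 - 2 * k2)) (- m)
   * Rpower q (INR n * (INR n - 1) - IZR m * (IZR m - 1)))).
set (Y := qpoch_inf (alpha * Q) Q) in *.
set (X := qpoch_inf D Q) in *.
assert (HQr : RtoC (q ^ 2) = Q) by reflexivity.
assert (H3 : forall p, RtoC (Rpower q (4 * k2 + 2 * INR p) / s ^ 2) = (alpha * Q ^ p)%C).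
{ intro p; replace (Rpower q (4 * k2 + 2 * INR p)) with (B ^ 2 * (q ^ 2) ^ p)
    by (unfold A, B; rpow q; ring).
  rewrite RtoC_div, RtoC_mult, CQ, !RtoC_pow by auto. fold sc Bc. rewrite Hal.
  generalize (Q ^ p)%C; intro u. simpl Cpow; field; auto. }
assert (H1 : RtoC (Rpower q (4 * k2 + 2) / s ^ 2) = (alpha * Q)%C).
{ rewrite <- (Cpow_1_r Q), <- H3. do 2 f_equal. simpl INR. f_equal; ring. }
assert (Hab : RtoC (q ^ 2 / s ^ 2) = (a * b)%C).
{ rewrite RtoC_div, HQr, RtoC_pow by auto. fold sc. rewrite Hb, HQ; unfold a; simpl Cpow; field; auto. }
assert (H2 : forall p, (RtoC (Rpower q (2 * k2 - 2 * k1 + 2 * INR p + 2)) * e / sc)%C = (a * c * Q ^ p)%C).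
{ intro p; replace (Rpower q (2 * k2 - 2 * k1 + 2 * INR p + 2)) with (B / A * (q ^ 2) ^ p * q ^ 2)
    by (unfold A, B; rpow q; ring).
  rewrite !RtoC_mult, RtoC_div, CQ, HQr by lra. fold Ac Bc.
  rewrite Hc; unfold a. generalize (Q ^ p)%C; intro u. rewrite HQ; simpl Cpow; field; auto. }
(* s and q are real, so conjugation exchanges e^(i theta) and e^(-i theta), that is a and b;
   the squared modulus thus becomes a product of two infinite products. *)
assert (Hconj : forall p, Cconj (a * c * Q ^ p)%C = (b * c * Q ^ p)%C).
{ intro p; unfold a, b, c, qc, sc, Q, e.
  rewrite !Cmult_conj, Cdiv_conj, Cmult_conj, Cpow_conj, !Cconj_RtoC, Cconj_cis by auto. reflexivity. }
assert (T1 : forall p, coef q k1 k2 s theta m n p = (kap / (Y * X) * weight Q a b c d p)%C).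
{ intro p; unfold coef; cbv zeta. rewrite HQr. fold kap. fold e. fold D. fold X.
  rewrite H1, H3, Hab. fold Y. fold sc. rewrite H2.
  rewrite Cmod2_conj, qpoch_inf_conj, Hconj by auto.
  replace (Cconj Q) with Q by (unfold Q; now rewrite Cconj_RtoC).
  replace (RtoC ((Rpower q (2 * k2 - 2 * k1 + 3) / s ^ 2) ^ p * Rpower q (2 * INR p * (INR p - 1))))
    with ((a * b * c) ^ p * Q ^ (p * (p - 1)))%C.
  2: { replace (Rpower q (2 * k2 - 2 * k1 + 3)) with (B / A * q ^ 3)
    by (unfold A, B; rpow q; ring).
       rewrite Rpower_quadratic by auto. rewrite RtoC_mult, CQ, RtoC_pow. f_equal; f_equal.
       rewrite RtoC_div, RtoC_mult, RtoC_div, !RtoC_pow by (auto; lra). fold Ac Bc qc sc.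
       rewrite Hb, Hc; unfold a; simpl Cpow; field; auto. }
  unfold weight. fold alpha.
  rewrite <- (alpha_coef alpha Q p Nal).
  assert (Np1 : qpoch (alpha * Q ^ p) Q p <> 0%C).
  { apply qpoch_neq_0; intro j; rewrite <- Cmult_assoc, <- Cpow_add_r; apply Nal. }
  assert (Np2 : qpoch Q Q p <> 0%C) by (apply qpoch_neq_0_lt1; lra).
  assert (Np3 : qpoch (a * b) Q p <> 0%C) by (apply qpoch_neq_0_lt1; lra).
  field; repeat split; auto. }
assert (Hneg : forall k : nat, (Z.of_nat k <? 0)%Z = false) by (intro k; apply Z.ltb_ge; lia).
assert (T2 : forall p, al_salam_chihara (Z.of_nat n + m) (cos theta)
    (s * Rpower q (2 * k1 - 2 * k2 - 2 * INR p))%R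
    (Rpower q (2 * k1 + 2 * k2 + 2 * INR p) / s)%R Q = asc Q a b c d e N p).
{ intro p; unfold al_salam_chihara; rewrite HN, Hneg, Nat2Z.id.
  unfold asc, cont_dual_q_hahn. fold alpha. fold sig.
  rewrite Hsig, Hal. unfold e at 1; rewrite mu_cis.
  f_equal.
  - replace (Rpower q (2 * k1 - 2 * k2 - 2 * INR p)) with (A / B / (q ^ 2) ^ p)
    by (unfold A, B; rpow q; ring). rewrite RtoC_mult, !RtoC_div, CQ by (try apply pow_nonzero; lra).
    fold Ac Bc sc. field; auto.
  - replace (Rpower q (2 * k1 + 2 * k2 + 2 * INR p)) with (A * B * (q ^ 2) ^ p)
    by (unfold A, B; rpow q; ring). rewrite RtoC_div, !RtoC_mult, CQ by auto.
    fold Ac Bc sc. generalize (Q ^ p)%C; intro u; simpl Cpow; field; auto. }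
assert (T3 : forall p, al_salam_chihara (Z.of_nat n)
    (mu (Rpower q (2 * k2 + 2 * INR p) / s)%R)
    (s * Rpower q (- 2 * k2))%R (Rpower q (- 2 * k2) / s)%R (/ Q) = asc_dual Q a b tau n p).
{ intro p; unfold al_salam_chihara; rewrite Hneg, Nat2Z.id.
  unfold asc_dual, cont_dual_q_hahn. fold tau.
  f_equal.
  - f_equal. replace (Rpower q (2 * k2 + 2 * INR p)) with (B * (q ^ 2) ^ p)
    by (unfold A, B; rpow q; ring). rewrite RtoC_div, RtoC_mult, CQ by auto.
    fold Bc sc. rewrite Ht; field; auto.
  - replace (Rpower q (- 2 * k2)) with (/ B)
    by (unfold A, B; rpow q; ring). rewrite RtoC_div, RtoC_inv by (auto; lra).
    fold Bc sc. rewrite Ht, Hb, HQ; unfold a; simpl Cpow; field; auto. }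
eapply is_series_Cext; [| |exact (is_series_Cscal (kap / (Y * X))%C _ _ Main)].
{ intro p; cbv beta. rewrite T1, T2, T3. fold qc sc. fold a b c d. ring. }
assert (yn := cis_neq_0 psi).
assert (Hphi : phi22 (qc * cis (theta - psi) / sc) (qc * cis (theta + psi) / sc)
         (q ^ 2 / s ^ 2)%R D Q
         ((Rpower q (2 * k2 - 2 * k1 - 2 * IZR m + 2))%R * cis (- theta) / sc)
   = (phi_reg (RtoC (cos psi)) a b Q gam / X)%C).
{ unfold X; rewrite <- mu_cis. rewrite HDg in *.
  rewrite <- phi22_phi_reg by auto.
  fold qc sc. rewrite Hab.
  replace (qc * cis (theta - psi) / sc)%C with (a / cis psi)%C.
  2: { unfold Rminus; rewrite cis_add, <- cis_inv; fold e; unfold a; field; auto. }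
  replace (qc * cis (theta + psi) / sc)%C with (a * cis psi)%C.
  2: { rewrite cis_add; fold e; unfold a; field; auto. }
  f_equal. rewrite He.
  assert (Z : (RtoC (Rpower q (2 * k2 - 2 * k1 - 2 * IZR m + 2)) * e / sc = a * gam)%C) by exact HDg.
  rewrite Hb; unfold a in Z.
  transitivity (RtoC (Rpower q (2 * k2 - 2 * k1 - 2 * IZR m + 2)) * e / sc / e ^ 2)%C.
  - simpl Cpow; field; auto.
  - rewrite Z. simpl Cpow; field; auto. }
rewrite Hphi.
assert (Hg : RtoC (Rpower q (2 * k1 - 2 * k2 + 2 * IZR m + 1)) = (Q * Q ^ N / (Q ^ n * c))%C).
{ rewrite Hm'.
  replace (Rpower q (2 * k1 - 2 * k2 + 2 * (INR N - INR n) + 1)) with (A / B * q * (q ^ 2) ^ N / (q ^ 2) ^ n)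
    by (unfold A, B; rpow q; ring).
  rewrite RtoC_div by (now apply pow_nonzero). rewrite !RtoC_mult, RtoC_div, !CQ by lra.
  fold qc Ac Bc. rewrite Hc.
  assert (N1 := NQ n); revert N1.
  generalize (Q ^ n)%C (Q ^ N)%C; intros u v N1. rewrite HQ; simpl Cpow. field; auto. }
unfold closed_form. fold gam. fold c d. rewrite Hg.
(* The signs and the powers of s, q and Q in the coefficient are the inverse of those in the
   constant of the closed form, so that only (alpha Q;Q)_oo is left. *)
assert (HK : (kap * closed_form_const Q a b c d e tau n N = Y)%C).
{ unfold closed_form_const. fold alpha sig Y. unfold kap.
  rewrite HN, <- pow_powerRZ, Hm', Rpower_quadratic_diff by auto.
  replace (Rpower q (INR n * (1 + 2 * k2))) with ((q * B) ^ n)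
    by (unfold A, B; rpow q; ring).
  replace (Rpower q (2 * k1 - 2 * k2)) with (A / B)
    by (unfold A, B; rpow q; ring).
  assert (sAB : s * (A / B) <> 0).
  { apply Rmult_integral_contrapositive; split; auto. apply Rgt_not_eq, Rdiv_lt_0_compat; lra. }
  replace (- m)%Z with (Z.of_nat n + - Z.of_nat N)%Z by lia.
  rewrite powerRZ_add, powerRZ_neg', <- !pow_powerRZ by auto.
  assert (Ck : RtoC ((-1) ^ N * (q * B) ^ n * ((s * (A / B)) ^ n * / (s * (A / B)) ^ N)
      * (((q ^ 2) ^ N) ^ n / ((q ^ 2) ^ (N * (N - 1) / 2) * (q ^ 2) ^ n)))
    = (RtoC (-1) ^ N * (qc * Bc) ^ n * (sig ^ n / sig ^ N)
      * ((Q ^ N) ^ n / (Q ^ (N * (N - 1) / 2) * Q ^ n)))%C).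
  { assert (Sg : RtoC (s * (A / B)) = sig).
    { rewrite Hsig, RtoC_mult, RtoC_div by lra. fold sc Ac Bc. field; auto. }
    rewrite !RtoC_mult, RtoC_inv, RtoC_div, RtoC_mult, !CQ
      by (try apply Rmult_integral_contrapositive; try split; now apply pow_nonzero).
    rewrite !(RtoC_pow (s * (A / B))), Sg, (RtoC_pow (-1)), (RtoC_pow (q * B)),
      (RtoC_pow ((q ^ 2) ^ N)), CQ, RtoC_mult. reflexivity. }
  rewrite Ck.
  assert (sgn : sig <> 0%C) by (rewrite Hsig; auto 10 using Cmult_neq_0, Cdiv_neq_0).
  replace (- sig)%C with (RtoC (-1) * sig)%C by ring.
  assert (E1 : (RtoC (-1) ^ N * RtoC (-1) ^ N = 1)%C).
  { rewrite <- Cpow_mult_l. replace (RtoC (-1) * RtoC (-1))%C with (RtoC 1) by ring. apply Cpow_1_l. }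
  assert (E2 : ((qc * Bc) ^ n * sig ^ n = Q ^ n * (d * tau) ^ n)%C).
  { rewrite <- !Cpow_mult_l; f_equal. rewrite Hsig, Hd, Ht, HQ; simpl Cpow; field; auto. }
  rewrite (Cpow_mult_l _ sig N), (Cpow_mult_l (d * tau) _ n).
  assert (Nn := Cpow_nz _ n (Cmult_neq_0 _ _ dn tn)).
  assert (Ns := Cpow_nz _ N sgn). assert (NNn := Cpow_nz _ n (NQ N)).
  transitivity (Y * (RtoC (-1) ^ N * RtoC (-1) ^ N) * ((qc * Bc) ^ n * sig ^ n) / (Q ^ n * (d * tau) ^ n))%C.
  - field; auto 10.
  - rewrite E1, E2; field; auto. }
transitivity (kap * closed_form_const Q a b c d e tau n N / Y * (cont_dual_q_hahn n (cos psi) (Q * Q ^ N / (Q ^ n * c)) d c Q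
  * (phi_reg (cos psi) a b Q gam / X)))%C.
{ field; auto. }
rewrite HK; field; auto.
Qed.
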